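(* Let $T\subset\mathbb{R}^d$ be compact and let $f:T\to\mathbb{R}$ be a mean zero Gaussian random field satisfying conditions (B1) and (B2) of the context, whose global maximum over $T$ is almost surely attained at a single point. Then there exist constants $c\in(0,\infty)$, $b_0$ and $\varepsilon_0>0$ such that for any $\varepsilon/b$-regular discretizations $\widetilde T$ of $T$ $$\sup_{b>b_0,\ \varepsilon\in(0,\varepsilon_0]}\frac{E^Q\widetilde L_b^2}{P^2(\sup_{t\in T}f(t)>b)}\le\sup_{b>b_0,\ \varepsilon\in(0,\varepsilon_0]}\frac{E^Q\widetilde L_b^2}{P^2(\sup_{t\in\widetilde T}f(t)>b)}\le c .$$
   Context: Notation. $|x|=\sum_{j=1}^d|x_j|$; $m$ is Lebesgue measure; $B(t,\varepsilon)=\{s:|t-s|\le\varepsilon\}$; $\operatorname{Var}(f(t))>0$. (B1) $f$ is homogeneous (its law is invariant under translations) and almost surely twice continuously differentiable. (B2) $0\in T\subset\mathbb{R}^d$ is a $d$-dimensional convex set with nonempty interior; its boundary $\partial T$ is a $(d-1)$-dimensional manifold without boundary; and there exists $\kappa_0>0$ with $m(B(t,\varepsilon)\cap T)\ge\kappa_0\varepsilon^d$ for all $t\in T$ and $\varepsilon<1$. A finite set $\widetilde T=\{t_1,\dots,t_M\}\subset T$ is a $\theta$-regular discretization of $T$ if $\min_{i\ne j}|t_i-t_j|\ge\theta$ and $\sup_{t\in T}\min_i|t_i-t|\le2\theta$. Given an $\varepsilon/b$-regular discretization $\widetilde T=\{t_1,\dots,t_M\}$ (one for each pair $b,\varepsilon$;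 the constants do not depend on its choice), put $X_i=f(t_i)$, $X=(X_1,\dots,X_M)$. The measure $Q$ is $Q(X\in B)=\sum_{i=1}^M\frac1M P[X\in B\mid X_i>b-1/b]$, and $$\widetilde L_b=\frac{M\,P(X_1>b-1/b)}{\sum_{j=1}^M\mathbf{1}(X_j>b-1/b)}\,\mathbf{1}\Big(\max_{1\le i\le M}X_i>b\Big).$$ *)

(* Defs.v *)
From HB Require Import structures.
From mathcomp Require Import all_boot all_order all_algebra.
From mathcomp Require Import all_classical all_reals all_analysis.

Set Implicit Arguments.
Unset Strict Implicit.
Unset Printing Implicit Defensive.
Import Order.TTheory GRing.Theory Num.Theory.
Import numFieldNormedType.Exports.

Local Open Scope classical_set_scope.
Local Open Scope ring_scope.

Section Euclidean.
Context {R : realType} {d : nat}.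
Implicit Types (x y t a b : 'rV[R]_d) (S T : set 'rV[R]_d).

(* |x| is the l1 norm; the library norm on 'rV is the sup norm. *)
Definition norm1 x : R := \sum_(j < d) `|x ord0 j|.

Definition ball1 t (e : R) : set 'rV[R]_d := [set s | norm1 (t - s) <= e].

Definition box a b : set 'rV[R]_d :=
  [set x | forall i, a ord0 i <= x ord0 i <= b ord0 i].

Definition box_volume a b : R := \prod_(i < d) (b ord0 i - a ord0 i).

(* d-dimensional Lebesgue (outer) measure: infimum of the total volume of
   countable covers by boxes. The library has no Lebesgue measure on 'rV. *)
Definition lebesgue_rV S : \bar R :=
  ereal_inf [set (\sum_(k <oo) (box_volume (ab.1 k) (ab.2 k))%:E)%E |
    ab in [set ab : (nat -> 'rV[R]_d) * (nat -> 'rV[R]_d) |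
      (forall k i, ab.1 k ord0 i <= ab.2 k ord0 i) /\
      S `<=` \bigcup_k box (ab.1 k) (ab.2 k)]].

(* S, with the subspace topology, is a k-dimensional topological manifold
   without boundary: around every point there is a chart onto an open subset of
   R^k. (Hausdorff and second countable are inherited from R^d.) *)
Definition manifold_without_boundary (k : nat) S :=
  forall x, S x ->
    exists (U : set 'rV[R]_d) (phi : 'rV[R]_d -> 'rV[R]_k)
           (psi : 'rV[R]_k -> 'rV[R]_d),
      [/\ open U /\ U x,
          open (phi @` (S `&` U)),
          {within S `&` U, continuous phi},
          {within phi @` (S `&` U), continuous psi} &
          forall y, (S `&` U) y -> psi (phi y) = y].

Definition condition_B2 T :=
  [/\ T 0,
      convex_set (T : set (convex_lmodType 'rV[R]_d)),
      interior T !=set0,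
      manifold_without_boundary d.-1 (closure T `\` interior T) &
      exists2 kappa0 : R, 0 < kappa0 &
        forall t (e : R), T t -> 0 < e < 1 ->
          ((kappa0 * e ^+ d)%:E <= lebesgue_rV (ball1 t e `&` T))%E].

Definition regular_discretization T (theta : R) (ts : seq 'rV[R]_d) :=
  [/\ forall t, t \in ts -> T t,
      forall i j, (i < size ts)%N -> (j < size ts)%N -> i != j ->
        theta <= norm1 (ts`_i - ts`_j) &
      forall t, T t -> exists2 s, s \in ts & norm1 (s - t) <= 2 * theta].

Definition twice_cont_diff (g : 'rV[R]_d -> R) :=
  [/\ forall x, differentiable g x,
      forall v x, differentiable ('D_v g) x &
      forall v w, continuous ('D_w ('D_v g))].

(* Twice continuously differentiable on the (closed) set T. *)
Definition twice_cont_diff_on T (g : 'rV[R]_d -> R) :=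
  exists2 h, twice_cont_diff h & forall t, T t -> g t = h t.

End Euclidean.

(* Normal law with mean m and standard deviation s; [normal_prob m 0] is not
   the Dirac mass in the library. *)
Definition gaussian_law {R : realType} (m s : R) (A : set R) : \bar R :=
  if s == 0 then \d_m A else normal_prob m s A.

(* A field on T is a total family f of which only the restriction to T is ever
   constrained or used. *)
Section Field.
Context {R : realType} {disp : measure_display} {Omega : measurableType disp}.
Variable P : probability Omega R.
Context {d : nat}.
Variables (T : set 'rV[R]_d) (f : 'rV[R]_d -> {RV P >-> R}).

Definition centered_gaussian_field :=
  (forall (n : nat) (t : 'I_n -> 'rV[R]_d) (a : 'I_n -> R),
     (forall i, T (t i)) ->
     exists m s : R, forall A : set R, measurable A ->
       P ((fun w => \sum_(i < n) a i * f (t i) w) @^-1` A) = gaussian_law m s A)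
  /\ (forall t, T t -> ('E_P[f t] = 0)%E).

Definition homogeneous :=
  forall (n : nat) (t : 'I_n -> 'rV[R]_d) (h : 'rV[R]_d),
    (forall i, T (t i)) -> (forall i, T (t i + h)) ->
    forall B : set (n.-tuple R), measurable B ->
      P [set w | B [tuple f (t i + h) w | i < n]] =
      P [set w | B [tuple f (t i) w | i < n]].

Definition condition_B1 :=
  homogeneous /\ {ae P, forall w, twice_cont_diff_on T (fun t => f t w)}.

Definition unique_maximum :=
  {ae P, forall w, exists! t, T t /\ forall s, T s -> f s w <= f t w}.

Definition exceedance (A : set 'rV[R]_d) (b : R) : set Omega :=
  [set w | (b%:E < ereal_sup [set (f t w)%:E | t in A])%E].

(* [exceedance T b] is in general measurable only up to a P-null set, since
   sample paths are only almost surely continuous: its probability is that given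
   by the completion of P, i.e. the outer measure P^*, which extends P. *)
Definition prob_exceedance (A : set 'rV[R]_d) (b : R) : \bar R :=
  (P^*)%mu (exceedance A b).

Section Estimator.
Variables (b : R) (ts : seq 'rV[R]_d).
Let M := size ts.

(* the event X_(i+1) > b - 1/b *)
Definition high (i : nat) : set Omega := [set w | b - b^-1 < f ts`_i w].

(* Q(X \in B) is [Q_b (X @^-1` B)]: Q is carried by Omega itself. *)
Definition Q_b (A : set Omega) : \bar R :=
  (\sum_(i < M) (M%:R^-1)%:E * (P (A `&` high i) / P (high i)))%E.

Lemma measurable_high i : measurable (high i).
Proof.
rewrite -[high i]setTI; have -> : high i = f ts`_i @^-1` `]b - b^-1, +oo[.
  by apply/seteqP; split => w; rewrite /high /= in_itv/= andbT.
exact: measurable_funP.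
Qed.

Let weight i : R := M%:R^-1 * (fine (P (high i)))^-1.

Let weight_ge0 i : 0 <= weight i.
Proof. by rewrite /weight mulr_ge0 ?invr_ge0// fine_ge0. Qed.

Let Q_bE A : measurable A -> Q_b A =
  msum (fun i => mscale (NngNum (weight_ge0 i))
                        (mrestr P (measurable_high i))) M A.
Proof.
move=> mA; apply: eq_bigr => i _.
transitivity ((weight i)%:E * P (A `&` high i))%E; last by [].
rewrite /weight EFinM -muleA; congr (_ * _)%E.
have mH := measurable_high i.
have [P0|P0] := eqVneq (P (high i)) 0%E.
  have -> : P (A `&` high i) = 0%E.
    apply: (subset_measure0 (mu := P) _ mH) => //; exact: measurableI.
  by rewrite mul0e mule0.
have PE := fineK (fin_num_measure P _ mH).
have P0' : fine (P (high i)) != 0 by rewrite -eqe PE.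
by rewrite [RHS]muleC -[in LHS]PE inver (negPf P0').
Qed.

Let Q_b0 : Q_b set0 = 0%E.
Proof. by rewrite Q_bE// measure0. Qed.

Let Q_b_ge0 A : (0 <= Q_b A)%E.
Proof.
apply: sume_ge0 => i _; rewrite mule_ge0 ?lee_fin ?invr_ge0//.
by rewrite mule_ge0// inve_ge0.
Qed.

Let Q_b_semi_sigma_additive : semi_sigma_additive Q_b.
Proof.
move=> F mF tF mUF; rewrite Q_bE//.
rewrite (_ : (fun n => _) = (fun n =>
    \sum_(0 <= i < n) msum (fun i => mscale (NngNum (weight_ge0 i))
      (mrestr P (measurable_high i))) M (F i)))%E.
  exact: measure_semi_sigma_additive.
by apply/funext => n; apply: eq_bigr => i _; rewrite Q_bE.
Qed.

HB.instance Definition _ :=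
  isMeasure.Build _ _ _ Q_b Q_b0 Q_b_ge0 Q_b_semi_sigma_additive.

(* The supremum over the finite set [set` ts] is the maximum of the X_i. *)
Definition L_b (w : Omega) : R :=
  M%:R * fine (P (high 0%N)) / (\sum_(j < M) \1_(high j) w) *
  \1_(exceedance [set` ts] b) w.

(* E^Q L_b^2 / P^2(sup_A f > b) *)
Definition second_moment_ratio (A : set 'rV[R]_d) : \bar R :=
  ((\int[Q_b]_w ((L_b w) ^+ 2)%:E) / (prob_exceedance A b ^+ 2))%E.

End Estimator.
End Field.

(* Main.v *)
(* With p = P(X_1 > b - 1/b), G = {max X_i > b} and N = #{j : X_j > b - 1/b}, one
   has E^Q L_b^2 = M p E[1/N; G]. Write Psi for the Gaussian tail at level b: then
   p <= C Psi, packing gives M <= C (b/e)^d, and it remains to prove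
     E[1/N; G] <= C e^d b^d Psi   and   P(G) >= c b^d Psi.
   The upper bound is a chaining argument in each cell of diameter 1/b: the event
   that the oscillation parameter equals y has probability at most
   C 2^-y (y+1)^-2d Psi, and on it 1/N <= C e^d (y+1)^2d. The joint tails are reduced
   to one-dimensional half-spaces, so that only laws of linear combinations enter.
   The lower bound is Bonferroni's inequality on a grid of mesh K/b, and requires
   the increments of f to be nondegenerate in all directions. This is where the
   unique maximum is used: let J be a maximal set of coordinates along which f is
   nondegenerate. If J is proper, f is constant along the fibres of a linear
   projection onto the coordinates in J, so uniqueness forces the maximizer onto a
   part of the boundary whose projection has only C b^(#|J|-1) points at distance
   1/b; chaining then gives P(sup f > b) <= C b^(#|J|-1) Psi, contradicting the grid
   bound c b^#|J| Psi. *)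
Require Import Defs.
From HB Require Import structures.
From mathcomp Require Import all_boot all_order all_algebra.
From mathcomp Require Import all_classical all_reals all_analysis.
From mathcomp Require Import measurable_realfun.
From mathcomp Require Import ring lra.

Set Implicit Arguments.
Unset Strict Implicit.
Unset Printing Implicit Defensive.
Import Order.TTheory GRing.Theory Num.Theory.
Import numFieldNormedType.Exports.

Local Open Scope classical_set_scope.
Local Open Scope ring_scope.

(** The scales explain the exponents. Increments over distance $4^{-n}/b$ are compared with
    $y2^{-n}/b$: the spare factor $2^n$ pays for the number of links at level $n$, of order
    $4^{2dn}$. Conversely, an oscillation parameter $y$ keeps the field within $1/b$ of its value
    over a distance of order $(y+1)^{-2}/b$, and the $d$-dimensional volume of that ball is the
    source of the power $2d$. The obstacle is the variance of the relaxed half-spaces: it must be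
    $\sigma^2+O(b^{-2})$, because an excess of order $1/b$ would multiply the tail by $e^{O(b)}$.
    The constant variance of the field helps here: $(f(u)+f(v))/2$ is uncorrelated with $f(u)-f(v)$,
    so the covariance of $f(x)$ with an increment is a product of two small distances. Smoothness of
    the paths enters through a Lipschitz bound on the $L^2$ size of increments, extracted from a
    small-ball estimate. Chaining is carried out through a map [pi], since it serves twice: with the
    identity for the upper bound, and with the linear projection for the contradiction. *)

Section GaussTail.
Context {R : realType}.
Implicit Types (x z s m : R).
Local Notation mu := (@lebesgue_measure R).

Lemma normal_pdf_nz m s x : s != 0 ->
  normal_pdf m s x = normal_peak s * expR (- (x - m) ^+ 2 / (s ^+ 2 *+ 2)).
Proof. by move=> s0; rewrite normal_pdfE. Qed.

Lemma normal_peak1_le1 : normal_peak (1 : R) <= 1.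
Proof.
rewrite /normal_peak invf_le1; last first.
  by rewrite sqrtr_gt0 expr1n mul1r mulrn_wgt0 ?pi_gt0.
rewrite -[leLHS]sqrtr1 ler_sqrt expr1n mul1r.
  by have := pi_ge2 R; lra.
by have := pi_ge2 R; lra.
Qed.

Definition gauss_tail z : R := fine (normal_prob 0 1 `]z, +oo[).

Lemma gauss_tailE z : (gauss_tail z)%:E = normal_prob 0 1 `]z, +oo[.
Proof. by rewrite /gauss_tail fineK ?fin_num_measure. Qed.

Lemma gauss_tail_closed z : (gauss_tail z)%:E =
  (\int[mu]_(x in `[z, +oo[) (normal_pdf 0 1 x)%:E)%E.
Proof.
rewrite gauss_tailE /normal_prob integral_itv_obnd_cbnd//.
by apply/measurable_EFinP/measurable_funTS; exact: measurable_normal_pdf.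
Qed.

Lemma gauss_tail_ge0 z : 0 <= gauss_tail z.
Proof. by rewrite fine_ge0. Qed.

Lemma is_derive_normal_pdf m s x : s != 0 ->
  is_derive x 1 (normal_pdf m s : R^o -> R^o)
    (- (x - m) / s ^+ 2 * normal_pdf m s x).
Proof.
move=> s0.
have -> : normal_pdf m s = (fun y => normal_peak s * expR (- (y - m) ^+ 2 / (s ^+ 2 *+ 2))).
  by apply/funext => y; rewrite normal_pdf_nz.
apply: is_derive_eq.
rewrite /GRing.scale/= subr0 mulr0 mulr1.
by field.
Qed.

Lemma cvg_normal_pdfy m s : s != 0 -> normal_pdf m s x @[x --> +oo%R] --> (0 : R).
Proof.
move=> s0.
have -> : normal_pdf m s = (fun y => normal_peak s * expR (- ((y - m) ^+ 2 / (s ^+ 2 *+ 2)))).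
  by apply/funext => y; rewrite normal_pdf_nz// mulNr.
rewrite -[0 : R](mulr0 (normal_peak s)); apply: cvgMr.
apply: (@cvg_comp _ _ _ (fun x => (x - m) ^+ 2 / (s ^+ 2 *+ 2)) (fun u : R => expR (- u)));
  last exact: cvgr_expR.
apply: gt0_cvgMly.
  by rewrite invr_gt0 pmulrn_lgt0// exprn_even_gt0.
apply: (@cvg_comp _ _ _ (fun x => (x - m)) (fun u : R => u ^+ 2)); last exact: cvgr_expr2.
exact: cvg_addrr.
Qed.

Lemma integral_center_normal_pdf m s : s != 0 ->
  (\int[mu]_(x in `[m, +oo[) ((x - m) * normal_pdf m s x)%:E)%E =
  (s ^+ 2 * normal_peak s)%:E.
Proof.
move=> s0.
have dF x : is_derive x 1 (fun y : R^o => - (s ^+ 2 * normal_pdf m s y) : R^o)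
    ((x - m) * normal_pdf m s x).
  have D := is_derive_normal_pdf m x s0.
  apply: is_derive_eq; rewrite /GRing.scale/=; by field.
rewrite (@ge0_continuous_FTC2y _ _ (fun y => - (s ^+ 2 * normal_pdf m s y)) _ 0).
- rewrite normal_pdf_nz// subrr expr0n/= oppr0 mul0r expR0 mulr1.
  by rewrite opprK -EFinD add0r.
- by move=> x mx; rewrite mulr_ge0 ?normal_pdf_ge0 ?subr_ge0.
- apply: continuous_subspaceT => x; apply: cvgM; last exact: continuous_normal_pdf.
  by apply: cvgB; [exact: cvg_id|exact: cvg_cst].
- rewrite -[0 : R]oppr0 -(mulr0 (s ^+ 2)); apply: cvgN; apply: cvgMr.
  exact: cvg_normal_pdfy.
- by move=> x _; have [] := dF x.
- apply: cvg_at_right_filter; apply: cvgN; apply: cvgMr; exact: continuous_normal_pdf.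
- by move=> x _; rewrite derive1E; exact: derive_val.
Qed.

(** On $[z,\infty)$ the density is at most $x/z$ times itself, and that product has the explicit
    primitive $-\varphi(x)/z$. *)
Lemma gauss_tail_le z : 0 < z ->
  gauss_tail z <= normal_pdf 0 1 z / z.
Proof.
move=> z0; rewrite -lee_fin gauss_tail_closed.
have dF x : is_derive x 1 (fun y : R^o => - (normal_pdf 0 1 y / z) : R^o)
    (x / z * normal_pdf 0 1 x).
  have D := is_derive_normal_pdf 0 x (oner_neq0 R).
  apply: is_derive_eq; rewrite /GRing.scale/=; field; exact: lt0r_neq0.
have cI : continuous (fun x : R => x / z * normal_pdf 0 1 x).
  move=> x; apply: cvgM; last by apply: continuous_normal_pdf; exact: oner_neq0.
  by apply: cvgMl; exact: cvg_id.
have <- : (\int[mu]_(x in `[z, +oo[) (x / z * normal_pdf 0 1 x)%:E =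
          (normal_pdf 0 1 z / z)%:E)%E.
  rewrite (@ge0_continuous_FTC2y _ _ (fun y => - (normal_pdf 0 1 y / z)) _ 0).
  - by rewrite sub0e -EFinN opprK.
  - move=> x mx; rewrite mulr_ge0 ?normal_pdf_ge0 ?divr_ge0// ?(ltW z0)//.
    by rewrite (le_trans (ltW z0)).
  - exact: continuous_subspaceT.
  - rewrite -[0 : R]oppr0 -(mul0r (z^-1)); apply: cvgN; apply: cvgMl.
    by apply: cvg_normal_pdfy; exact: oner_neq0.
  - by move=> x _; have [] := dF x.
  - apply: cvg_at_right_filter; apply: cvgN; apply: cvgMl.
    by apply: continuous_normal_pdf; exact: oner_neq0.
  - by move=> x _; rewrite derive1E; exact: derive_val.
apply: ge0_le_integral => //=.
- by move=> x _; rewrite lee_fin normal_pdf_ge0.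
- by apply/measurable_EFinP/measurable_funTS; exact: measurable_normal_pdf.
- by apply/measurable_EFinP/measurable_funTS; exact: continuous_measurable_fun.
- move=> x; rewrite in_itv/= andbT => zx; rewrite lee_fin ler_peMl ?normal_pdf_ge0//.
  by rewrite ler_pdivlMr// mul1r.
Qed.

(** Only the interval $[z, z+1/z]$ is kept; on it the exponent $x^2/2$ grows by at most $1 +
    1/(2z^2) \le 3/2$. *)
Lemma gauss_tail_ge z : 1 <= z ->
  normal_pdf 0 1 z / z * expR (- (3 / 2)) <= gauss_tail z.
Proof.
move=> z1; have z0 : 0 < z by apply: lt_le_trans z1.
rewrite -lee_fin gauss_tail_closed.
apply: (@le_trans _ _ (\int[mu]_(x in `[z, (z + z^-1)%R]) (normal_pdf 0 1 x)%:E)%E); last first.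
  apply: ge0_subset_integral => //=.
  - by apply/measurable_EFinP/measurable_funTS; exact: measurable_normal_pdf.
  - by move=> x _; rewrite lee_fin normal_pdf_ge0.
  - by move=> x/=; rewrite !in_itv/= andbT => /andP[].
apply: (@le_trans _ _ (\int[mu]_(x in `[z, (z + z^-1)%R]) (cst (normal_pdf 0 1 z * expR (- (3 / 2)))%:E) x)%E).
  rewrite integral_cst//= lebesgue_measure_itv/= lte_fin ltrDl invr_gt0 z0.
  by rewrite -EFinD -EFinM lee_fin addrAC subrr add0r mulrAC.
apply: ge0_le_integral => //=.
- by move=> x _; rewrite lee_fin mulr_ge0 ?normal_pdf_ge0 ?expR_ge0.
- by apply/measurable_EFinP/measurable_funTS; exact: measurable_normal_pdf.
- move=> x; rewrite in_itv/= => /andP[zx xz]; rewrite lee_fin.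
  rewrite !normal_pdf_nz ?oner_neq0// -mulrA ler_wpM2l ?normal_peak_ge0//.
  rewrite -expRD ler_expR expr1n !subr0.
  have zi1 : z^-1 <= 1 by rewrite invf_le1.
  have zz : z * z^-1 = 1 by rewrite divff ?lt0r_neq0.
  have zi0 : 0 < z^-1 by rewrite invr_gt0.
  set w := z^-1 in xz zi1 zz zi0 *.
  have : x ^+ 2 <= (z + w) ^+ 2 by rewrite lerXn2r ?nnegrE; nra.
  by nra.
Qed.

Lemma normal_prob_small_ball k : 0 <= k ->
  (normal_prob (0 : R) 1 `[(- k)%R, k] <= (2 * k)%:E)%E.
Proof.
move=> k0; apply: (@le_trans _ _ (\int[mu]_(x in `[(- k)%R, k]) (cst 1%:E) x)%E).
  apply: ge0_le_integral => //=.
  - by move=> x _; rewrite lee_fin normal_pdf_ge0.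
  - by apply/measurable_EFinP/measurable_funTS; exact: measurable_normal_pdf.
  - move=> x _; rewrite lee_fin (le_trans (normal_pdf_ub _ _ (oner_neq0 R)))//.
    exact: normal_peak1_le1.
rewrite integral_cst//= lebesgue_measure_itv/= mul1e.
case: ifPn => _; last by rewrite lee_fin mulr_ge0.
by rewrite -EFinB lee_fin; lra.
Qed.

(* ∫ x² dN(0,1); its value (1) is not needed, only its scaling behaviour. *)
Definition normal_moment2 : \bar R := (\int[mu]_x (x ^+ 2 * normal_pdf 0 1 x)%:E)%E.

Lemma normal_moment2_scale s : 0 < s ->
  (\int[mu]_x (x ^+ 2 * normal_pdf 0 s x)%:E = (s ^+ 2)%:E * normal_moment2)%E.
Proof.
move=> s0; have sn0 : s != 0 by exact: lt0r_neq0.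
pose F (x : R^o) : R^o := x / s.
have F'E : F^`()%classic = cst s^-1.
  apply/funext => x; rewrite derive1E.
  apply: derive_val; apply: is_derive_eq; rewrite /GRing.scale/= mulr0 add0r mulr1//.
have s2 : 0 < s ^+ 2 by rewrite exprn_gt0.
rewrite /normal_moment2 -ge0_integralZl//=; last 3 first.
- apply/measurable_EFinP/measurable_funM => //; exact: measurable_normal_pdf.
- by move=> x _; rewrite lee_fin mulr_ge0 ?sqr_ge0 ?normal_pdf_ge0.
- by rewrite lee_fin ltW.
under [RHS]eq_integral do rewrite -EFinM.
rewrite (@increasing_ge0_integration_by_substitutionT _ F (fun x => s ^+ 2 * (x ^+ 2 * normal_pdf 0 1 x))).
- apply: eq_integral => x _; congr EFin; rewrite F'E /=/F.
  transitivity (s ^+ 2 * ((x / s) ^+ 2 * normal_pdf 0 1 (x / s)) / s); last by [].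
  rewrite !normal_pdf_nz ?oner_neq0// !subr0 expr1n.
  have -> : - (x / s) ^+ 2 / (1 *+ 2) = - x ^+ 2 / (s ^+ 2 *+ 2) by field.
  have -> : normal_peak s = normal_peak 1 / s.
    rewrite /normal_peak -mulrnAr -(mulrnAr (1 ^+ 2)) (sqrtrM _ (sqr_ge0 s)) sqrtr_sqr gtr0_norm//.
    by rewrite expr1n mul1r invfM mulrC.
  by field.
- by move=> x y xy; rewrite /F ltr_pM2r// invr_gt0.
- by rewrite F'E => x; exact: cvg_cst.
- by rewrite F'E; exact: is_cvg_cst.
- by rewrite F'E; exact: is_cvg_cst.
- by move=> x; apply: derivableM.
- by apply/gt0_cvgMlNy; [rewrite invr_gt0|exact: cvg_id].
- by apply/gt0_cvgMly; [rewrite invr_gt0|exact: cvg_id].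
- move=> x; apply: cvgMr; apply: cvgM; first exact: exprn_continuous.
  by apply: continuous_normal_pdf; exact: oner_neq0.
- by move=> x; rewrite mulr_ge0 ?(ltW s2)// mulr_ge0 ?sqr_ge0 ?normal_pdf_ge0.
Qed.

Lemma normal_moment2_gt0 : (0 < normal_moment2)%E.
Proof.
have T1 : 0 < gauss_tail 1.
  apply: lt_le_trans (gauss_tail_ge (lexx 1)).
  rewrite divr1 mulr_gt0 ?expR_gt0// normal_pdf_nz ?oner_neq0// mulr_gt0 ?expR_gt0//.
  exact/normal_peak_gt0/oner_neq0.
rewrite (@lt_le_trans _ _ (gauss_tail 1)%:E)// gauss_tail_closed.
apply: (@le_trans _ _ (\int[mu]_(x in `[1%R, +oo[) (x ^+ 2 * normal_pdf 0 1 x)%:E)%E).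
  apply: ge0_le_integral => //=.
  - by move=> x _; rewrite lee_fin normal_pdf_ge0.
  - by apply/measurable_EFinP/measurable_funTS; exact: measurable_normal_pdf.
  - apply/measurable_EFinP/measurable_funTS/measurable_funM => //; exact: measurable_normal_pdf.
  - move=> x; rewrite in_itv/= andbT => x1; rewrite lee_fin ler_peMl ?normal_pdf_ge0//.
    by rewrite expr_ge1// (le_trans ler01).
apply: ge0_subset_integral => //=.
- apply/measurable_EFinP/measurable_funM => //; exact: measurable_normal_pdf.
- by move=> x _; rewrite lee_fin mulr_ge0 ?sqr_ge0 ?normal_pdf_ge0.
Qed.

(** The integrand is dominated by a multiple of the normal density with doubled standard deviation:
    the exponents differ by $3(x-m)^2/(8s^2)$, and $e^u \ge 1+u$ absorbs the square. *)
Lemma center_normal_moment2_fin m s : s != 0 ->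
  (\int[mu]_x ((x - m) ^+ 2 * normal_pdf m s x)%:E < +oo)%E.
Proof.
move=> s0; have s20 : 2 * s != 0 by rewrite mulf_neq0// pnatr_eq0.
have p10 := normal_peak_gt0 s0.
have p20 := normal_peak_gt0 s20.
have ss0 : 0 < s ^+ 2 by rewrite exprn_even_gt0.
pose c : R := 8 * s ^+ 2 * normal_peak s / normal_peak (2 * s).
have c0 : 0 <= c.
  by rewrite /c divr_ge0 ?(ltW p20)// mulr_ge0 ?(ltW p10)// mulr_ge0 ?(ltW ss0).
apply: (@le_lt_trans _ _ (\int[mu]_x (c%:E * (normal_pdf m (2 * s) x)%:E))%E).
  apply: ge0_le_integral => //=.
  - by move=> x _; rewrite lee_fin mulr_ge0 ?sqr_ge0 ?normal_pdf_ge0.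
  - apply/measurable_EFinP/measurable_funM => //; last exact: measurable_normal_pdf.
    by apply: measurable_funX; exact: measurable_funB.
  - apply/measurable_EFinP/measurable_funM => //; exact: measurable_normal_pdf.
  - move=> x _; rewrite lee_fin (normal_pdf_nz _ _ s0) (normal_pdf_nz _ _ s20).
    have -> : c * (normal_peak (2 * s) * expR (- (x - m) ^+ 2 / ((2 * s) ^+ 2 *+ 2))) =
        normal_peak s * (8 * s ^+ 2 * expR (- (x - m) ^+ 2 / ((2 * s) ^+ 2 *+ 2))).
      by rewrite /c; field; exact: lt0r_neq0.
    rewrite mulrCA ler_wpM2l ?(ltW p10)//.
    have -> : expR (- (x - m) ^+ 2 / (s ^+ 2 *+ 2)) =
        expR (- (x - m) ^+ 2 / ((2 * s) ^+ 2 *+ 2)) * expR (- (3 / 8 * ((x - m) ^+ 2 / s ^+ 2))).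
      by rewrite -expRD; congr expR; field.
    rewrite mulrCA mulrC ler_wpM2r ?expR_ge0// -ler_pdivlMr ?expR_gt0//.
    rewrite -expRN opprK (le_trans _ (ler_wpM2l _ (expR_ge1Dx _)))//; last first.
      by rewrite mulr_ge0// ltW.
    have -> : 8 * s ^+ 2 * (1 + 3 / 8 * ((x - m) ^+ 2 / s ^+ 2)) =
        8 * s ^+ 2 + 3 * (x - m) ^+ 2 by field.
    by have := sqr_ge0 (x - m); lra.
rewrite ge0_integralZl//=; first by rewrite integral_normal_pdf mule1 ltry.
- by apply/measurable_EFinP; exact: measurable_normal_pdf.
- by move=> x _; rewrite lee_fin normal_pdf_ge0.
Qed.

Lemma normal_moment2_fin_num : normal_moment2 \is a fin_num.
Proof.
rewrite ge0_fin_numE ?(ltW normal_moment2_gt0)//.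
have := center_normal_moment2_fin 0 (oner_neq0 R).
by under eq_integral do rewrite subr0.
Qed.

End GaussTail.

(** * Integration against a normal law, and moments of a variable with such a law *)

Section NormalIntegral.
Context {R : realType}.
Variables (m s : R).
Local Notation mu := (@lebesgue_measure R).
Import HBNNSimple.

Let pdf_ge0 x : (0 <= (normal_pdf m s x)%:E)%E.
Proof. by rewrite lee_fin normal_pdf_ge0. Qed.

Let mpdf : measurable_fun [set: R] (fun x => (normal_pdf m s x)%:E).
Proof. by apply/measurable_EFinP; exact: measurable_normal_pdf. Qed.

Let integral_indic_normal (A : set (measurableTypeR R)) : measurable A ->
  (\int[normal_prob m s]_x (\1_A x)%:E =
   \int[mu]_x ((\1_A x)%:E * (normal_pdf m s x)%:E))%E.
Proof.
move=> mA; rewrite integral_indic//= setIT /normal_prob integral_mkcond/=.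
apply: eq_integral => x _; rewrite patchE indicE.
by case: (x \in A); rewrite ?mul1e ?mul0e.
Qed.

Let integral_nnsfun_normal (h : {nnsfun measurableTypeR R >-> R}) :
  (\int[normal_prob m s]_x (h x)%:E =
   \int[mu]_x ((h x)%:E * (normal_pdf m s x)%:E))%E.
Proof.
under [LHS]eq_integral do rewrite fimfunE -fsumEFin//.
rewrite [LHS]ge0_integral_fsum//; last 2 first.
  - by move=> r; exact/measurable_EFinP/measurableT_comp.
  - by move=> n x _; rewrite EFinM nnfun_muleindic_ge0.
under [RHS]eq_integral.
  move=> x _; rewrite fimfunE -fsumEFin// ge0_mule_fsuml; last first.
    by move=> r; rewrite EFinM nnfun_muleindic_ge0.
  over.
rewrite [RHS]ge0_integral_fsum//; last 2 first.
  - move=> r; apply: emeasurable_funM => //.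
    exact/measurable_EFinP/measurableT_comp.
  - by move=> n x _; rewrite mule_ge0// EFinM nnfun_muleindic_ge0.
apply: eq_fsbigr => r _.
rewrite integralZl_indic_nnsfun//= integral_indic_normal//.
have [r0|r0] := leP 0 r.
  rewrite -ge0_integralZl//.
  - by apply: eq_integral => x _; rewrite EFinM muleA.
  - by apply: emeasurable_funM => //; exact/measurable_EFinP.
  - by move=> x _; rewrite mule_ge0// lee_fin.
have -> : h @^-1` [set r] = set0.
    apply/seteqP; split=> x //= hx; have : 0 <= h x by exact: fun_ge0.
  by rewrite hx leNgt r0.
under eq_integral do rewrite indic0 mul0e.
under [RHS]eq_integral do rewrite indic0 mulr0 mul0e.
by rewrite !integral0 mule0.
Qed.

Lemma ge0_integral_normal_prob (g : measurableTypeR R -> \bar R) :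
  measurable_fun [set: measurableTypeR R] g -> (forall x, 0 <= g x)%E ->
  (\int[normal_prob m s]_x g x = \int[mu]_x (g x * (normal_pdf m s x)%:E))%E.
Proof.
move=> mg g0; pose g_ := nnsfun_approx measurableT mg.
transitivity (limn (fun n => \int[normal_prob m s]_x (g_ n x)%:E))%E.
  rewrite -monotone_convergence//=.
  - apply: eq_integral => ? /[!inE] xD; apply/esym/cvg_lim => //=.
    exact: cvg_nnsfun_approx.
  - by move=> n; apply/measurable_EFinP; exact: measurable_funP.
  - by move=> n ? _; rewrite lee_fin.
  - by move=> ? _ ? ? mn; rewrite lee_fin; exact/lefP/nd_nnsfun_approx.
under eq_fun do rewrite integral_nnsfun_normal.
rewrite -monotone_convergence//=.
- apply: eq_integral => x _; apply/cvg_lim => //.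
  by apply: cvgeZr => //; exact: cvg_nnsfun_approx.
- move=> n; apply: emeasurable_funM => //.
  exact/measurable_EFinP/measurable_funTS.
- by move=> n x _; rewrite mule_ge0// lee_fin.
- move=> x _ a b ab; rewrite lee_wpmul2r// lee_fin.
  exact/lefP/nd_nnsfun_approx.
Qed.

End NormalIntegral.

Section NormalLaw.
Context {R : realType}.
Local Notation mu := (@lebesgue_measure R).
Context {disp : measure_display} {Omega : measurableType disp}.
Variables (P : probability Omega R) (Y : {RV P >-> R}) (m s : R).
Hypothesis lawY : forall A : set R, measurable A -> P (Y @^-1` A) = gaussian_law m s A.

Lemma ge0_integral_normal_law (g : R -> \bar R) : s != 0 ->
  measurable_fun [set: R] g -> (forall x, 0 <= g x)%E ->
  (\int[P]_w g (Y w) = \int[mu]_x (g x * (normal_pdf m s x)%:E))%E.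
Proof.
move=> s0 mg g0; rewrite -ge0_integral_normal_prob//.
have mY : measurable_fun [set: Omega] (Y : Omega -> measurableTypeR R).
  have mY : measurable_fun [set: Omega] Y by exact: measurable_funP.
  exact mY.
pose Y' : {mfun Omega >-> measurableTypeR R} :=
  HB.pack (Y : Omega -> measurableTypeR R) (isMeasurableFun.Build _ _ _ _ _ mY).
transitivity (\int[distribution P Y']_x g x)%E; first by rewrite ge0_integral_distribution.
apply: eq_measure_integral => A mA _.
by have := lawY mA; rewrite /gaussian_law (negPf s0).
Qed.

Lemma normal_law_degenerate : s = 0 -> P (Y @^-1` [set~ m]) = 0.
Proof.
move=> s0; rewrite lawY; last exact: measurableC.
by rewrite /gaussian_law s0 eqxx diracE memNset//=; apply.
Qed.

Lemma normal_law_ae : s = 0 -> {ae P, forall w, Y w = m}.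
Proof.
move=> s0; exists (Y @^-1` [set~ m]); split.
- by rewrite -[X in measurable X]setTI; apply: measurable_funP => //; exact: measurableC.
- exact: normal_law_degenerate.
- by move=> w.
Qed.

(** The positive and negative parts of [Y - m] have the same explicit integral
    [s ^+ 2 * normal_peak s], by reflection, so [Y - m] has expectation zero. If [s = 0], then [Y]
    equals [m] almost surely. *)
Lemma normal_law_mean_zero : P.-integrable setT (EFin \o Y) -> ('E_P[Y] = 0)%E -> m = 0.
Proof.
move=> iY; rewrite unlock => EY0.
have [s0|s0] := eqVneq s 0.
  have : (\int[P]_w (Y w)%:E = \int[P]_w m%:E)%E.
    apply: ae_eq_integral => //; first exact: (measurable_int P).
    by apply: filterS (normal_law_ae s0) => w /= ->.
  by rewrite EY0 integral_cst//= probability_setT mule1 => -[].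
have mpd := measurable_normal_pdf m s.
have mmax (e : R) : measurable_fun [set: R] (fun x => (Order.max (e * (x - m)) 0)%:E).
  apply/measurable_EFinP; apply: measurable_funrpos; apply: measurable_funM => //.
  exact: measurable_funB.
have pos : (\int[P]_w (Order.max (1 * (Y w - m)) 0)%:E = (s ^+ 2 * normal_peak s)%:E)%E.
  rewrite (@ge0_integral_normal_law (fun x => (Order.max (1 * (x - m)) 0)%:E))//; last first.
    by move=> x; rewrite lee_fin le_max lexx orbT.
  rewrite -(integral_center_normal_pdf m s0) [RHS]integral_mkcond/=; apply: eq_integral => x _.
  rewrite patchE mem_setE in_itv/= andbT mul1r -EFinM.
  case: ifPn => [mx|]; first by rewrite max_l// subr_ge0.
  by rewrite -ltNge => xm; rewrite max_r ?mul0r// subr_le0 ltW.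
have neg : (\int[P]_w (Order.max (-1 * (Y w - m)) 0)%:E = (s ^+ 2 * normal_peak s)%:E)%E.
  rewrite (@ge0_integral_normal_law (fun x => (Order.max (-1 * (x - m)) 0)%:E))//; last first.
    by move=> x; rewrite lee_fin le_max lexx orbT.
  rewrite -(integral_center_normal_pdf (- m) s0).
  transitivity (\int[mu]_(x in `]-oo, (- - m)%R]) ((m - x) * normal_pdf m s x)%:E)%E.
    rewrite opprK [RHS]integral_mkcond/=; apply: eq_integral => x _.
    rewrite patchE mem_setE in_itv/= mulN1r opprB -EFinM.
    case: ifPn => [mx|]; first by rewrite max_l// subr_ge0.
    by rewrite -ltNge => xm; rewrite max_r ?mul0r// subr_le0 ltW.
  rewrite (@ge0_integration_by_substitutionNy _ (fun x => (m - x) * normal_pdf m s x)).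
  - apply: eq_integral => x _; congr EFin => /=.
    rewrite !normal_pdf_nz// !opprK addrC.
    by have -> : (- x - m) ^+ 2 = (x + m) ^+ 2 by ring.
  - apply: continuous_subspaceT => x; apply: cvgM; last exact: continuous_normal_pdf.
    by apply: cvgB; [exact: cvg_cst|exact: cvg_id].
  - move=> x; rewrite in_itv/= opprK => xm.
    by rewrite mulr_ge0 ?normal_pdf_ge0 ?subr_ge0 ?ltW.
have : (\int[P]_w (Y w - m)%:E = 0)%E.
  rewrite integralE/=.
  have -> : (\int[P]_w ((fun w => (Y w - m)%:E)^\+ w) = (s ^+ 2 * normal_peak s)%:E)%E.
    by rewrite -pos; apply: eq_integral => w _; rewrite funeposE EFin_max mul1r.
  have -> : (\int[P]_w ((fun w => (Y w - m)%:E)^\- w) = (s ^+ 2 * normal_peak s)%:E)%E.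
    by rewrite -neg; apply: eq_integral => w _; rewrite funenegE EFin_max mulN1r EFinN.
  by rewrite -EFinB subrr.
under eq_integral do rewrite EFinB.
rewrite integralB//; last exact: finite_measure_integrable_cst.
rewrite EY0 integral_cst//= probability_setT mule1 sub0e => /eqP.
by rewrite oppe_eq0 => /eqP[].
Qed.

Lemma normal_law_sqr_integrable : P.-integrable setT (fun w => ((Y w) ^+ 2)%:E).
Proof.
have [s0|s0] := eqVneq s 0.
  have mY2 : measurable_fun setT (fun w => ((Y w) ^+ 2)%:E).
    by apply/measurable_EFinP/measurable_funX; exact: measurable_funP.
  apply/integrableP; split => //.
  rewrite (ae_eq_integral (cst `|(m ^+ 2)%:E|%E))//=.
  - by rewrite integral_cst//= probability_setT mule1 ltry.
  - by apply/measurable_EFinP/measurableT_comp => //; exact: measurable_funX.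
  - by apply: filterS (normal_law_ae s0) => w /= ->.
have iYm : P.-integrable setT (fun w => ((Y w - m) ^+ 2)%:E).
  apply/integrableP; split.
    by apply/measurable_EFinP/measurable_funX; apply: measurable_funB.
  under eq_integral do rewrite gee0_abs ?lee_fin ?sqr_ge0//.
  rewrite (@ge0_integral_normal_law (fun x => ((x - m) ^+ 2)%:E))//.
  - exact: center_normal_moment2_fin.
  - by apply/measurable_EFinP/measurable_funX; apply: measurable_funB.
  - by move=> x; rewrite lee_fin sqr_ge0.
apply: (@le_integrable _ _ _ P _ measurableT _
  (fun w => (2%:E * ((Y w - m) ^+ 2)%:E + (2 * m ^+ 2)%:E)%E)) => //.
- by apply/measurable_EFinP/measurable_funX; exact: measurable_funP.
- move=> w _; rewrite !gee0_abs ?lee_fin ?sqr_ge0// -?EFinM -?EFinD ?lee_fin.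
    by have := sqr_ge0 (Y w - 2 * m); nra.
  by have := sqr_ge0 (Y w - m); have := sqr_ge0 m; lra.
- apply: integrableD => //; first exact: integrableZl.
  exact: finite_measure_integrable_cst.
Qed.

Lemma normal_law_moment2 : m = 0 ->
  (\int[P]_w ((Y w) ^+ 2)%:E = (s ^+ 2)%:E * normal_moment2)%E.
Proof.
move=> m0; have [s0|s0] := eqVneq s 0.
  rewrite s0 expr0n mul0e.
  transitivity (\int[P]_w cst 0%E w)%E; last by rewrite integral0.
  apply: ae_eq_integral => //.
    by apply/measurable_EFinP/measurable_funX; exact: measurable_funP.
  by apply: filterS (normal_law_ae s0) => w /= ->; rewrite m0 expr0n.
rewrite (@ge0_integral_normal_law (fun x => (x ^+ 2)%:E))//; last 2 first.
- by apply/measurable_EFinP/measurable_funX.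
- by move=> x; rewrite lee_fin sqr_ge0.
have sE : s ^+ 2 = `|s| ^+ 2 by rewrite real_normK ?num_real.
have s0' : 0 < `|s| by rewrite normr_gt0.
have sn0 : `|s| != 0 by rewrite normr_eq0.
rewrite sE -(normal_moment2_scale s0') m0; apply: eq_integral => x _.
by rewrite -EFinM (normal_pdf_nz _ _ s0) (normal_pdf_nz _ _ sn0) /normal_peak sE.
Qed.

End NormalLaw.

Lemma gaussian_law_norm {R : realType} (s : R) (A : set R) :
  gaussian_law 0 `|s| A = gaussian_law 0 s A.
Proof.
rewrite /gaussian_law normr_eq0; have [//|s0] := eqVneq s 0.
have sn0 : `|s| != 0 by rewrite normr_eq0.
have sE : s ^+ 2 = `|s| ^+ 2 by rewrite real_normK ?num_real.
apply: eq_integral => x _.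
by rewrite (normal_pdf_nz _ _ s0) (normal_pdf_nz _ _ sn0) /normal_peak sE.
Qed.

(** * Laws of finite linear combinations of the field *)

Section FieldLaws.
Context {R : realType} {disp : measure_display} {Omega : measurableType disp}.
Variables (P : probability Omega R) (d : nat).
Variables (T : set 'rV[R]_d) (f : 'rV[R]_d -> {RV P >-> R}).
Hypothesis gf : centered_gaussian_field T f.

Definition lincomb (n : nat) (t : 'I_n -> 'rV[R]_d) (a : 'I_n -> R) (w : Omega) : R :=
  \sum_(i < n) a i * f (t i) w.

Lemma measurable_lincomb n t a : measurable_fun setT (@lincomb n t a).
Proof.
by rewrite /lincomb; apply: measurable_sum => i; apply: measurable_funM.
Qed.

HB.instance Definition _ n t a :=
  isMeasurableFun.Build _ _ _ _ (@lincomb n t a) (measurable_lincomb t a).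

Lemma lincomb_law n (t : 'I_n -> 'rV[R]_d) a : (forall i, T (t i)) ->
  exists m s, forall A : set R, measurable A ->
    P (lincomb t a @^-1` A) = gaussian_law m s A.
Proof. by move=> Tt; have [H _] := gf; exact: H. Qed.

Lemma field_law t : T t -> exists m s, forall A : set R, measurable A ->
    P (f t @^-1` A) = gaussian_law m s A.
Proof.
move=> Tt; have [m [s H]] := @lincomb_law 1 (fun=> t) (fun=> 1) (fun=> Tt).
exists m, s => A mA; rewrite -H//; congr (P _); apply/seteqP; split => w /=;
  by rewrite /lincomb big_ord1 mul1r.
Qed.

(* Normalising by the second moment of N(0,1) makes [cov t t] the variance
   parameter of the law of [f t] without evaluating that moment. *)
Definition cov (s t : 'rV[R]_d) : R :=
  fine (\int[P]_w (f s w * f t w)%:E) / fine (@normal_moment2 R).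

Definition quad n (t : 'I_n -> 'rV[R]_d) (a : 'I_n -> R) : R :=
  \sum_(i < n) \sum_(j < n) a i * a j * cov (t i) (t j).

Lemma integrable_field_mul s t : T s -> T t ->
  P.-integrable setT (fun w => (f s w * f t w)%:E).
Proof.
move=> /field_law[m1 [s1 L1]] /field_law[m2 [s2 L2]].
apply: (@le_integrable _ _ _ P _ measurableT _
    (fun w => ((f s w ^+ 2)%:E + (f t w ^+ 2)%:E)%E)) => //.
- by apply/measurable_EFinP/measurable_funM.
- move=> w _; rewrite /= lee_fin (ger0_norm (addr_ge0 (sqr_ge0 _) (sqr_ge0 _))).
  by rewrite ler_norml; apply/andP; split;
    have := sqr_ge0 (f s w + f t w); have := sqr_ge0 (f s w - f t w);
    have := sqr_ge0 (f s w); have := sqr_ge0 (f t w); nra.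
- apply: integrableD => //; [exact: (normal_law_sqr_integrable L1)|exact: (normal_law_sqr_integrable L2)].
Qed.

Lemma integrable_field t : T t -> P.-integrable setT (EFin \o f t).
Proof.
move=> /field_law[m1 [s1 L1]].
apply: (@le_integrable _ _ _ P _ measurableT _
    (fun w => ((f t w ^+ 2)%:E + 1%:E)%E)) => //.
- by apply/measurable_EFinP.
- move=> w _; rewrite /= lee_fin (ger0_norm (addr_ge0 (sqr_ge0 _) ler01)).
  by rewrite ler_norml; apply/andP; split;
    have := sqr_ge0 (f t w + 1); have := sqr_ge0 (f t w - 1); nra.
- apply: integrableD => //; first exact: (normal_law_sqr_integrable L1).
  exact: finite_measure_integrable_cst.
Qed.

Lemma integrable_lincomb n (t : 'I_n -> 'rV[R]_d) a : (forall i, T (t i)) ->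
  P.-integrable setT (EFin \o lincomb t a).
Proof.
move=> Tt; have -> : EFin \o lincomb t a = (fun w => \sum_(i < n) ((a i)%:E * (f (t i) w)%:E))%E.
  by apply/funext => w /=; rewrite /lincomb -sumEFin; apply: eq_bigr => i _; rewrite EFinM.
apply: integrable_sum => // i _; apply: integrableZl => //.
exact: integrable_field.
Qed.

Lemma expectation_lincomb n (t : 'I_n -> 'rV[R]_d) a : (forall i, T (t i)) ->
  ('E_P[lincomb t a] = 0)%E.
Proof.
move=> Tt; rewrite unlock.
have -> : (\int[P]_w (lincomb t a w)%:E = \int[P]_w (\sum_(i < n) ((a i)%:E * (f (t i) w)%:E)))%E.
  by apply: eq_integral => w _; rewrite /lincomb -sumEFin; apply: eq_bigr => i _; rewrite EFinM.
rewrite integral_sum//=; last by move=> i; apply: integrableZl => //; exact: integrable_field.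
apply: big1 => i _; rewrite integralZl//; last exact: integrable_field.
by have [_ /(_ _ (Tt i))] := gf; rewrite unlock => ->; rewrite mule0.
Qed.

Let kappa_gt0 : 0 < fine (@normal_moment2 R).
Proof. by rewrite -lte_fin fineK ?normal_moment2_fin_num ?normal_moment2_gt0. Qed.

Lemma lincomb_moment2 n (t : 'I_n -> 'rV[R]_d) a : (forall i, T (t i)) ->
  (\int[P]_w ((lincomb t a w) ^+ 2)%:E = (quad t a)%:E * @normal_moment2 R)%E.
Proof.
move=> Tt.
have -> : (\int[P]_w ((lincomb t a w) ^+ 2)%:E =
    \int[P]_w (\sum_(i < n) \sum_(j < n) ((a i * a j)%:E * (f (t i) w * f (t j) w)%:E)))%E.
  apply: eq_integral => w _; rewrite /lincomb expr2 big_distrlr/= -sumEFin.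
  apply: eq_bigr => i _; rewrite -sumEFin; apply: eq_bigr => j _.
  by rewrite -EFinM mulrACA.
have I i j : P.-integrable setT (fun w => ((a i * a j)%:E * (f (t i) w * f (t j) w)%:E)%E).
  by apply: integrableZl => //; exact: integrable_field_mul.
rewrite integral_sum//=; last by move=> i; apply: integrable_sum.
rewrite -[X in (_ * X)%E](fineK normal_moment2_fin_num) -EFinM /quad mulr_suml -sumEFin.
apply: eq_bigr => i _; rewrite integral_sum//= mulr_suml -sumEFin.
apply: eq_bigr => j _; rewrite integralZl//; last exact: integrable_field_mul.
rewrite /cov mulrA divfK ?lt0r_neq0// [in RHS]EFinM fineK//.
by apply: integrable_fin_num => //; exact: integrable_field_mul.
Qed.

(** The unknown parameter [s] of the law is identified by computing the second moment twice: it is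
    both [s ^+ 2] and [quad t a] times [normal_moment2], which is positive and cancels. *)
Lemma lincomb_gaussian n (t : 'I_n -> 'rV[R]_d) a : (forall i, T (t i)) ->
  0 <= quad t a /\ forall A : set R, measurable A ->
    P (lincomb t a @^-1` A) = gaussian_law 0 (Num.sqrt (quad t a)) A.
Proof.
move=> Tt; have [m [s L]] := lincomb_law a Tt.
have m0 : m = 0.
  by apply: (@normal_law_mean_zero _ _ _ P (lincomb t a) m s) => //;
    [exact: integrable_lincomb|exact: expectation_lincomb].
have := lincomb_moment2 a Tt; rewrite (@normal_law_moment2 _ _ _ P (lincomb t a) m s)//.
rewrite -(fineK normal_moment2_fin_num) -!EFinM => -[] /(mulIf (lt0r_neq0 kappa_gt0)) <-.
rewrite sqr_ge0; split => // A mA.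
by rewrite (L _ mA) m0 sqrtr_sqr gaussian_law_norm.
Qed.

Lemma covC s t : cov s t = cov t s.
Proof. by rewrite /cov; under eq_integral do rewrite mulrC. Qed.

(** The tail estimates involve at most three points, a base point and the two ends of an increment;
    events on fewer points are written with zero coefficients. *)
Definition lc3 (t1 t2 t3 : 'rV[R]_d) (a1 a2 a3 : R) (w : Omega) : R :=
  a1 * f t1 w + a2 * f t2 w + a3 * f t3 w.

Definition var3 (t1 t2 t3 : 'rV[R]_d) (a1 a2 a3 : R) : R :=
  a1 ^+ 2 * cov t1 t1 + a2 ^+ 2 * cov t2 t2 + a3 ^+ 2 * cov t3 t3 +
  2 * (a1 * a2 * cov t1 t2 + a1 * a3 * cov t1 t3 + a2 * a3 * cov t2 t3).

Lemma lc3_gaussian t1 t2 t3 a1 a2 a3 : T t1 -> T t2 -> T t3 ->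
  0 <= var3 t1 t2 t3 a1 a2 a3 /\ forall A : set R, measurable A ->
    P (lc3 t1 t2 t3 a1 a2 a3 @^-1` A) =
    gaussian_law 0 (Num.sqrt (var3 t1 t2 t3 a1 a2 a3)) A.
Proof.
move=> T1 T2 T3.
pose t (i : 'I_3) := nth t1 [:: t1; t2; t3] i.
pose a (i : 'I_3) := nth a1 [:: a1; a2; a3] i.
have Tt i : T (t i) by case: i => -[|[|[|]]].
have -> : var3 t1 t2 t3 a1 a2 a3 = quad t a.
  rewrite /quad !big_ord_recl !big_ord0 /= /t /a /=.
  by rewrite (covC t2 t1) (covC t3 t1) (covC t3 t2) /var3; ring.
have -> : lc3 t1 t2 t3 a1 a2 a3 = lincomb t a.
  apply/funext => w; rewrite /lincomb !big_ord_recl big_ord0 /t /a /= /lc3.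
  by rewrite addr0 addrA.
exact: lincomb_gaussian.
Qed.

Lemma measurable_lc3 t1 t2 t3 a1 a2 a3 :
  measurable_fun setT (lc3 t1 t2 t3 a1 a2 a3).
Proof.
apply: measurable_funD; last exact: measurable_funM.
by apply: measurable_funD; exact: measurable_funM.
Qed.

Lemma lc3_tail t1 t2 t3 a1 a2 a3 B : T t1 -> T t2 -> T t3 ->
  0 < var3 t1 t2 t3 a1 a2 a3 ->
  P [set w | B < lc3 t1 t2 t3 a1 a2 a3 w] =
  (gauss_tail (B / Num.sqrt (var3 t1 t2 t3 a1 a2 a3)))%:E.
Proof.
move=> T1 T2 T3; set v := var3 _ _ _ _ _ _ => v0.
have q0 : 0 < Num.sqrt v by rewrite sqrtr_gt0.
set q := Num.sqrt v in q0 *.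
have [_] := @lc3_gaussian t1 t2 t3 (a1 / q) (a2 / q) (a3 / q) T1 T2 T3.
have -> : var3 t1 t2 t3 (a1 / q) (a2 / q) (a3 / q) = 1.
  have -> : var3 t1 t2 t3 (a1 / q) (a2 / q) (a3 / q) = v / q ^+ 2.
    by rewrite /v /var3; field; exact: lt0r_neq0.
  by rewrite sqr_sqrtr ?(ltW v0)// divff// lt0r_neq0.
rewrite sqrtr1 => /(_ [set` `]B / q, +oo[] (measurable_itv _)).
rewrite /gaussian_law oner_eq0 -gauss_tailE => <-; congr (P _).
have E w : lc3 t1 t2 t3 (a1 / q) (a2 / q) (a3 / q) w = lc3 t1 t2 t3 a1 a2 a3 w / q.
  by rewrite /lc3; field; exact: lt0r_neq0.
by apply/seteqP; split => w /=; rewrite in_itv/= andbT E ltr_pM2r ?invr_gt0.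
Qed.

Lemma lc3_small_ball t1 t2 t3 a1 a2 a3 (k : R) : T t1 -> T t2 -> T t3 -> 0 <= k ->
  0 < var3 t1 t2 t3 a1 a2 a3 ->
  (P [set w | (`|lc3 t1 t2 t3 a1 a2 a3 w| <= k)%R] <=
  (2 * (k / Num.sqrt (var3 t1 t2 t3 a1 a2 a3)))%:E)%E.
Proof.
move=> T1 T2 T3 k0; set v := var3 _ _ _ _ _ _ => v0.
have q0 : 0 < Num.sqrt v by rewrite sqrtr_gt0.
set q := Num.sqrt v in q0 *.
have [_] := @lc3_gaussian t1 t2 t3 (a1 / q) (a2 / q) (a3 / q) T1 T2 T3.
have -> : var3 t1 t2 t3 (a1 / q) (a2 / q) (a3 / q) = 1.
  have -> : var3 t1 t2 t3 (a1 / q) (a2 / q) (a3 / q) = v / q ^+ 2.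
    by rewrite /v /var3; field; exact: lt0r_neq0.
  by rewrite sqr_sqrtr ?(ltW v0)// divff// lt0r_neq0.
rewrite sqrtr1 => /(_ [set` `[- (k / q), k / q]] (measurable_itv _)).
rewrite /gaussian_law oner_eq0 => H.
have kq0 : 0 <= k / q by rewrite divr_ge0 ?(ltW q0).
apply: (le_trans _ (normal_prob_small_ball kq0)).
rewrite -H le_eqVlt; apply/orP; left; apply/eqP; congr (P _).
have E w : lc3 t1 t2 t3 (a1 / q) (a2 / q) (a3 / q) w = lc3 t1 t2 t3 a1 a2 a3 w / q.
  by rewrite /lc3; field; exact: lt0r_neq0.
apply/seteqP; split => w /=; rewrite in_itv/= E -mulNr ler_pM2r ?invr_gt0// ler_pM2r ?invr_gt0//.
  by rewrite ler_norml.
by rewrite ler_norml.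
Qed.

Lemma lc3_degenerate t1 t2 t3 a1 a2 a3 : T t1 -> T t2 -> T t3 ->
  var3 t1 t2 t3 a1 a2 a3 = 0 -> P [set w | lc3 t1 t2 t3 a1 a2 a3 w != 0] = 0.
Proof.
move=> T1 T2 T3 v0.
have [_] := @lc3_gaussian t1 t2 t3 a1 a2 a3 T1 T2 T3.
rewrite v0 sqrtr0 => /(_ [set~ 0] (measurableC (measurable_set1 0))).
rewrite /gaussian_law eqxx diracE memNset/=; last by apply.
move=> H; rewrite -[RHS]H.
by congr (P _); apply/seteqP; split => w /= /eqP.
Qed.

End FieldLaws.

(** * Nets, packing numbers and elementary sums *)

Section Combinatorics.
Context {R : realType}.

Lemma finite_net (X : eqType) (close : rel X) (S : seq X) :
  reflexive close -> symmetric close ->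
  exists I : seq X, [/\ uniq I, {subset I <= S},
    {in I &, forall x y, x != y -> ~~ close x y} &
    forall x, x \in S -> exists2 y, y \in I & close x y].
Proof.
move=> crefl csym; elim: S => [|x S [I [uI IS sepI covI]]].
  by exists [::].
have [/hasP[y yI cxy]|/hasPn nc] := boolP (has (close x) I).
  exists I; split => //; first by move=> u /IS uS; rewrite inE uS orbT.
  by move=> u; rewrite inE => /predU1P[->|/covI//]; exists y.
exists (x :: I); split => /=.
- by rewrite uI andbT; apply/negP => /nc; rewrite crefl.
- move=> u; rewrite !inE => /predU1P[->|/IS ->]; by rewrite ?eqxx ?orbT.
- move=> u v; rewrite !inE => /predU1P[->|uI'] /predU1P[->|vI']; first by rewrite eqxx.
  + by move=> _; exact: nc.
  + by move=> _; rewrite csym; exact: nc.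
  + exact: sepI.
- move=> u; rewrite inE => /predU1P[->|/covI[y yI cuy]].
    by exists x => //; rewrite mem_head.
  by exists y => //; rewrite inE yI orbT.
Qed.

Lemma mx_norm_ge (d : nat) (x : 'rV[R]_d) i : `|x ord0 i| <= `|x|.
Proof.
rewrite [leRHS]mx_normrE; exact: (le_bigmax _ (fun ij : 'I_1 * 'I_d => `|x ij.1 ij.2|) (ord0, i)).
Qed.

Lemma mx_norm_le (d : nat) (x : 'rV[R]_d) (c : R) : 0 <= c ->
  (forall i, `|x ord0 i| <= c) -> `|x| <= c.
Proof.
move=> c0 xc; rewrite [leLHS]mx_normrE; apply: bigmax_le => // -[i j] _ /=.
by rewrite ord1.
Qed.

Lemma mx_norm_lt (d : nat) (x : 'rV[R]_d) (c : R) : 0 < c ->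
  (forall i, `|x ord0 i| < c) -> `|x| < c.
Proof.
move=> c0 xc; rewrite [ltLHS]mx_normrE; apply: bigmax_lt => // -[i j] _ /=.
by rewrite ord1.
Qed.

(** Rounding the coordinates in [J] down to a grid of mesh [delta] is injective on [s]: two points
    in one cell would be less than [delta] apart in the sup norm. The other coordinates vanish,
    hence the exponent [#|J|]. *)
Lemma packing_bound (d : nat) (J : {set 'I_d}) (s : seq 'rV[R]_d) (r delta : R) :
  0 < delta -> 0 <= r -> uniq s ->
  (forall x, x \in s -> forall i, i \notin J -> x ord0 i = 0) ->
  (forall x, x \in s -> `|x| <= r) ->
  {in s &, forall x y, x != y -> delta <= `|x - y|} ->
  (size s)%:R <= (2 * r / delta + 2) ^+ #|J|.
Proof.
move=> delta0 r0 us sJ sr sep.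
have q0 : 0 <= 2 * r / delta by rewrite divr_ge0 ?mulr_ge0 ?(ltW delta0).
pose N := Num.truncn (2 * r / delta).
pose u (x : 'rV[R]_d) i := (x ord0 i + r) / delta.
have u0 x i : x \in s -> 0 <= u x i.
  move=> /sr xr; rewrite divr_ge0 ?(ltW delta0)//.
  by have := le_trans (mx_norm_ge x i) xr; rewrite ler_norml => /andP[? _]; lra.
have uN x i : x \in s -> (Num.truncn (u x i) < N.+1)%N.
  move=> /sr xr; rewrite ltnS /N; apply: le_truncn.
  rewrite ler_pM2r ?invr_gt0//.
  by have := le_trans (mx_norm_ge x i) xr; rewrite ler_norml => /andP[_ ?]; lra.
pose F x : {ffun 'I_d -> 'I_N.+1} :=
  [ffun i => if i \in J then inord (Num.truncn (u x i)) else ord0].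
have injF : {in s &, injective F}.
  move=> x y xs ys Fxy; apply/eqP; apply: contraT => /(sep _ _ xs ys).
  rewrite leNgt => /negP; case; apply: mx_norm_lt => // i; rewrite !mxE.
  have [iJ|iJ] := boolP (i \in J); last by rewrite !sJ// subrr normr0.
  have := congr1 (fun h : {ffun _ -> _} => val (h i)) Fxy.
  rewrite !ffunE iJ /= !inordK ?uN// => E.
  have /andP[x1 x2] := truncn_itv (u0 _ i xs).
  have /andP[y1 y2] := truncn_itv (u0 _ i ys).
  have xE : x ord0 i = delta * u x i - r by rewrite /u; field; exact: lt0r_neq0.
  have yE : y ord0 i = delta * u y i - r by rewrite /u; field; exact: lt0r_neq0.
  rewrite E in x1 x2; rewrite -natr1 in x2 y2.
  have -> : x ord0 i - y ord0 i = delta * (u x i - u y i) by rewrite xE yE; ring.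
  rewrite normrM (gtr0_norm delta0) gtr_pMr// ltr_norml; apply/andP; split; lra.
have : (size s <= N.+1 ^ #|J|)%N.
  rewrite -(size_map F) -[N.+1 in X in (_ <= X)%N]card_ord.
  rewrite -(card_pffun_on (ord0 : 'I_N.+1) (mem J) predT) cardE.
  apply: uniq_leq_size; first by rewrite map_inj_in_uniq.
  move=> _ /mapP[x xs ->]; rewrite mem_enum; apply/pffun_onP; split; last by [].
  by apply/supportP => i iJ; rewrite ffunE (negPf iJ).
rewrite -(ler_nat R) natrX => /le_trans; apply; apply: lerXn2r; rewrite ?nnegrE//.
  by rewrite addr_ge0.
have := truncn_itv q0; rewrite -/N -natr1 => /andP[? _]; lra.
Qed.

Lemma sum_pow2_le (m : nat) : \sum_(i < m) 2^-1 ^+ i <= (2 : R).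
Proof.
suff : \sum_(i < m) 2^-1 ^+ i = 2 - 2 * 2^-1 ^+ m :> R.
  by move=> ->; have : 0 <= (2 : R)^-1 ^+ m by []; lra.
elim: m => [|m IH]; first by rewrite big_ord0 expr0; lra.
by rewrite big_ord_recr/= IH exprS; lra.
Qed.

(** With truncated subtraction the exponent is $|k-l|$. The sharper bound $4 - 2\cdot 2^{-k}$ is
    what the induction carries. *)
Lemma sum_pow2_dist_le (m k : nat) :
  \sum_(l < m) 2^-1 ^+ ((k - l) + (l - k)) <= (4 : R).
Proof.
suff H : \sum_(l < m) 2^-1 ^+ ((k - l) + (l - k)) <= 4 - 2 * 2^-1 ^+ k :> R.
  by apply: (le_trans H); have : 0 <= (2 : R)^-1 ^+ k by []; lra.
have p0 n : 0 <= (2 : R)^-1 ^+ n by [].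
have p1 n : (2 : R)^-1 ^+ n <= 1 by rewrite exprn_ile1// invf_le1// ler1n.
elim: m k => [|m IH] k; first by rewrite big_ord0; have := p1 k; lra.
case: k => [|k].
  under eq_bigr do rewrite sub0n subn0 add0n.
  by apply: (le_trans (sum_pow2_le _)); rewrite expr0; lra.
rewrite big_ord_recl/= subn0 sub0n addn0.
under eq_bigr do rewrite /bump/= add1n !subSS.
by have := IH k; rewrite exprS; have := p0 k; lra.
Qed.

(** Finitely many nonnegative numbers have a least positive one. This ends the chaining: beyond some
    level every link has length zero. *)
Lemma finite_gap (X : eqType) (s : seq X) (g : X -> R) : (forall x, 0 <= g x) ->
  exists N : nat, forall x, x \in s -> g x <= 3 * 4^-1 ^+ N -> g x = 0.
Proof.
move=> g0; elim: s => [|x s [N HN]]; first by exists 0%N.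
have [N' HN'] : exists N', g x <= 3 * 4^-1 ^+ N' -> g x = 0.
  have [->|gx0] := eqVneq (g x) 0; first by exists 0%N.
  have gx : 0 < g x / 3 by rewrite divr_gt0// lt_neqAle eq_sym gx0 g0.
  have [N' _ /(_ N' (leqnn _))] : \forall n \near \oo, `|4^-1 ^+ n| < g x / 3.
    apply: (cvgr0_norm_lt _ (cvg_expr _)) => //.
    by rewrite ger0_norm ?invr_ge0// invf_lt1// ltr1n.
  rewrite /= ger0_norm ?exprn_ge0 ?invr_ge0// ltr_pdivlMr// => H.
  by exists N'; rewrite leNgt mulrC H.
have mono n1 n2 : (n1 <= n2)%N -> 3 * (4 : R)^-1 ^+ n2 <= 3 * 4^-1 ^+ n1.
  by move=> n12; rewrite ler_wpM2l// ler_wiXn2l// ?invr_ge0// invf_le1// ler1n.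
exists (maxn N N') => y; rewrite inE => /predU1P[->|ys] H.
  by apply: HN'; apply: le_trans H (mono _ _ _); exact: leq_maxr.
by apply: HN => //; apply: le_trans H (mono _ _ _); exact: leq_maxl.
Qed.

Lemma expR_ge_pow k (x : R) : 0 <= x -> x ^+ k / k`!%:R <= expR x.
Proof.
move=> x0; case: k => [|k]; first by rewrite expr0 fact0 divr1; have := expR_ge1Dx x; lra.
by have := expR_ge1Dxn k x0; lra.
Qed.
End Combinatorics.

Section TailRatio.
Context {R : realType}.

Lemma gauss_tail_gt0 (z : R) : 1 <= z -> 0 < gauss_tail z.
Proof.
move=> z1; apply: lt_le_trans (gauss_tail_ge z1).
rewrite mulr_gt0 ?expR_gt0// divr_gt0//; last exact: lt_le_trans z1.
rewrite normal_pdf_nz ?oner_neq0// mulr_gt0 ?expR_gt0//.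
exact/normal_peak_gt0/oner_neq0.
Qed.

(** Quotient of the two bounds on the Gaussian tail: the factor 4 bounds [z0 / z1], and
    [expR (3 / 2)] is the loss of [gauss_tail_ge]. *)
Lemma gauss_tail_compare (z0 z1 c : R) : 1 <= z0 -> 0 < z1 -> z0 <= 4 * z1 ->
  z0 ^+ 2 - z1 ^+ 2 <= 2 * c ->
  gauss_tail z1 <= 4 * expR (3 / 2) * expR c * gauss_tail z0.
Proof.
move=> z01 z1p z041 H.
have z0p : 0 < z0 by apply: lt_le_trans z01.
apply: (le_trans (gauss_tail_le z1p)).
have K0 : 0 <= 4 * expR (3 / 2) * expR c by rewrite !mulr_ge0 ?expR_ge0.
apply: (le_trans _ (ler_wpM2l K0 (gauss_tail_ge z01))).
have p0 := normal_peak_gt0 (oner_neq0 R).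
have one2 : (1 : R) ^+ 2 *+ 2 = 2 by rewrite expr1n.
rewrite !(normal_pdf_nz _ _ (oner_neq0 R)) !subr0 one2.
have -> : 4 * expR (3 / 2) * expR c *
  (normal_peak 1 * expR (- z0 ^+ 2 / 2) / z0 * expR (- (3 / 2))) =
  normal_peak 1 * (expR (3 / 2) * expR (- (3 / 2)) * (expR c * expR (- z0 ^+ 2 / 2))) * (4 / z0).
  by field; exact: lt0r_neq0.
rewrite -2!expRD subrr expR0 mul1r.
apply: ler_pM => //.
- by rewrite mulr_ge0 ?expR_ge0 ?(ltW p0).
- by rewrite invr_ge0 ltW.
- by rewrite ler_wpM2l ?(ltW p0)// ler_expR; lra.
- by rewrite ler_pdivlMr// mulrC ler_pdivrMr.
Qed.

(** Since $(b+A/b)^2 \ge b^2+2A$, raising the level by $A/b$ should gain $e^{-A/\sigma^2}$. Only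
    half of this rate is claimed; the other half absorbs the excess $E/b^2$ of the variance,
    uniformly for arbitrarily large $A$. *)
Lemma gauss_tail_ratio (sigma E C1 : R) : 0 < sigma -> 0 <= E -> 0 <= C1 ->
  exists C b0, [/\ 0 < C, 0 < b0 & forall b A v : R, b0 <= b -> - C1 <= A -> 0 < v ->
    v <= sigma ^+ 2 + E / b ^+ 2 ->
    gauss_tail ((b + A / b) / Num.sqrt v) <=
    C * expR (- (A / (2 * sigma ^+ 2))) * gauss_tail (b / sigma)].
Proof.
move=> s0 E0 C10.
have s20 : 0 < sigma ^+ 2 by rewrite exprn_gt0.
set s2 := sigma ^+ 2 in s20 *.
have e0 : 0 <= E / s2 by rewrite divr_ge0 ?(ltW s20).
exists (4 * expR (3 / 2) * expR (E / (2 * s2 ^+ 2) + C1 / (2 * s2))), (1 + sigma + 2 * C1 + E / s2).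
split.
- by rewrite !mulr_gt0 ?expR_gt0.
- by move: s0; lra.
move=> b A v Hb HA v0 Hv.
have b1 : 1 <= b by lra.
have b0 : 0 < b by lra.
have w0 : 0 < b ^+ 2 by rewrite exprn_gt0.
have bw : b <= b ^+ 2 by rewrite expr2 ler_peMl// ltW.
set w := b ^+ 2 in w0 bw Hv *.
have wC : 2 * C1 <= w by lra.
have wE : E / s2 <= w by lra.
have Ew : E / w <= s2 by rewrite ler_pdivrMr// mulrC -ler_pdivrMr.
have Ew0 : 0 <= E / w by rewrite divr_ge0 ?(ltW w0).
have q0 : 0 < Num.sqrt v by rewrite sqrtr_gt0.
have qv : Num.sqrt v ^+ 2 = v by rewrite sqr_sqrtr ?(ltW v0).
have qs : Num.sqrt v <= 2 * sigma.
  rewrite -(@ler_pXn2r _ 2) ?nnegrE ?mulr_ge0 ?(ltW q0) ?(ltW s0)//.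
  by rewrite qv exprMn -/s2; lra.
have Bb : b / 2 <= b + A / b.
  suff : - (b / 2) <= A / b by lra.
  rewrite ler_pdivlMr// mulNr mulrAC -expr2 -/w; lra.
rewrite -(mulrA (4 * expR (3 / 2))) -expRD.
apply: gauss_tail_compare.
- by rewrite ler_pdivlMr// mul1r; lra.
- by rewrite divr_gt0//; lra.
- rewrite ler_pdivrMr// mulrA mulrAC ler_pdivlMr//; nra.
- have -> : (b / sigma) ^+ 2 = w / s2 by rewrite /w /s2; field; exact: lt0r_neq0.
  have -> : ((b + A / b) / Num.sqrt v) ^+ 2 = (b + A / b) ^+ 2 / v by rewrite expr_div_n qv.
  have BE : (b + A / b) ^+ 2 = w + 2 * A + A ^+ 2 / w by rewrite /w; field; exact: lt0r_neq0.
  have A2 : 0 <= A ^+ 2 / w by rewrite divr_ge0 ?sqr_ge0 ?(ltW w0).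
  have B1 : (w + 2 * A) / (s2 + E / w) <= (b + A / b) ^+ 2 / v.
    apply: ler_pM; rewrite ?invr_ge0; try lra.
    by rewrite lef_pV2 ?posrE//; lra.
  suff : w / s2 + A / s2 - E / s2 ^+ 2 - C1 / s2 <= (w + 2 * A) / (s2 + E / w).
    move: B1; set X := (b + _) ^+ 2 / v; set Y := (w + 2 * A) / _.
    have -> : 2 * (E / (2 * s2 ^+ 2) + C1 / (2 * s2) + - (A / (2 * s2))) =
      E / s2 ^+ 2 + C1 / s2 - A / s2 by field; exact: lt0r_neq0.
    by move=> B1; lra.
  rewrite ler_pdivlMr; last lra.
  have -> : (w / s2 + A / s2 - E / s2 ^+ 2 - C1 / s2) * (s2 + E / w) =
    w + A - C1 + (E / w) * (A - C1 - E / s2) / s2.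
    by field; rewrite !lt0r_neq0.
  suff : E / w * (A - C1 - E / s2) / s2 <= A + C1 by lra.
  rewrite ler_pdivrMr//.
  have : E / w * (A - C1 - E / s2) <= E / w * (A + C1) by rewrite ler_wpM2l//; lra.
  nra.
Qed.

End TailRatio.

Section FiniteUnion.
Context {R : realType} {disp : measure_display} {Omega : measurableType disp}.
Variable P : probability Omega R.

Lemma prob_finite_union (X : eqType) (s : seq X) (F : X -> set Omega) (c : X -> R) :
  (forall i, i \in s -> measurable (F i) /\ (P (F i) <= (c i)%:E)%E) ->
  measurable [set w | exists2 i, i \in s & F i w] /\
  (P [set w | exists2 i, i \in s & F i w] <= (\sum_(i <- s) c i)%:E)%E.
Proof.
elim: s => [|i s IH] H.
  have -> : [set w | exists2 i, i \in [::] & F i w] = set0.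
    by apply/seteqP; split => w // -[].
  by rewrite big_nil measure0.
have -> : [set w | exists2 j, j \in i :: s & F j w] =
    F i `|` [set w | exists2 j, j \in s & F j w].
  apply/seteqP; split => w /=.
    by move=> [j]; rewrite inE => /predU1P[->|js] Fj; [left|right; exists j].
  by move=> [Fi|[j js Fj]]; [exists i; rewrite ?mem_head|exists j; rewrite ?inE ?js ?orbT].
have [mFi PFi] := H i (mem_head i s).
have [mU PU] : measurable [set w | exists2 j, j \in s & F j w] /\
   (P [set w | exists2 j, j \in s & F j w] <= (\sum_(j <- s) c j)%:E)%E.
  by apply: IH => j js; apply: H; rewrite inE js orbT.
split; first exact: measurableU.
by rewrite big_cons EFinD (le_trans (measureU2 _ _ _))// leeD.
Qed.

End FiniteUnion.

(** Cauchy-Schwarz from a nonnegative quadratic form, evaluated at $l=\pm a/b$. Working with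
    positive upper bounds $a^2, b^2$ of the diagonal entries avoids a separate case for a vanishing
    variance. *)
Lemma quadratic_ge0_le {R : realType} (a b A B c : R) : 0 < a -> 0 < b ->
  A <= a ^+ 2 -> B <= b ^+ 2 -> (forall l, 0 <= A + 2 * l * c + l ^+ 2 * B) ->
  `|c| <= a * b.
Proof.
move=> a0 b0 Aa Bb H.
have E l : l ^+ 2 = (a / b) ^+ 2 -> 0 <= 2 * l * c + 2 * a ^+ 2.
  move=> lE; have := H l; rewrite lE.
  have : (a / b) ^+ 2 * B <= a ^+ 2.
    by rewrite expr_div_n mulrAC ler_pdivrMr ?exprn_gt0// ler_wpM2l ?sqr_ge0.
  lra.
have ab0 : 0 < a / b by rewrite divr_gt0.
have abE : a = a / b * b by rewrite divfK ?lt0r_neq0.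
have H1 := E (a / b) erefl.
have H2 := E (- (a / b)) (sqrrN _).
have F : 0 <= (a / b) * (c + a * b) /\ 0 <= (a / b) * (a * b - c).
  by split; [move: H1|move: H2]; rewrite {2}abE; nra.
rewrite ler_norml; case: F; rewrite !pmulr_rge0// => ? ?; apply/andP; split; lra.
Qed.

Section Bonferroni.
Context {R : realType} {disp : measure_display} {Omega : measurableType disp}.
Variable P : probability Omega R.

(** By induction on [s]: outside the union of the other events, the event at [x] still has
    probability at least [p] minus the sum of the [q x j], that is at least [p / 2]. *)
Lemma bonferroni_lower (X : eqType) (s : seq X) (A : X -> set Omega) (p : R) (q : X -> X -> R) :
  uniq s -> (forall i, i \in s -> measurable (A i) /\ (p%:E <= P (A i))%E) ->
  (forall i j, i \in s -> j \in s -> i != j -> (P (A i `&` A j) <= (q i j)%:E)%E) ->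
  (forall i j, 0 <= q i j) ->
  (forall i, i \in s -> \sum_(j <- s | j != i) q i j <= p / 2) ->
  (((size s)%:R * (p / 2))%:E <= P [set w | exists2 i, i \in s & A i w])%E.
Proof.
elim: s => [|x s IH] /=; first by move=> *; rewrite mul0r measure_ge0.
move=> /andP[xs us] HA Hq q0 Hs.
have mx : x \in x :: s by exact: mem_head.
have ms i : i \in s -> i \in x :: s by move=> is_; rewrite inE is_ orbT.
set U := [set w | exists2 i, i \in s & A i w].
have [mA pA] := HA x mx.
have mU : measurable U.
  by have [] := @prob_finite_union _ _ _ P X s A (fun=> 1)
    (fun i is_ => conj (HA i (ms i is_)).1 (probability_le1 _ (HA i (ms i is_)).1)).
have -> : [set w | exists2 i, i \in x :: s & A i w] = U `|` (A x `\` U).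
  apply/seteqP; split => w /=.
    move=> [i]; rewrite inE => /predU1P[->|is_] Aw; last by left; exists i.
    by have [Uw|nUw] := pselect (U w); [left|right].
  by move=> [[i is_ Aw]|[Aw _]]; [exists i => //; exact: ms|exists x].
have IHU : (((size s)%:R * (p / 2))%:E <= P U)%E.
  apply: IH => // [i is_|i j is_ js|i is_].
  - exact/HA/ms.
  - by apply: Hq; exact: ms.
  - apply: (le_trans _ (Hs i (ms i is_))); rewrite big_cons.
    by case: ifP => _ //; rewrite lerDr.
have PI : (P (A x `&` U) <= (p / 2)%:E)%E.
  have -> : A x `&` U = [set w | exists2 i, i \in s & (A x `&` A i) w].
    apply/seteqP; split => w /=; first by move=> [Aw [i is_ Aiw]]; exists i.
    by move=> [i is_ [Aw Aiw]]; split => //; exists i.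
  have H i : i \in s -> measurable (A x `&` A i) /\ (P (A x `&` A i) <= (q x i)%:E)%E.
    move=> is_; split; first by apply: measurableI => //; case: (HA i (ms i is_)).
    apply: Hq => //; first exact: ms.
    by apply: contraNneq xs => ->.
  have [_ /le_trans] := prob_finite_union H; apply; rewrite lee_fin.
  apply: (le_trans _ (Hs x mx)); rewrite big_cons eqxx /= big_seq [leRHS]big_seq_cond.
  rewrite le_eqVlt; apply/orP; left; apply/eqP; apply: eq_bigl => j.
  have [js|//] := boolP (j \in s); rewrite /=; apply/esym.
  by apply: contraNneq xs => <-.
rewrite measureU//; last first.
  by apply/seteqP; split => w // -[Uw [_ /(_ Uw)]].
  exact: measurableD.
have fI := fin_num_measure P _ (measurableI _ _ mA mU).
have fD := fin_num_measure P _ (measurableD mA mU).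
have PA : P (A x) = (P (A x `\` U) + P (A x `&` U))%E by exact: measureDI.
move: pA PI; rewrite PA -(fineK fI) -(fineK fD) -EFinD !lee_fin => pA PI.
rewrite -natr1 mulrDl mul1r EFinD; apply: leeD => //.
by rewrite -(fineK fD) lee_fin; lra.
Qed.

End Bonferroni.

(** * Tail bounds and chaining for a field whose increments are controlled through [pi] *)

Section Chaining.
Context {R : realType} {disp : measure_display} {Omega : measurableType disp}.
Variables (P : probability Omega R) (d : nat).
Variables (T : set 'rV[R]_d) (f : 'rV[R]_d -> {RV P >-> R}).
Hypothesis gf : centered_gaussian_field T f.
Variables (sigma L : R) (pi : 'rV[R]_d -> 'rV[R]_d).
Hypotheses (sigma_gt0 : 0 < sigma) (L_gt0 : 0 < L).
Hypothesis var_sigma : forall t, T t -> cov f t t = sigma ^+ 2.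

(** The square of the canonical metric of the field: the normalised variance of [f s - f t]. *)
Definition dist2 (s t : 'rV[R]_d) : R := cov f s s + cov f t t - 2 * cov f s t.

Hypothesis dist2_le : forall s t, T s -> T t -> dist2 s t <= (L * `|pi s - pi t|) ^+ 2.

Lemma measurable_gt_lc3 t1 t2 t3 a1 a2 a3 B :
  measurable [set w | B < lc3 f t1 t2 t3 a1 a2 a3 w].
Proof.
rewrite -[X in measurable X]setTI.
have -> : [set w | B < lc3 f t1 t2 t3 a1 a2 a3 w] = lc3 f t1 t2 t3 a1 a2 a3 @^-1` `]B, +oo[.
  by apply/seteqP; split => w /=; rewrite in_itv/= andbT.
exact: (measurable_lc3 f t1 t2 t3 a1 a2 a3).
Qed.

Lemma measurable_gt_field t B : measurable [set w | B < f t w].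
Proof.
rewrite (_ : [set w | _] = [set w | B < lc3 f t t t 1 0 0 w]).
  exact: measurable_gt_lc3.
by apply/seteqP; split => w /=; rewrite /lc3 !mul0r !addr0 mul1r.
Qed.

Lemma measurable_gt_diff u v B : measurable [set w | B < f u w - f v w].
Proof.
rewrite (_ : [set w | _] = [set w | B < lc3 f u v v 1 (-1) 0 w]).
  exact: measurable_gt_lc3.
by apply/seteqP; split => w /=; rewrite /lc3 !mul0r !addr0 mul1r mulN1r.
Qed.

Lemma measurable_gt_increment u v B : measurable [set w | B < `|f u w - f v w|].
Proof.
rewrite (_ : [set w | _] = [set w | B < lc3 f u v v 1 (-1) 0 w] `|`
    [set w | B < lc3 f u v v (-1) 1 0 w]).
  by apply: measurableU; exact: measurable_gt_lc3.
apply/seteqP; split => w /=; rewrite /lc3 !mul0r !addr0 !mul1r !mulN1r.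
  by rewrite ltr_normr => /orP[H|H]; [left|right]; lra.
by move=> H; rewrite ltr_normr; apply/orP; case: H => H; [left|right]; lra.
Qed.

(** Equal variances make the midpoint $(f(u)+f(v))/2$ uncorrelated with $f(u)-f(v)$, so $f(x)$ may
    be replaced by its difference from that midpoint before applying Cauchy-Schwarz. The bound is
    therefore of second order. *)
Lemma cov_increment_le x u v (a c : R) : T x -> T u -> T v -> 0 < a -> 0 < c ->
  L * `|pi u - pi v| <= a -> L * `|pi x - pi u| <= c -> L * `|pi x - pi v| <= c ->
  `|cov f x u - cov f x v| <= a * c.
Proof.
move=> Tx Tu Tv a0 c0 uva xuc xvc.
have le2 (s t : 'rV[R]_d) e : T s -> T t -> 0 < e -> L * `|pi s - pi t| <= e ->
    dist2 s t <= e ^+ 2.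
  move=> Ts Tt e0 le; apply: (le_trans (dist2_le Ts Tt)).
  by rewrite lerXn2r ?nnegrE ?mulr_ge0 ?(ltW L_gt0)// ltW.
have Duv := le2 u v _ Tu Tv a0 uva.
have Dxu := le2 x u _ Tx Tu c0 xuc.
have Dxv := le2 x v _ Tx Tv c0 xvc.
apply: (@quadratic_ge0_le _ a c (dist2 u v) ((dist2 x u + dist2 x v) / 2 - dist2 u v / 4)) => //.
  have : 0 <= dist2 u v.
    have [+ _] := @lc3_gaussian _ _ _ P d T f gf u v v 1 (-1) 0 Tu Tv Tv.
    rewrite /var3 /dist2; lra.
  lra.
move=> l.
have [+ _] := @lc3_gaussian _ _ _ P d T f gf x u v l (1 - l / 2) (- 1 - l / 2) Tx Tu Tv.
have := var_sigma Tu; have := var_sigma Tv; rewrite /dist2 /var3.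
move=> -> -> H; apply: (le_trans H); rewrite le_eqVlt; apply/orP; left; apply/eqP.
by field.
Qed.

Lemma base_tail (C1 : R) : 0 <= C1 -> exists C b0, [/\ 0 < C, 0 < b0 &
  forall (b : R) x, b0 <= b -> T x ->
  (P [set w | (b - C1 / b < f x w)%R] <= (C * gauss_tail (b / sigma))%:E)%E].
Proof.
move=> C10; have [C [b0 [C0 b00 H]]] := @gauss_tail_ratio _ sigma 0 C1 sigma_gt0 (lexx 0) C10.
exists (C * expR (C1 / (2 * sigma ^+ 2))), b0; split => //; first by rewrite mulr_gt0 ?expR_gt0.
move=> b x bb Tx.
have s2 : 0 < sigma ^+ 2 by rewrite exprn_gt0.
have vE : var3 f x x x 1 0 0 = sigma ^+ 2 by rewrite /var3 var_sigma//; ring.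
rewrite (_ : [set w | _] = [set w | b - C1 / b < lc3 f x x x 1 0 0 w]); last first.
  by apply/seteqP; split => w /=; rewrite /lc3 !mul0r !addr0 mul1r.
rewrite (lc3_tail gf)//; last by rewrite vE.
rewrite vE lee_fin; have := H b (- C1) (sigma ^+ 2) bb (lexx _) s2.
by rewrite !mulNr opprK; apply; rewrite mul0r addr0.
Qed.

(* The two events are relaxed to the single half-space
   f x + beta (f u - f v) > b + ..., with beta = K 4^n: this keeps the factor 1/b
   of the Gaussian tail, which separate Chernoff bounds would lose. *)
Lemma link_tail : exists C b0, [/\ 0 < C, 0 < b0 &
  forall (b : R) (n y : nat) x u v, b0 <= b -> (0 < y)%N -> T x -> T u -> T v ->
    b * `|pi u - pi x| <= 2 -> b * `|pi v - pi x| <= 2 ->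
    b * `|pi u - pi v| <= 3 * 4^-1 ^+ n ->
    (P [set w | (b - 5 * y.+1%:R / b < f x w)%R /\ (y%:R * 2^-1 ^+ n / b < f u w - f v w)%R] <=
     (C * expR (- (3 * y%:R * 2 ^+ n)) * gauss_tail (b / sigma))%:E)%E].
Proof.
have s2 : 0 < sigma ^+ 2 by rewrite exprn_gt0.
(* The 10 pays for [5 * y.+1%:R <= 10 * y%:R]. What remains, $6\sigma^2y2^n$, becomes the exponent
   $3y2^n$ after the division by $2\sigma^2$ in [gauss_tail_ratio]. *)
pose K := 10 + 6 * sigma ^+ 2.
have K0 : 0 < K by rewrite /K; lra.
(* With $\beta 4^{-n}=K$, the first summand is $b^2$ times the bound $\beta^2(3L4^{-n}/b)^2$ on the
   variance of the scaled increment. The second is $b^2$ times the bound $2\beta(3L4^{-n}/b)(2L/b)$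
   on the cross term. *)
pose E := 9 * K ^+ 2 * L ^+ 2 + 12 * K * L ^+ 2.
have E0 : 0 <= E by rewrite /E addr_ge0// !mulr_ge0 ?sqr_ge0 ?(ltW K0) ?(ltW L_gt0).
have [C [b0 [C0 b00 H]]] := @gauss_tail_ratio _ sigma E 5 sigma_gt0 E0 (ler0n _ 5).
exists C, (b0 + 1); split => //; first by lra.
move=> b n y x u v bb y0 Tx Tu Tv ux vx uv.
have bp : 0 < b by lra.
have y1 : 1 <= y%:R :> R by rewrite ler1n.
pose q := 4^-1 ^+ n : R.
have q0 : 0 < q by rewrite exprn_gt0.
have q4 : q * 4 ^+ n = 1 by rewrite -exprMn mulVf// expr1n.
have p2 : 2^-1 ^+ n * 4 ^+ n = 2 ^+ n :> R.
  by rewrite -exprMn; congr (_ ^+ n); field.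
have tn1 : 1 <= 2 ^+ n :> R by rewrite exprn_ege1// ler1n.
pose beta := K * 4 ^+ n.
have beta0 : 0 < beta by rewrite mulr_gt0// exprn_gt0.
pose A := K * y%:R * 2 ^+ n - 5 * y.+1%:R.
have HA : 6 * sigma ^+ 2 * y%:R * 2 ^+ n <= A.
  rewrite /A /K -natr1; nra.
set v3 := var3 f x u v 1 beta (- beta).
have [v3ge0 _] := @lc3_gaussian _ _ _ P d T f gf x u v 1 beta (- beta) Tx Tu Tv.
have sub : [set w | (b - 5 * y.+1%:R / b < f x w)%R /\ (y%:R * 2^-1 ^+ n / b < f u w - f v w)%R] `<=`
    [set w | (b + A / b < lc3 f x u v 1 beta (- beta) w)%R].
  move=> w /= [H1 H2]; rewrite /lc3.
  have : beta * (y%:R * 2^-1 ^+ n / b) < beta * (f u w - f v w) by rewrite ltr_pM2l.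
  have -> : beta * (y%:R * 2^-1 ^+ n / b) = K * y%:R * 2 ^+ n / b by rewrite -p2 /beta; field; lra.
  have -> : A / b = K * y%:R * 2 ^+ n / b - 5 * y.+1%:R / b by rewrite /A; field; lra.
  by move=> H3; lra.
have sy0 : 0 <= 6 * sigma ^+ 2 * y%:R * 2 ^+ n by rewrite !mulr_ge0 ?exprn_ge0 ?(ltW sigma_gt0).
have A0 : 0 <= A by apply: le_trans HA.
have bA : 0 < b + A / b by rewrite ltr_wpDr ?divr_ge0 ?(ltW bp).
have mE : measurable [set w | (b - 5 * y.+1%:R / b < f x w)%R /\ (y%:R * 2^-1 ^+ n / b < f u w - f v w)%R].
  by apply: measurableI; [exact: measurable_gt_field|exact: measurable_gt_diff].
apply: (@le_trans _ _ (P [set w | (b + A / b < lc3 f x u v 1 beta (- beta) w)%R])).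
  by apply: le_measure; rewrite ?inE//; exact: measurable_gt_lc3.
have [v30|v30] := eqVneq v3 0.
  have := @lc3_degenerate _ _ _ P d T f gf x u v 1 beta (- beta) Tx Tu Tv v30 => P0.
  apply: (@le_trans _ _ 0%E); last by rewrite lee_fin !mulr_ge0 ?expR_ge0 ?gauss_tail_ge0// ltW.
  rewrite -P0; apply: le_measure; rewrite ?inE; first exact: measurable_gt_lc3.
    rewrite (_ : [set w | _] = [set w | 0 < lc3 f x u v 1 beta (- beta) w] `|`
       [set w | 0 < lc3 f x u v (-1) (- beta) beta w]).
      by apply: measurableU; exact: measurable_gt_lc3.
    apply/seteqP; split => w /=.
      rewrite neq_lt => /orP[] H0; [right|by left].
      by move: H0; rewrite /lc3; lra.
    move=> [H0|H0]; first by rewrite gt_eqF.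
    by rewrite lt_eqF//; move: H0; rewrite /lc3; lra.
  by move=> w /= H0; rewrite gt_eqF//; apply: lt_trans H0.
have v3gt0 : 0 < v3 by rewrite lt_neqAle eq_sym v30.
rewrite (lc3_tail gf)// lee_fin -/v3.
apply: (le_trans (H b A v3 _ _ v3gt0 _)); [by lra|by lra| |].
- have aq0 : 0 < 3 * L * q / b by rewrite divr_gt0// !mulr_gt0.
  have cq0 : 0 < 2 * L / b by rewrite divr_gt0// !mulr_gt0.
  have scale (s t : 'rV[R]_d) e : b * `|pi s - pi t| <= e -> L * `|pi s - pi t| <= e * L / b.
    by move=> le; rewrite mulrAC [leRHS]mulrC ler_wpM2l ?(ltW L_gt0)// ler_pdivlMr// mulrC.
  have uv' : L * `|pi u - pi v| <= 3 * L * q / b.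
    by rewrite (mulrAC 3); exact: scale.
  have Duv : dist2 u v <= (3 * L * q / b) ^+ 2.
    apply: (le_trans (dist2_le Tu Tv)).
    by rewrite lerXn2r ?nnegrE ?(ltW aq0)// mulr_ge0 ?(ltW L_gt0).
  have xu' : L * `|pi x - pi u| <= 2 * L / b by rewrite distrC; exact: scale.
  have xv' : L * `|pi x - pi v| <= 2 * L / b by rewrite distrC; exact: scale.
  have := cov_increment_le Tx Tu Tv aq0 cq0 uv' xu' xv'.
  rewrite ler_norml => /andP[_ Cuv].
  have -> : v3 = sigma ^+ 2 + beta ^+ 2 * dist2 u v + 2 * beta * (cov f x u - cov f x v).
    by rewrite /v3 /var3 /dist2 (var_sigma Tx); ring.
  have -> : sigma ^+ 2 + E / b ^+ 2 = sigma ^+ 2 + beta ^+ 2 * (3 * L * q / b) ^+ 2 +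
      2 * beta * (3 * L * q / b * (2 * L / b)).
    have -> : beta ^+ 2 * (3 * L * q / b) ^+ 2 = 9 * K ^+ 2 * L ^+ 2 * (q * 4 ^+ n) ^+ 2 / b ^+ 2.
      by rewrite /beta; field; lra.
    have -> : 2 * beta * (3 * L * q / b * (2 * L / b)) = 12 * K * L ^+ 2 * (q * 4 ^+ n) / b ^+ 2.
      by rewrite /beta; field; lra.
    by rewrite q4 /E; field; lra.
  rewrite lerD// ?lerD// ler_wpM2l ?sqr_ge0//.
  by rewrite mulr_ge0 ?(ltW beta0).
- rewrite ler_wpM2r ?gauss_tail_ge0// ler_wpM2l ?(ltW C0)// ler_expR lerN2.
  rewrite ler_pdivlMr ?mulr_gt0//; apply: le_trans HA; rewrite le_eqVlt; apply/orP; left.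
  by apply/eqP; ring.
Qed.

(** With $t=2^n\ge1$ and $y\ge1$ one has $3yt\ge t+y+y$. The factor $e^{-t}$ beats the $t^{4d}$
    coming from the links and leaves a summable $1/t$; the two factors $e^{-y}$ give $2^{-y}$ and
    $(y+1)^{-2d}$ respectively. The leading 4 combines the two signs of an increment with the 2 in
    the bound on the number of links. *)
Lemma link_sum : exists C, 0 < C /\ forall N y : nat, (0 < y)%N ->
  \sum_(n <- iota 0 N) 4 * (24 * 4 ^+ n) ^+ (2 * d) * expR (- (3 * y%:R * 2 ^+ n)) <=
  C * 2^-1 ^+ y / y.+1%:R ^+ (2 * d) :> R.
Proof.
pose D := (2 * d)`!%:R : R; pose D' := (4 * d).+1`!%:R : R.
have D0 : 0 < D by rewrite ltr0n fact_gt0.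
have D'0 : 0 < D' by rewrite ltr0n fact_gt0.
exists (4 * 24 ^+ (2 * d) * D' * (expR 1 * D) * 2); split.
  by rewrite !mulr_gt0 ?expR_gt0 ?exprn_gt0.
move=> N y y0; have y1 : 1 <= y%:R :> R by rewrite ler1n.
have yS0 : 0 < y.+1%:R :> R by rewrite ltr0n.
have term n : 4 * (24 * 4 ^+ n) ^+ (2 * d) * expR (- (3 * y%:R * 2 ^+ n)) <=
    4 * 24 ^+ (2 * d) * D' * (expR 1 * D) * (2^-1 ^+ y / y.+1%:R ^+ (2 * d)) * 2^-1 ^+ n.
  set t := 2 ^+ n : R.
  have t1 : 1 <= t by rewrite exprn_ege1// ler1n.
  have t0 : 0 < t by rewrite exprn_gt0.
  have tE : 4 ^+ n = t ^+ 2 :> R.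
    by rewrite /t -exprM mulnC exprM; congr (_ ^+ n); ring.
  have tiE : 2^-1 ^+ n = t^-1 :> R by rewrite exprVn.
  have e1 : expR (- t) <= D' / t ^+ (4 * d).+1.
    rewrite expRN -[leRHS]invrK lef_pV2 ?posrE ?expR_gt0 ?invr_gt0 ?divr_gt0 ?exprn_gt0//.
    by rewrite invfM invrK mulrC; apply: expR_ge_pow; exact: ltW.
  have e2 : expR (- y%:R) <= 2^-1 ^+ y :> R.
    rewrite expRN exprVn lef_pV2 ?posrE ?expR_gt0 ?exprn_gt0// -[y%:R]mulr1 mulrC expRM_natr.
    by rewrite lerXn2r ?nnegrE ?expR_ge0//; have := expR_ge1Dx (1 : R); lra.
  have e3 : expR (- y%:R) <= expR 1 * D / y.+1%:R ^+ (2 * d).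
    have -> : - y%:R = 1 + - y.+1%:R :> R by rewrite -natr1; ring.
    rewrite expRD -mulrA ler_wpM2l ?expR_ge0//.
    rewrite expRN -[leRHS]invrK lef_pV2 ?posrE ?expR_gt0 ?invr_gt0 ?divr_gt0 ?exprn_gt0//.
    by rewrite invfM invrK mulrC; apply: expR_ge_pow; exact: ltW.
  have e4 : expR (- (3 * y%:R * t)) <= expR (- t) * (expR (- y%:R) * expR (- y%:R)).
    by rewrite -!expRD ler_expR; nra.
  have eE : 4 * (24 * 4 ^+ n) ^+ (2 * d) = 4 * 24 ^+ (2 * d) * t ^+ (4 * d).
    by rewrite exprMn tE -exprM mulnA mulrA.
  rewrite eE tiE.
  apply: (@le_trans _ _ (4 * 24 ^+ (2 * d) * t ^+ (4 * d) *
    (D' / t ^+ (4 * d).+1 * (2^-1 ^+ y * (expR 1 * D / y.+1%:R ^+ (2 * d)))))).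
    rewrite ler_wpM2l ?mulr_ge0 ?exprn_ge0 ?(ltW t0)//.
    apply: (le_trans e4); rewrite ler_pM ?mulr_ge0 ?expR_ge0//.
    by rewrite ler_pM ?expR_ge0.
  rewrite le_eqVlt; apply/orP; left; apply/eqP; rewrite [t ^+ (4 * d).+1]exprS.
  by field; rewrite ?lt0r_neq0 ?exprn_gt0.
apply: (le_trans (ler_sum _ (fun n _ => term n))).
rewrite -mulr_sumr [leRHS](_ : _ =
  4 * 24 ^+ (2 * d) * D' * (expR 1 * D) * (2^-1 ^+ y / y.+1%:R ^+ (2 * d)) * 2); last first.
  by ring.
rewrite ler_wpM2l//.
  by rewrite !mulr_ge0 ?expR_ge0 ?invr_ge0 ?exprn_ge0 ?(ltW D0) ?(ltW D'0).
by rewrite -[N]subn0 -/(index_iota 0 N) big_mkord; exact: sum_pow2_le.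
Qed.

(* Chaining along nets of mesh 4^-n/b: for y > 0, E y is the event that f x0 is above
   b - 5 (y+1)/b and some link at level n has an increment above y 2^-n/b. The y
   found for w is the least one such that no link exceeds (y+1) 2^-n/b. *)
Lemma cell_events : exists C b0, [/\ 0 < C, 0 < b0 &
  forall (b : R) (S : seq 'rV[R]_d) x0, b0 <= b -> (forall s, s \in S -> T s) -> x0 \in S ->
  (forall s, s \in S -> b * `|pi s - pi x0| <= 2) ->
  exists E : nat -> set Omega,
    (forall y, measurable (E y) /\
      (P (E y) <= (C * 2^-1 ^+ y / y.+1%:R ^+ (2 * d) * gauss_tail (b / sigma))%:E)%E) /\
    forall w, (forall u v, u \in S -> v \in S -> pi u = pi v -> f u w = f v w) ->
      (exists t, [/\ t \in S, b * `|pi t - pi x0| <= 1 & b < f t w]) ->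
      exists y, E y w /\ forall s s' m, s \in S -> s' \in S ->
        b * `|pi s - pi s'| <= 4^-1 ^+ m ->
        `|f s w - f s' w| <= 5 * y.+1%:R * 2^-1 ^+ m / b].
Proof.
have [C1 [b1 [C10 b10 H1]]] := @base_tail 5 (ler0n _ 5).
have [C2 [b2 [C20 b20 H2]]] := link_tail.
have [C3 [C30 H3]] := link_sum.
exists (C1 + C2 * C3), (b1 + b2); split; [by rewrite addr_gt0 ?mulr_gt0|by rewrite addr_gt0|].
move=> b S x0 bb ST x0S near.
have bb1 : b1 <= b by lra.
have bb2 : b2 <= b by lra.
have b_gt0 : 0 < b by lra.
pose close n (s t : 'rV[R]_d) := b * `|pi s - pi t| < 4^-1 ^+ n.
have q0 n : 0 < 4^-1 ^+ n :> R by rewrite exprn_gt0.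
have /choice[N RN] : forall n, exists I : seq 'rV[R]_d, [/\ uniq I, {subset I <= S},
    {in I &, forall x y, x != y -> ~~ close n x y} &
    forall x, x \in S -> exists2 y, y \in I & close n x y].
  move=> n; apply: finite_net.
    by move=> x; rewrite /close subrr normr0 mulr0.
  by move=> x y; rewrite /close distrC.
have sub n : {subset N n <= S} by have [] := RN n.
(* Rescaled by [b] and viewed through [pi], the net is $4^{-n}$-separated in a ball of radius 2, and
   $4\cdot4^n+2\le6\cdot4^n$. *)
have sizeN n : (size (N n))%:R <= (6 * 4 ^+ n) ^+ d :> R.
  have [uN _ sepN _] := RN n.
  pose F (s : 'rV[R]_d) := b *: (pi s - pi x0).
  have FE s s' : `|F s - F s'| = b * `|pi s - pi s'|.
    by rewrite /F -scalerBr opprB addrA subrK normrZ gtr0_norm.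
  have sepF s s' : s \in N n -> s' \in N n -> s != s' -> 4^-1 ^+ n <= `|F s - F s'|.
    by move=> sN s'N ss'; rewrite FE leNgt; exact: sepN.
  have := @packing_bound R d [set: 'I_d]%SET [seq F s | s <- N n] 2 (4^-1 ^+ n) (q0 n) (ler0n _ 2).
  rewrite size_map cardsT card_ord => H; apply: (le_trans (H _ _ _ _)).
  - rewrite map_inj_in_uniq// => s s' sN s'N FF; apply/eqP; apply: contraT => /(sepF _ _ sN s'N).
    by rewrite FF subrr normr0 leNgt q0.
  - by move=> x _ i; rewrite inE.
  - move=> _ /mapP[s sN ->]; rewrite /F normrZ gtr0_norm//.
    by apply: near; exact: sub sN.
  - move=> _ _ /mapP[s sN ->] /mapP[s' s'N ->] FF; apply: sepF => //.
    by apply: contraNneq FF => ->.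
  - have qV : (4^-1 ^+ n)^-1 = 4 ^+ n :> R by rewrite exprVn invrK.
    have t1 : 1 <= 4 ^+ n :> R by rewrite exprn_ege1// ler1n.
    rewrite lerXn2r ?nnegrE ?addr_ge0 ?mulr_ge0 ?invr_ge0 ?exprn_ge0//.
    by rewrite qV; lra.
have [n0 Hn0] := @finite_gap R _ [seq (u, v) | u <- S, v <- S]
  (fun p => b * `|pi p.1 - pi p.2|) (fun p => mulr_ge0 (ltW b_gt0) (normr_ge0 _)).
have gap n u v : u \in S -> v \in S -> (n0 <= n)%N ->
    b * `|pi u - pi v| <= 3 * 4^-1 ^+ n -> pi u = pi v.
  move=> uS vS nn0 H; apply/eqP; rewrite -subr_eq0 -normr_eq0.
  have : b * `|pi u - pi v| = 0.
    apply: (Hn0 (u, v)); first by apply/allpairsP; exists (u, v).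
    by apply: (le_trans H); rewrite ler_wpM2l// ler_wiXn2l// ?invr_ge0// invf_le1// ler1n.
  by move=> /eqP; rewrite mulf_eq0 (gt_eqF b_gt0).
(* The 3 lets the net points nearest to two points at rescaled distance $4^{-n}$ form a link: one
   step out, one across, one back. *)
pose links n := [seq p <- [seq (u, v) | u <- N n, v <- N n ++ N n.+1] |
  b * `|pi p.1 - pi p.2| <= 3 * 4^-1 ^+ n].
pose inc n (y : nat) (p : 'rV[R]_d * 'rV[R]_d) (w : Omega) : Prop :=
  y%:R * 2^-1 ^+ n / b < `|f p.1 w - f p.2 w|.
pose base (y : nat) w : Prop := b - 5 * y.+1%:R / b < f x0 w.
pose E (y : nat) : set Omega := if y is 0%N then base 0%N else
  [set w | exists2 n, n \in iota 0 n0 & exists2 p, p \in links n & base y w /\ inc n y p w].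
exists E; split.
  case=> [|y].
    rewrite /E; split; first exact: measurable_gt_field.
    have -> : base 0%N = [set w | b - 5 / b < f x0 w] by rewrite /base mulr1.
    rewrite expr0 expr1n divr1 mulr1 (le_trans (H1 b x0 bb1 (ST _ x0S)))//.
      rewrite lee_fin ler_wpM2r ?gauss_tail_ge0// lerDl mulr_ge0 ?(ltW C20) ?(ltW C30)//.
  have ev n p : p \in links n -> measurable [set w | base y.+1 w /\ inc n y.+1 p w] /\
      (P [set w | base y.+1 w /\ inc n y.+1 p w] <=
       (2 * (C2 * expR (- (3 * y.+1%:R * 2 ^+ n)) * gauss_tail (b / sigma)))%:E)%E.
    rewrite mem_filter => /andP[pn /allpairsP[[u v] /= [uN vN pE]]].
    have uS : u \in S by exact: sub uN.
    have vS : v \in S by move: vN; rewrite mem_cat => /orP[]; exact: sub.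
    rewrite pE /= in pn *; split.
      apply: measurableI; [exact: measurable_gt_field|exact: measurable_gt_increment].
    have Hu := H2 b n y.+1 x0 u v bb2 erefl (ST _ x0S) (ST _ uS) (ST _ vS) (near _ uS) (near _ vS) pn.
    have pn' : b * `|pi v - pi u| <= 3 * 4^-1 ^+ n by rewrite distrC.
    have Hv := H2 b n y.+1 x0 v u bb2 erefl (ST _ x0S) (ST _ vS) (ST _ uS) (near _ vS) (near _ uS) pn'.
    rewrite mulr_natl mulr2n EFinD; apply: le_trans (leeD Hu Hv).
    have mh s s' : measurable [set w | (b - 5 * y.+2%:R / b < f x0 w)%R /\
        (y.+1%:R * 2^-1 ^+ n / b < f s w - f s' w)%R].
      by apply: measurableI; [exact: measurable_gt_field|exact: measurable_gt_diff].
    apply: (le_trans _ (measureU2 _ (mh u v) (mh v u))).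
    apply: le_measure; rewrite ?inE.
    - apply: measurableI; [exact: measurable_gt_field|exact: measurable_gt_increment].
    - by apply: measurableU.
    - move=> w /= [bw]; rewrite /inc /= ltr_normr opprB => /orP[iw|iw]; [left|right]; split => //.
  have lev n : n \in iota 0 n0 -> _ := fun _ => prob_finite_union (ev n).
  have [mE PE] := prob_finite_union lev.
  split; first exact: mE.
  apply: (le_trans PE); rewrite lee_fin.
  apply: (@le_trans _ _ (C2 * gauss_tail (b / sigma) *
    \sum_(n <- iota 0 n0) 4 * (24 * 4 ^+ n) ^+ (2 * d) * expR (- (3 * y.+1%:R * 2 ^+ n)))).
    rewrite mulr_sumr ler_sum// => n _.
    rewrite big_const_seq count_predT iter_addr_0 -[leLHS]mulr_natr.
    have lsz : (size (links n))%:R <= 2 * (24 * 4 ^+ n) ^+ (2 * d) :> R.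
      apply: (@le_trans _ _ ((size (N n))%:R * ((size (N n))%:R + (size (N n.+1))%:R))).
        rewrite -natrD -natrM ler_nat size_filter (leq_trans (count_size _ _))//.
        by rewrite size_allpairs size_cat.
      have t0 : 0 <= 4 ^+ n :> R by rewrite exprn_ge0.
      have s1 : (size (N n))%:R <= (24 * 4 ^+ n) ^+ d :> R.
        apply: (le_trans (sizeN n)); rewrite lerXn2r ?nnegrE ?mulr_ge0//; lra.
      have s2 : (size (N n.+1))%:R <= (24 * 4 ^+ n) ^+ d :> R.
        apply: (le_trans (sizeN n.+1)); rewrite exprS mulrA le_eqVlt; apply/orP; left; apply/eqP.
        by congr ((_ * _) ^+ _); ring.
      rewrite mulnC exprM expr2.
      have z0 : 0 <= (24 * 4 ^+ n) ^+ d :> R by rewrite exprn_ge0// mulr_ge0.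
      rewrite mulrCA; apply: ler_pM; rewrite ?addr_ge0//; lra.
    have c0 : 0 <= 2 * (C2 * expR (- (3 * y.+1%:R * 2 ^+ n)) * gauss_tail (b / sigma)).
      by rewrite !mulr_ge0 ?expR_ge0 ?gauss_tail_ge0 ?(ltW C20).
    apply: (le_trans (ler_wpM2l c0 lsz)); rewrite le_eqVlt; apply/orP; left; apply/eqP.
    by ring.
  have g0 : 0 <= C2 * gauss_tail (b / sigma) by rewrite mulr_ge0 ?gauss_tail_ge0 ?(ltW C20).
  apply: (le_trans (ler_wpM2l g0 (H3 n0 y.+1 erefl))).
  have X0 : 0 <= 2^-1 ^+ y.+1 / y.+2%:R ^+ (2 * d) :> R.
    by rewrite divr_ge0 ?exprn_ge0.
  rewrite [leLHS](_ : _ = C2 * C3 * (2^-1 ^+ y.+1 / y.+2%:R ^+ (2 * d)) * gauss_tail (b / sigma)); last by ring.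
  rewrite ler_wpM2r ?gauss_tail_ge0// -[leRHS]mulrA ler_wpM2r//.
  by rewrite lerDr ltW.
move=> w const [t [tS tx0 bt]].
pose G y := forall n p, p \in links n -> `|f p.1 w - f p.2 w| <= y%:R * 2^-1 ^+ n / b.
have linksP n u v : u \in N n -> v \in N n ++ N n.+1 -> b * `|pi u - pi v| <= 3 * 4^-1 ^+ n ->
    (u, v) \in links n.
  by move=> uN vN uv; rewrite mem_filter uv/=; apply/allpairsP; exists (u, v).
have linksS n p : p \in links n ->
    [/\ p.1 \in S, p.2 \in S & b * `|pi p.1 - pi p.2| <= 3 * 4^-1 ^+ n].
  rewrite mem_filter => /andP[pn /allpairsP[[u v] /= [uN vN pE]]].
  rewrite pE /= in pn *; split => //; first exact: sub uN.
  by move: vN; rewrite mem_cat => /orP[]; exact: sub.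
(* At levels from [n0] on, linked points have equal projections and hence equal values; the finitely
   many lower levels are covered by taking [y] large. *)
have exG : exists y, `[< G y.+1 >].
  pose M := \sum_(u <- S) \sum_(v <- S) `|f u w - f v w|.
  have MP u v : u \in S -> v \in S -> `|f u w - f v w| <= M.
    move=> uS vS; rewrite /M (big_rem _ uS)/= (big_rem _ vS)/=.
    by rewrite -addrA lerDl addr_ge0// sumr_ge0// => ? _; rewrite sumr_ge0.
  have M0 : 0 <= M * b * 2 ^+ n0.
    by rewrite !mulr_ge0 ?exprn_ge0 ?(ltW b_gt0)// sumr_ge0// => ? _; rewrite sumr_ge0.
  exists (Num.truncn (M * b * 2 ^+ n0)); apply/asboolP => n p /linksS[p1 p2 pn].
  have /andP[_ Ht] := truncn_itv M0.
  set y := (Num.truncn _).+1 in Ht *.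
  have [nn0|nn0] := leqP n0 n.
    by rewrite (const _ _ p1 p2 (gap n _ _ p1 p2 nn0 pn)) subrr normr0 !mulr_ge0 ?invr_ge0 ?exprn_ge0 ?(ltW b_gt0).
  apply: (le_trans (MP _ _ p1 p2)).
  rewrite ler_pdivlMr// exprVn ler_pdivlMr ?exprn_gt0//.
  apply: (le_trans _ (ltW Ht)); rewrite ler_wpM2l//.
    by rewrite mulr_ge0 ?(ltW b_gt0)// sumr_ge0// => ? _; rewrite sumr_ge0.
  by rewrite ler_weXn2l ?ler1n// ltnW.
(* The constant is $5=2+1+2$: a geometric sum of ratio $1/2$ from each of the two points to its net
   point at level [m], and one link between these net points. *)
have chain (y : nat) s s' m : G y -> s \in S -> s' \in S -> b * `|pi s - pi s'| <= 4^-1 ^+ m ->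
    `|f s w - f s' w| <= 5 * y%:R * 2^-1 ^+ m / b.
  move=> Gy sS s'S ss'.
  have /choice[r Hr] : forall p : nat * 'rV[R]_d, exists v, p.2 \in S -> v \in N p.1 /\ close p.1 p.2 v.
    move=> [n u] /=; have [uS|uS] := boolP (u \in S); last by exists u.
    by have [_ _ _ /(_ _ uS)[v vN uv]] := RN n; exists v.
  pose z := y%:R * 2^-1 ^+ m / b.
  have tele u k : u \in S -> `|f (r (m, u)) w - f (r (m + k, u)%N) w| <= 2 * z * (1 - 2^-1 ^+ k).
    move=> uS; elim: k => [|k IH]; first by rewrite addn0 subrr normr0 expr0 subrr mulr0.
    have [r1 c1] := Hr ((m + k)%N, u) uS.
    have [r2 c2] := Hr ((m + k.+1)%N, u) uS; rewrite /= in r1 r2 c1 c2.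
    have := Gy (m + k)%N (r ((m + k)%N, u), r ((m + k.+1)%N, u)).
    move=> /(_ _)/wrap[|/= H].
      apply: linksP => //; first by rewrite mem_cat addnS in r2 *; rewrite r2 orbT.
      move: c1 c2; rewrite /close addnS exprS => c1 c2.
      have := ler_distD (pi u) (pi (r ((m + k)%N, u))) (pi (r ((m + k).+1, u))).
      rewrite (distrC (pi (r ((m + k)%N, u))) (pi u)) => /(ler_wpM2l (ltW b_gt0)).
      rewrite mulrDr; have := q0 (m + k)%N; lra.
    have := ler_distD (f (r ((m + k)%N, u)) w) (f (r (m, u)) w) (f (r ((m + k.+1)%N, u)) w).
    have E1 : y%:R * 2^-1 ^+ (m + k) / b = z * 2^-1 ^+ k by rewrite /z exprD; ring.
    by rewrite E1 in H; rewrite exprS; lra.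
  have z0 : 0 <= z by rewrite !mulr_ge0 ?invr_ge0 ?exprn_ge0 ?(ltW b_gt0).
  have lim u : u \in S -> `|f (r (m, u)) w - f u w| <= 2 * z.
    move=> uS; have := tele u n0 uS.
    have [r1 c1] := Hr ((m + n0)%N, u) uS; rewrite /= in r1 c1.
    have -> : f (r ((m + n0)%N, u)) w = f u w.
      apply: const => //; first exact: sub r1.
      apply/esym/(gap (m + n0)%N) => //; first exact: sub r1.
        exact: leq_addl.
      by move: c1; rewrite /close; have := q0 (m + n0)%N; lra.
    by have e0 : 0 <= 2^-1 ^+ n0 :> R by []; have := mulr_ge0 z0 e0; lra.
  have [r1 c1] := Hr (m, s) sS.
  have [r2 c2] := Hr (m, s') s'S; rewrite /= in r1 r2 c1 c2.
  have /= H := Gy m (r (m, s), r (m, s')) _.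
  have {}H : `|f (r (m, s)) w - f (r (m, s')) w| <= z.
    apply: H; apply: linksP => //; first by rewrite mem_cat r2.
    move: c1 c2; rewrite /close => c1 c2.
    have := ler_distD (pi s) (pi (r (m, s))) (pi (r (m, s'))).
    have := ler_distD (pi s') (pi s) (pi (r (m, s'))).
    rewrite (distrC (pi (r (m, s))) (pi s)) => /(ler_wpM2l (ltW b_gt0)) + /(ler_wpM2l (ltW b_gt0)).
    rewrite !mulrDr; have := q0 m; lra.
  have := lim s sS; have := lim s' s'S.
  have := ler_distD (f (r (m, s)) w) (f s w) (f s' w).
  have := ler_distD (f (r (m, s')) w) (f (r (m, s)) w) (f s' w).
  rewrite (distrC (f s w) (f (r (m, s)) w)).
  have -> : 5 * y%:R * 2^-1 ^+ m / b = 5 * z by rewrite /z; ring.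
  lra.
have [y /asboolP Gy miny] := ex_minnP exG.
exists y; split; last by move=> s s' m sS s'S; exact: chain.
have by0 : base y w.
  (* Chaining between [t] and [x0] at level 0 bounds their difference by $5(y+1)/b$, so [f x0]
     inherits an almost as high value. *)
  rewrite /base.
  have := chain _ _ _ 0%N Gy tS x0S; rewrite !expr0 mulr1 => /(_ tx0).
  by rewrite ler_norml => /andP[_]; lra.
case: y => [|y] in Gy miny by0 *; first exact: by0.
have nG : ~ G y.+1.
  by move=> Gy1; have := miny y (introT (asboolP _) Gy1); rewrite ltnn.
have [n [p [pn inp]]] : exists n p, p \in links n /\ inc n y.+1 p w.
  apply: contrapT => H; apply: nG => n p pn; rewrite leNgt; apply/negP => H'.
  by apply: H; exists n, p.
have nn0 : (n < n0)%N.
  rewrite ltnNge; apply/negP => nn0; have [p1 p2 pp] := linksS _ _ pn.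
  move: inp; rewrite /inc (const _ _ p1 p2 (gap n _ _ p1 p2 nn0 pp)) subrr normr0 ltNge.
  by rewrite !mulr_ge0 ?invr_ge0 ?exprn_ge0 ?(ltW b_gt0).
by exists n; [rewrite mem_iota|exists p].
Qed.

(** The cells of [cell_events] are centred at a maximal subset [I] that is $1/b$-separated under
    [pi]; the union bound over cells costs only [size I], and this is the single place where the
    choice of [pi] affects the order in [b]. *)
Lemma net_events : exists C b0, [/\ 0 < C, 0 < b0 &
  forall (b : R) (S : seq 'rV[R]_d), b0 <= b -> (forall s, s \in S -> T s) ->
  exists (I : seq 'rV[R]_d) (E : nat -> set Omega), [/\ uniq I, {subset I <= S},
    {in I &, forall x y, x != y -> 1 < b * `|pi x - pi y|},
    (forall y, measurable (E y) /\
      (P (E y) <= ((size I)%:R * (C * 2^-1 ^+ y / y.+1%:R ^+ (2 * d) * gauss_tail (b / sigma)))%:E)%E) &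
    forall w, (forall u v, u \in S -> v \in S -> pi u = pi v -> f u w = f v w) ->
      (exists2 t, t \in S & b < f t w) ->
      exists y t, [/\ E y w, t \in S, b < f t w & forall s m, s \in S ->
        b * `|pi s - pi t| <= 4^-1 ^+ m ->
        `|f s w - f t w| <= 5 * y.+1%:R * 2^-1 ^+ m / b]]].
Proof.
have [C [b0 [C0 b00 HC]]] := cell_events.
exists C, b0; split => // b S bb0 ST.
have b0' : 0 < b by apply: lt_le_trans bb0.
pose close (x y : 'rV[R]_d) := b * `|pi x - pi y| <= 1.
have cr : reflexive close by move=> x; rewrite /close subrr normr0 mulr0.
have cs : symmetric close by move=> x y; rewrite /close distrC.
have [I [uI IS sepI covI]] := finite_net S cr cs.
(* Radius 2 so that the cell contains, with each [t] at distance at most 1 from [x], every [s] at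
   distance at most 1 from [t]. *)
pose Sx x := [seq s <- S | b * `|pi s - pi x| <= 2].
have /choice[E HE] : forall x, exists E : nat -> set Omega, x \in I ->
   (forall y, measurable (E y) /\
      (P (E y) <= (C * 2^-1 ^+ y / y.+1%:R ^+ (2 * d) * gauss_tail (b / sigma))%:E)%E) /\
    forall w, (forall u v, u \in Sx x -> v \in Sx x -> pi u = pi v -> f u w = f v w) ->
      (exists t, [/\ t \in Sx x, b * `|pi t - pi x| <= 1 & b < f t w]) ->
      exists y, E y w /\ forall s s' m, s \in Sx x -> s' \in Sx x ->
        b * `|pi s - pi s'| <= 4^-1 ^+ m ->
        `|f s w - f s' w| <= 5 * y.+1%:R * 2^-1 ^+ m / b.
  move=> x; have [xI|xI] := boolP (x \in I); last by exists (fun=> set0).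
  have [|||E HE] := HC b (Sx x) x bb0.
  - by move=> s; rewrite mem_filter => /andP[_ /ST].
  - by rewrite mem_filter subrr normr0 mulr0 ler0n IS.
  - by move=> s; rewrite mem_filter => /andP[].
  by exists E.
exists I, (fun y => [set w | exists2 x, x \in I & E x y w]); split => //.
- by move=> x y xI yI xy; rewrite ltNge; exact: sepI.
- move=> y.
  have := @prob_finite_union _ _ _ P _ I (E^~ y)
    (fun=> C * 2^-1 ^+ y / y.+1%:R ^+ (2 * d) * gauss_tail (b / sigma)).
  rewrite big_const_seq count_predT iter_addr_0 mulr_natl; apply.
  by move=> x /HE[/(_ y)].
move=> w Hw [t tS bt]; have [x xI tx] := covI t tS.
have [_ H] := HE x xI.
have [||y [Ey Hy]] := H w.
- by move=> u v; rewrite !mem_filter => /andP[_ uS] /andP[_ vS]; exact: Hw.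
- exists t; split => //; rewrite mem_filter tS andbT; apply: (le_trans tx); lra.
exists y, t; split => //.
  by exists x.
move=> s m sS sm; apply: Hy => //; rewrite mem_filter ?sS ?tS andbT.
  rewrite (_ : pi s - pi x = (pi s - pi t) + (pi t - pi x)); last by rewrite subrKA.
  apply: (le_trans (ler_wpM2l (ltW b0') (ler_normD _ _))); rewrite mulrDr.
  have : 4^-1 ^+ m <= 1 :> R by rewrite exprn_ile1// ?invr_ge0// invf_le1//; lra.
  by move: tx; rewrite /close; lra.
by apply: (le_trans tx); lra.
Qed.

(** If both values exceed [b], so does their mean, whose variance is only $\sigma^2-D/4$ with $D$
    the value of [dist2 s t]; then $b^2/(\sigma^2-D/4)\ge b^2/\sigma^2+b^2D/(4\sigma^4)$. *)
Lemma pair_tail (b : R) s t : sigma <= b -> T s -> T t ->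
  (P [set w | (b < f s w)%R /\ (b < f t w)%R] <=
   (4 * expR (3 / 2) * expR (- (b ^+ 2 * dist2 s t / (8 * sigma ^+ 4))) *
    gauss_tail (b / sigma))%:E)%E.
Proof.
move=> sb Ts Tt; have b0 : 0 < b by apply: lt_le_trans sb.
set v := var3 f s t t (1 / 2) (1 / 2) 0.
have vE : v = sigma ^+ 2 - dist2 s t / 4.
  by rewrite /v /var3 /dist2 !var_sigma//; field.
have [v0 _] := @lc3_gaussian _ _ _ P d T f gf s t t (1 / 2) (1 / 2) 0 Ts Tt Tt.
rewrite -/v in v0.
have D0 : 0 <= dist2 s t.
  have [+ _] := @lc3_gaussian _ _ _ P d T f gf s t t 1 (-1) 0 Ts Tt Tt.
  by rewrite /var3 /dist2; lra.
apply: (@le_trans _ _ (P [set w | (b < lc3 f s t t (1 / 2) (1 / 2) 0 w)%R])).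
  apply: le_measure; rewrite ?inE.
  - by apply: measurableI; exact: measurable_gt_field.
  - exact: measurable_gt_lc3.
  - by move=> w /= [H1 H2]; rewrite /lc3 mul0r; lra.
have [v00|vn0] := eqVneq v 0.
  have P0 := @lc3_degenerate _ _ _ P d T f gf s t t (1 / 2) (1 / 2) 0 Ts Tt Tt v00.
  apply: (@le_trans _ _ 0%E); last by rewrite lee_fin !mulr_ge0 ?expR_ge0 ?gauss_tail_ge0.
  rewrite -P0; apply: le_measure; rewrite ?inE; first exact: measurable_gt_lc3.
    rewrite (_ : [set w | _] = [set w | 0 < lc3 f s t t (1 / 2) (1 / 2) 0 w] `|`
       [set w | 0 < lc3 f s t t (- (1 / 2)) (- (1 / 2)) 0 w]).
      by apply: measurableU; exact: measurable_gt_lc3.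
    apply/seteqP; split => w /=.
      rewrite neq_lt => /orP[] H0; [right|by left].
      by move: H0; rewrite /lc3; lra.
    move=> [H0|H0]; first by rewrite gt_eqF.
    by rewrite lt_eqF//; move: H0; rewrite /lc3; lra.
  by move=> w /= H0; rewrite gt_eqF//; apply: lt_trans H0.
have vp : 0 < v by rewrite lt_neqAle eq_sym vn0.
have qp : 0 < Num.sqrt v by rewrite sqrtr_gt0.
have qv : Num.sqrt v ^+ 2 = v by rewrite sqr_sqrtr ?(ltW vp).
have s2 : 0 < sigma ^+ 2 by rewrite exprn_gt0.
have s4 : 0 < sigma ^+ 4 by rewrite exprn_gt0.
rewrite (lc3_tail gf)// -/v lee_fin.
have qs : Num.sqrt v <= sigma.
  by rewrite -(@ler_pXn2r _ 2) ?nnegrE ?(ltW qp) ?(ltW sigma_gt0)// qv vE; lra.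
apply: gauss_tail_compare.
- by rewrite ler_pdivlMr// mul1r.
- exact: divr_gt0.
- have : b / sigma <= b / Num.sqrt v by rewrite ler_pM2l// lef_pV2.
  have : 0 < b / Num.sqrt v by exact: divr_gt0.
  lra.
- rewrite !expr_div_n qv.
  suff : b ^+ 2 / sigma ^+ 2 + b ^+ 2 * dist2 s t / (4 * sigma ^+ 4) <= b ^+ 2 / v.
    have -> : 2 * - (b ^+ 2 * dist2 s t / (8 * sigma ^+ 4)) =
      - (b ^+ 2 * dist2 s t / (4 * sigma ^+ 4)) by field; exact: lt0r_neq0.
    by lra.
  rewrite ler_pdivlMr//.
  have -> : (b ^+ 2 / sigma ^+ 2 + b ^+ 2 * dist2 s t / (4 * sigma ^+ 4)) * v =
     b ^+ 2 - b ^+ 2 * dist2 s t ^+ 2 / (16 * sigma ^+ 4).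
    by rewrite vE; field; exact: lt0r_neq0.
  by rewrite lerBlDr lerDl (divr_ge0 (mulr_ge0 (sqr_ge0 _) (sqr_ge0 _)) (mulr_ge0 (ler0n _ 16) (ltW s4))).
Qed.

(* Bonferroni's inequality on a grid whose mesh is a large multiple of 1/b. *)
Lemma grid_lower : exists2 kappa, 0 < kappa &
  forall (b : R) m (pt : {ffun 'I_d -> 'I_m} -> 'rV[R]_d) s,
    sigma <= b -> uniq s -> (forall i, i \in s -> T (pt i)) ->
    (forall i j, i \in s -> j \in s ->
       kappa * (\sum_k ((i k - j k) + (j k - i k)))%N%:R <= b ^+ 2 * dist2 (pt i) (pt j)) ->
    (((size s)%:R * (gauss_tail (b / sigma) / 2))%:E <=
    P [set w | exists2 i, i \in s & (b < f (pt i) w)%R])%E.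
Proof.
pose K := 4 * expR (3 / 2) : R.
have K0 : 0 < K by rewrite mulr_gt0 ?expR_gt0.
(* Chosen so that $e^{kap-1}\ge 2K4^d$: this makes the sum of all pair probabilities at most
   [p / 2]. *)
pose kap := 1 + 2 * K * 4 ^+ d.
have kap1 : 1 <= kap by rewrite /kap lerDl !mulr_ge0 ?exprn_ge0 ?(ltW K0).
have s4 : 0 < sigma ^+ 4 by rewrite exprn_gt0.
exists (8 * sigma ^+ 4 * kap); first by rewrite mulr_gt0 ?mulr_gt0//; lra.
move=> b m pt s sb us Ts Hs.
have b0 : 0 < b by apply: lt_le_trans sb.
set p := gauss_tail (b / sigma).
have p0 : 0 <= p by exact: gauss_tail_ge0.
pose n (i j : {ffun 'I_d -> 'I_m}) := (\sum_k ((i k - j k) + (j k - i k)))%N.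
apply: (@bonferroni_lower _ _ _ P _ s (fun i => [set w | (b < f (pt i) w)%R]) p
  (fun i j => K * expR (- (kap * (n i j)%:R)) * p)) => //.
- move=> i is_; split; first exact: measurable_gt_field.
  have Ti := Ts i is_.
  have vE : var3 f (pt i) (pt i) (pt i) 1 0 0 = sigma ^+ 2 by rewrite /var3 var_sigma//; ring.
  rewrite (_ : [set w | _] = [set w | b < lc3 f (pt i) (pt i) (pt i) 1 0 0 w]); last first.
    by apply/seteqP; split => w /=; rewrite /lc3 !mul0r !addr0 mul1r.
  rewrite (lc3_tail gf) ?vE ?exprn_gt0//.
  by rewrite sqrtr_sqr gtr0_norm.
- move=> i j is_ js _; apply: (le_trans (pair_tail sb (Ts i is_) (Ts j js))).
  rewrite lee_fin -/K ler_wpM2r// ler_wpM2l ?(ltW K0)// ler_expR lerN2.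
  rewrite ler_pdivlMr ?mulr_gt0//; apply: (le_trans _ (Hs i j is_ js)).
  by rewrite le_eqVlt; apply/orP; left; apply/eqP; rewrite /n; ring.
- by move=> i j; rewrite !mulr_ge0 ?expR_ge0 ?(ltW K0).
move=> i is_.
(* Since $n(i,j)\ge1$, the exponent is at least $(kap-1)+n(i,j)$. The first part supplies a small
   constant, the second a product over coordinates whose sum over all [j] factorises. *)
have term j : j != i -> K * expR (- (kap * (n i j)%:R)) * p <=
    K * p * expR (- (kap - 1)) * \prod_(k < d) 2^-1 ^+ ((i k - j k) + (j k - i k)).
  move=> ji; have n1 : (1 <= n i j)%N.
    rewrite lt0n; apply: contra ji; rewrite sum_nat_eq0 => /forallP H.
    apply/eqP/ffunP => k; have := H k; rewrite /= addn_eq0 !subn_eq0 => /andP[ij jj].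
    by apply/val_inj/eqP; rewrite eqn_leq ij jj.
  rewrite [K * _ * p]mulrAC -[leRHS]mulrA ler_wpM2l ?mulr_ge0 ?(ltW K0)//.
  rewrite -expr_sum -/(n i j).
  have -> : 2^-1 ^+ n i j = (2 ^+ n i j)^-1 :> R by rewrite exprVn.
  have e2 : expR (- (n i j)%:R) <= (2 ^+ n i j)^-1 :> R.
    rewrite expRN lef_pV2 ?posrE ?expR_gt0 ?exprn_gt0// -[(n i j)%:R]mulr1 mulrC expRM_natr.
    by rewrite lerXn2r ?nnegrE ?expR_ge0//; have := expR_ge1Dx (1 : R); lra.
  apply: (@le_trans _ _ (expR (- (kap - 1)) * expR (- (n i j)%:R))); last first.
    by rewrite ler_wpM2l ?expR_ge0.
  rewrite -expRD ler_expR; have : 1 <= (n i j)%:R :> R by rewrite ler1n.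
  by nra.
apply: (@le_trans _ _ (\sum_(j : {ffun 'I_d -> 'I_m}) K * p * expR (- (kap - 1)) * \prod_(k < d) 2^-1 ^+ ((i k - j k) + (j k - i k)))).
  rewrite -big_filter big_uniq ?filter_uniq//=.
  apply: (@le_trans _ _ (\sum_(j in [seq j <- s | j != i])
      K * p * expR (- (kap - 1)) * \prod_(k < d) 2^-1 ^+ ((i k - j k) + (j k - i k)))).
    by apply: ler_sum => j; rewrite mem_filter => /andP[/term].
  rewrite [leRHS](bigID (mem [seq j <- s | j != i]))/= lerDl sumr_ge0// => j _.
  by rewrite !mulr_ge0 ?expR_ge0 ?(ltW K0)// prodr_ge0.
rewrite -mulr_sumr -(bigA_distr_bigA (fun (k : 'I_d) (l : 'I_m) => 2^-1 ^+ ((i k - l) + (l - i k)) : R)).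
have prod4 : \prod_(k < d) \sum_(l < m) 2^-1 ^+ ((i k - l) + (l - i k)) <= 4 ^+ d :> R.
  rewrite -[in leRHS](card_ord d) -prodr_const; apply: ler_prod => k _.
  by rewrite sumr_ge0// sum_pow2_dist_le.
have Kp0 : 0 <= K * p * expR (- (kap - 1)) by rewrite !mulr_ge0 ?expR_ge0 ?(ltW K0).
apply: (le_trans (ler_wpM2l Kp0 prod4)).
rewrite expRN -!mulrA (mulrC p) !mulrA -mulrA -[leRHS]mul1r.
have e0 := expR_gt0 (kap - 1).
have ek : 2 * K * 4 ^+ d <= expR (kap - 1).
  by apply: le_trans (expR_ge1Dx _); rewrite /kap; lra.
rewrite [leLHS](_ : _ = (2 * K * 4 ^+ d) / expR (kap - 1) * (p / 2)); last first.
  by rewrite /K; field; exact: lt0r_neq0.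
by rewrite ler_wpM2r ?divr_ge0// ler_pdivrMr// mul1r.
Qed.

End Chaining.

(** * Stationarity of the covariance and the canonical metric *)

Section Covariance.
Context {R : realType} {disp : measure_display} {Omega : measurableType disp}.
Variables (P : probability Omega R) (d : nat).
Variables (T : set 'rV[R]_d) (f : 'rV[R]_d -> {RV P >-> R}).
Hypothesis gf : centered_gaussian_field T f.
Hypothesis hf : homogeneous T f.

Lemma cov_gt0 t : T t -> (0 < 'V_P[f t])%E -> 0 < cov f t t.
Proof.
move=> Tt; rewrite /variance unlock /=; have [_ /(_ t Tt) ->] := gf.
rewrite unlock /= => V0; rewrite /cov divr_gt0//; last first.
  by rewrite -lte_fin fineK ?normal_moment2_gt0// normal_moment2_fin_num.
rewrite -lte_fin fineK.
  apply: (lt_le_trans V0); rewrite le_eqVlt; apply/orP; left; apply/eqP.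
  by apply: eq_integral => w _ /=; rewrite !fctE /= !subr0.
exact: (integrable_fin_num measurableT (integrable_field_mul gf Tt Tt)).
Qed.

Lemma cov_shift s t h : T s -> T t -> T (s + h) -> T (t + h) ->
  cov f (s + h) (t + h) = cov f s t.
Proof.
move=> Ts Tt Tsh Tth; rewrite /cov; congr (fine _ / _).
pose u (i : 'I_2) := nth s [:: s; t] i.
have mprod x y : measurable_fun setT (f x \* f y) by exact: measurable_funM.
pose Z x y : {RV P >-> R} :=
  HB.pack (f x \* f y) (isMeasurableFun.Build _ _ _ _ (f x \* f y) (mprod x y)).
have E x y : T x -> T y -> (\int[P]_w (f x w * f y w)%:E)%E = (\int[distribution P (Z x y)]_r r%:E)%E.
  move=> Tx Ty; rewrite integral_distribution//.
  exact: (integrable_field_mul gf Tx Ty).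
rewrite !E//; apply: eq_measure_integral => A mA _.
have Tu i : T (u i) by rewrite /u; case: i => -[|[|]].
have Tuh i : T (u i + h) by rewrite /u; case: i => -[|[|]].
have mB : measurable [set x : 2.-tuple R | A (tnth x ord0 * tnth x (lift ord0 ord0))].
  rewrite -[X in measurable X]setTI.
  have mf : measurable_fun setT (fun x : 2.-tuple R => tnth x ord0 * tnth x (lift ord0 ord0)).
    by apply: measurable_funM; exact: measurable_tnth.
  exact: (mf measurableT A mA).
have := @hf 2 u h Tu Tuh _ mB.
rewrite /= /distribution /pushforward => H.
transitivity (P [set w | A (tnth [tuple f (u i + h) w | i < 2] ord0 *
   tnth [tuple f (u i + h) w | i < 2] (lift ord0 ord0))]).
  by congr (P _); apply/seteqP; split => w /=; rewrite !tnth_mktuple.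
rewrite H; congr (P _); apply/seteqP; split => w /=; by rewrite !tnth_mktuple.
Qed.

Definition ndist s t : R := Num.sqrt (dist2 f s t).

Lemma dist2_ge0 s t : T s -> T t -> 0 <= dist2 f s t.
Proof.
move=> Ts Tt.
have [+ _] := @lc3_gaussian _ _ _ P d T f gf s t t 1 (-1) 0 Ts Tt Tt.
by rewrite /var3 /dist2; lra.
Qed.

Lemma ndistK s t : T s -> T t -> ndist s t ^+ 2 = dist2 f s t.
Proof. by move=> Ts Tt; rewrite sqr_sqrtr// dist2_ge0. Qed.

Lemma ndist_ge0 s t : 0 <= ndist s t.
Proof. exact: sqrtr_ge0. Qed.

Lemma ndistC s t : ndist s t = ndist t s.
Proof. by rewrite /ndist /dist2 covC; congr Num.sqrt; ring. Qed.

Lemma ndist_shift s t h : T s -> T t -> T (s + h) -> T (t + h) ->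
  ndist (s + h) (t + h) = ndist s t.
Proof. by move=> Ts Tt Tsh Tth; rewrite /ndist /dist2 !cov_shift. Qed.

Lemma ndistxx s : ndist s s = 0.
Proof.
rewrite /ndist /dist2 (_ : _ - _ = 0) ?sqrtr0//; ring.
Qed.

(** Minkowski's inequality in $L^2$. [quadratic_ge0_le] asks for positive bounds, so a margin [e] is
    added to both distances and then removed in the limit. *)
Lemma ndist_triangle t s u : T s -> T t -> T u -> ndist s u <= ndist s t + ndist t u.
Proof.
move=> Ts Tt Tu.
have Dst := ndistK Ts Tt; have Dtu := ndistK Tt Tu; have Dsu := ndistK Ts Tu.
have p1 := ndist_ge0 s t; have p2 := ndist_ge0 t u; have p3 := ndist_ge0 s u.
rewrite -(@ler_pXn2r _ 2) ?nnegrE ?addr_ge0// Dsu.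
(* The covariance of the increments [f s - f t] and [f t - f u]. *)
pose c := cov f s t - cov f s u - cov f t t + cov f t u.
have sE : dist2 f s u = dist2 f s t + dist2 f t u + 2 * c by rewrite /dist2 /c; ring.
have cle e : 0 < e -> c <= (ndist s t + e) * (ndist t u + e).
  move=> e0; apply: (le_trans (ler_norm c)).
  apply: (@quadratic_ge0_le _ _ _ (dist2 f s t) (dist2 f t u)).
  - by rewrite ltr_wpDl.
  - by rewrite ltr_wpDl.
  - by rewrite -Dst lerXn2r ?nnegrE ?addr_ge0 ?lerDl ?(ltW e0).
  - by rewrite -Dtu lerXn2r ?nnegrE ?addr_ge0 ?lerDl ?(ltW e0).
  move=> l.
  have [+ _] := @lc3_gaussian _ _ _ P d T f gf s t u 1 (l - 1) (- l) Ts Tt Tu.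
  rewrite /dist2 /c /var3 => H; apply: (le_trans H); rewrite le_eqVlt; apply/orP; left.
  by apply/eqP; ring.
have c2 : c <= ndist s t * ndist t u.
  apply/ler_addgt0Pl => e e0.
  pose e' := e / (1 + ndist s t + ndist t u + e).
  have D0 : 0 < 1 + ndist s t + ndist t u + e by lra.
  have e'0 : 0 < e' by rewrite divr_gt0.
  have e'1 : e' <= 1 by rewrite ler_pdivrMr// mul1r; lra.
  have e'E : e' * (1 + ndist s t + ndist t u + e) = e by rewrite divfK ?lt0r_neq0.
  apply: (le_trans (cle _ e'0)).
  have : e' * (ndist s t + ndist t u + e') <= e by rewrite -[leRHS]e'E ler_wpM2l ?(ltW e'0)//; lra.
  by move=> H; lra.
by rewrite sE -Dst -Dtu sqrrD mulr2n; lra.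
Qed.

End Covariance.

Lemma differentiable_bound {R : realType} (d : nat) (g : 'rV[R]_d -> R) (x : 'rV[R]_d) :
  differentiable g x -> exists k delta : R, 0 < delta /\
    forall h, `|h| < delta -> `|g (x + h) - g x| <= k * `|h|.
Proof.
move=> dg; have /eqaddoP/(_ 1 ltr01) := diff_locally dg.
move=> /nbhs_norm0P[delta /= d0 H].
pose k0 := \sum_(i < d) `|'d g x 'e_i|.
exists (k0 + 1), delta; split=> // h hd.
have := H h hd; rewrite /= !fctE /= opprD addrA mul1r (addrC h x) => H1.
have dh : `|'d g x h| <= k0 * `|h|.
  rewrite {1}[h]row_sum_delta linear_sum /= (le_trans (ler_norm_sum _ _ _))// mulr_suml.
  apply: ler_sum => i _; rewrite linearZ/= normrM mulrC ler_wpM2l//; exact: mx_norm_ge.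
have -> : g (x + h) - g x = (g (x + h) - g x - 'd g x h) + 'd g x h by rewrite subrK.
by rewrite (le_trans (ler_normD _ _))// mulrDl mul1r addrC lerD.
Qed.

(** * The canonical metric around an interior point [z]: upper bounds and degenerate directions *)

Section Geometry.
Context {R : realType} {disp : measure_display} {Omega : measurableType disp}.
Variables (P : probability Omega R) (d : nat).
Variables (T : set 'rV[R]_d) (f : 'rV[R]_d -> {RV P >-> R}).
Hypothesis gf : centered_gaussian_field T f.
Hypothesis hf : homogeneous T f.
Hypothesis convT : convex_set (T : set (convex_lmodType 'rV[R]_d)).
Hypothesis smooth : {ae P, forall w, twice_cont_diff_on T (fun t => f t w)}.
Variables (z : 'rV[R]_d) (rho : R).
Hypothesis rho_gt0 : 0 < rho.
Hypothesis zT : forall h, `|h| <= rho -> T (z + h).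

Lemma convexT s t a : T s -> T t -> 0 <= a <= 1 -> T (s + a *: (t - s)).
Proof.
move=> Ts Tt /andP[a0 a1].
have := @convT t s (Itv01 a0 a1).
rewrite !inE => /(_ Tt Ts); rewrite /conv/=.
by congr T; rewrite scalerBl scale1r scalerBr addrCA.
Qed.

Let Tz : T z.
Proof. by have := @zT 0; rewrite addr0 normr0; apply; rewrite ltW. Qed.

(** Otherwise there are $h_m\to0$ along which the increment has standard deviation above
    $(m+1)|h_m|$. By the small-ball bound, the event that all increments with $m\ge k$ are at most
    $k|h_m|$ is null for every $k$. Yet almost every path is differentiable at [z] and belongs to
    one of these events. *)
Lemma ndist_local_Lipschitz : exists L delta : R, [/\ 0 < L, 0 < delta, delta <= rho &
  forall h, `|h| <= delta -> ndist f z (z + h) <= L * `|h|].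
Proof.
apply: contrapT => nL.
have mS0 m : 0 < m.+1%:R :> R by rewrite ltr0n.
have /choice[h Hh] : forall m : nat, exists h : 'rV[R]_d,
    `|h| <= rho / m.+1%:R /\ m.+1%:R * `|h| < ndist f z (z + h).
  move=> m; apply: contrapT => nh; apply: nL; exists m.+1%:R, (rho / m.+1%:R); split => //.
  - by rewrite divr_gt0.
  - by rewrite ler_pdivrMr// ler_peMr ?(ltW rho_gt0)// ler1n.
  - by move=> h hm; rewrite leNgt; apply/negP => H; apply: nh; exists h.
have hrho m : `|h m| <= rho.
  have [H _] := Hh m; apply: (le_trans H).
  by rewrite ler_pdivrMr// ler_peMr ?(ltW rho_gt0)// ler1n.
have h_gt0 m : 0 < `|h m|.
  rewrite normr_gt0; apply/eqP => h0; have [_] := Hh m.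
  by rewrite h0 normr0 mulr0 addr0 ndistxx ltxx.
pose E (k : nat) := \bigcap_(m in [set m | (k <= m)%N])
  [set w | `|lc3 f (z + h m) z z 1 (-1) 0 w| <= k%:R * `|h m|].
have mE k : measurable (E k).
  apply: bigcap_measurable => [|m _]; first by exists k => /=.
  rewrite -[X in measurable X]setTI.
  have -> : [set w | `|lc3 f (z + h m) z z 1 (-1) 0 w| <= k%:R * `|h m|] =
      lc3 f (z + h m) z z 1 (-1) 0 @^-1` `[- (k%:R * `|h m|), k%:R * `|h m|].
    by apply/seteqP; split => w /=; rewrite in_itv/= ler_norml.
  exact: measurable_lc3.
have PE k : P (E k) = 0.
  apply/eqP; rewrite eq_le measure_ge0 andbT; apply/lee_addgt0Pr => e e0; rewrite add0e.
  pose m := (k + Num.truncn (2 * k%:R / e))%N.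
  have Tzh : T (z + h m) by exact: zT.
  have vE : var3 f (z + h m) z z 1 (-1) 0 = dist2 f z (z + h m).
    by rewrite /var3 /dist2 (covC f (z + h m) z); ring.
  have [_ Hm] := Hh m.
  have nd0 : 0 < ndist f z (z + h m) by apply: le_lt_trans Hm; rewrite mulr_ge0.
  have v0 : 0 < var3 f (z + h m) z z 1 (-1) 0 by rewrite vE -sqrtr_gt0.
  have km0 : 0 <= k%:R * `|h m| by rewrite mulr_ge0.
  have := lc3_small_ball gf Tzh Tz Tz km0 v0; rewrite vE -/(ndist f z (z + h m)) => H.
  apply: (le_trans _ (le_trans H _)).
    apply: le_measure; rewrite ?inE//; last by move=> w; apply; rewrite /m /= leq_addr.
    rewrite -[X in measurable X]setTI.
    have -> : [set w | `|lc3 f (z + h m) z z 1 (-1) 0 w| <= k%:R * `|h m|] =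
        lc3 f (z + h m) z z 1 (-1) 0 @^-1` `[- (k%:R * `|h m|), k%:R * `|h m|].
      by apply/seteqP; split => w /=; rewrite in_itv/= ler_norml.
    exact: measurable_lc3.
  rewrite lee_fin.
  have q0 : 0 <= 2 * k%:R / e by rewrite divr_ge0 ?mulr_ge0// ltW.
  have /andP[_ Ht] := truncn_itv q0.
  have H2 : 2 * k%:R < e * m.+1%:R.
    move: Ht; rewrite ltr_pdivrMr// => Ht; rewrite [ltRHS]mulrC; apply: (lt_le_trans Ht).
    by rewrite ler_wpM2r ?(ltW e0)// ler_nat ltnS leq_addl.
  rewrite mulrA ler_pdivrMr//; apply: (le_trans _ (ler_wpM2l (ltW e0) (ltW Hm))).
  by rewrite mulrA mulrA ler_wpM2r// ltW.
have [N [mN PN0 subN]] := smooth.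
have : P.-negligible [set: Omega].
  apply: (@negligibleS _ _ _ _ (N `|` \bigcup_k E k)); last first.
    apply: negligibleU; first by apply/(negligibleP P mN).
    apply: negligible_bigcup => k; apply/(negligibleP P (mE k)); exact: PE.
  move=> w _; have [Nw|nNw] := pselect (N w); [by left|right].
  have [g [dg _ _] gf'] : twice_cont_diff_on T (fun t => f t w).
    by apply: contrapT => H; apply: nNw; apply: subN.
  have [k [delta [delta0 Hk]]] := differentiable_bound (dg z).
  pose K := (Num.truncn `|k| + Num.truncn (rho / delta)).+1.
  exists K => // m /= Km.
  have Tzh : T (z + h m) by exact: zT.
  rewrite /lc3 mul0r addr0 mul1r mulN1r !gf'//.
  apply: (le_trans (Hk _ _)).
    have [H _] := Hh m; apply: (le_lt_trans H).
    have q0 : 0 <= rho / delta by rewrite divr_ge0 ?(ltW rho_gt0) ?(ltW delta0).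
    have /andP[_ Ht] := truncn_itv q0.
    rewrite ltr_pdivrMr// mulrC -ltr_pdivrMr//; apply: (lt_le_trans Ht).
    by rewrite ler_nat ltnS (leq_trans _ (leq_trans (leqnSn _) Km))// leq_addl.
  rewrite ler_wpM2r// (le_trans (ler_norm k))//.
  have /andP[_ Ht] := truncn_itv (normr_ge0 k); apply: (le_trans (ltW Ht)).
  by rewrite ler_nat ltnS leq_addr.
move/negligibleP => /(_ measurableT) PT; have := @probability_setT _ _ _ P.
by rewrite PT => /eqP; rewrite eq_sym onee_eq0.
Qed.

(** The segment from [s] to [t] stays in the convex set [T]; each of its [n.+1] equal steps can be
    translated to start at [z], by homogeneity. *)
Lemma ndist_subdivide n s t : T s -> T t -> `|t - s| <= rho * n.+1%:R ->
  ndist f s t <= n.+1%:R * ndist f z (z + n.+1%:R^-1 *: (t - s)).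
Proof.
move=> Ts Tt Hn.
have n0 : 0 < n.+1%:R :> R by rewrite ltr0n.
set h := n.+1%:R^-1 *: (t - s).
have hr : `|h| <= rho.
  by rewrite /h normrZ gtr0_norm ?invr_gt0// mulrC ler_pdivrMr.
pose p (k : nat) := s + k%:R *: h.
have Tp k : (k <= n.+1)%N -> T (p k).
  move=> kn; rewrite /p /h scalerA; apply: convexT => //.
  by rewrite mulr_ge0 ?invr_ge0//= ler_pdivrMr// mul1r ler_nat.
have step k : (k < n.+1)%N -> ndist f (p k) (p k.+1) = ndist f z (z + h).
  move=> kn; rewrite -(@ndist_shift _ _ _ _ _ _ _ gf hf z (z + h) (p k - z)).
  - by rewrite addrC subrK addrAC subrKC /p -natr1 scalerDl scale1r addrA.
  - exact: Tz.
  - exact: zT.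
  - by rewrite addrC subrK; apply: Tp; rewrite ltnW.
  - by rewrite addrAC subrKC; have := Tp k.+1 kn; rewrite /p -natr1 scalerDl scale1r addrA.
have main k : (k <= n.+1)%N -> ndist f s (p k) <= k%:R * ndist f z (z + h).
  elim: k => [_|k IH kn]; first by rewrite /p scale0r addr0 ndistxx mul0r.
  apply: (le_trans (ndist_triangle gf Ts (Tp k (ltnW kn)) (Tp k.+1 kn))).
  by rewrite step// -natr1 mulrDl mul1r lerD// IH// ltnW.
have := main n.+1 (leqnn _).
by rewrite /p /h scalerA divff ?lt0r_neq0// scale1r addrC subrK.
Qed.

(** Positive homogeneity of [N] undoes the subdivision into short steps. It is applied to multiples
    of the norm and of the norm of the projection. *)
Lemma ndist_global (N : 'rV[R]_d -> R) (delta : R) : 0 < delta ->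
  (forall a x, 0 <= a -> N (a *: x) = a * N x) ->
  (forall h, `|h| <= delta -> ndist f z (z + h) <= N h) ->
  forall s t, T s -> T t -> ndist f s t <= N (t - s).
Proof.
move=> delta0 Nhom Nloc s t Ts Tt.
pose m := Num.min rho delta.
have m0 : 0 < m by rewrite /m lt_min rho_gt0 delta0.
pose n := Num.truncn (`|t - s| / m).
have n0 : 0 < n.+1%:R :> R by rewrite ltr0n.
have /andP[_ Ht] : n%:R <= `|t - s| / m < n.+1%:R.
  by apply: truncn_itv; rewrite divr_ge0 ?(ltW m0).
rewrite ltr_pdivrMr// in Ht.
apply: (le_trans (@ndist_subdivide n s t Ts Tt _)).
  by apply: (le_trans (ltW Ht)); rewrite mulrC ler_wpM2r// ge_min lexx.
have hd : `|n.+1%:R^-1 *: (t - s)| <= delta.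
  rewrite normrZ gtr0_norm ?invr_gt0// mulrC ler_pdivrMr//.
  by apply: (le_trans (ltW Ht)); rewrite mulrC ler_wpM2r// ge_min lexx orbT.
apply: (le_trans (ler_wpM2l (ltW n0) (Nloc _ hd))).
by rewrite Nhom ?invr_ge0// mulrA divff ?lt0r_neq0// mul1r.
Qed.

Lemma ndist_Lipschitz : exists2 L : R, 0 < L &
  forall s t, T s -> T t -> ndist f s t <= L * `|t - s|.
Proof.
have [L [delta [L0 d0 _ HL]]] := ndist_local_Lipschitz.
exists L => //; apply: (@ndist_global (fun h => L * `|h|) delta) => //.
by move=> a x a0; rewrite normrZ ger0_norm// mulrCA.
Qed.

Lemma ndist_opp h : `|h| <= rho -> ndist f z (z - h) = ndist f z (z + h).
Proof.
move=> hr; have hr' : `|- h| <= rho by rewrite normrN.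
rewrite ndistC -(@ndist_shift _ _ _ _ _ _ _ gf hf (z - h) z h) ?subrK//.
- exact: zT.
- exact: zT.
Qed.

Lemma ndist_sum (I : Type) (s : seq I) (y : I -> 'rV[R]_d) :
  \sum_(i <- s) `|y i| <= rho ->
  ndist f z (z + \sum_(i <- s) y i) <= \sum_(i <- s) ndist f z (z + y i).
Proof.
elim: s => [|i s IH]; first by rewrite !big_nil addr0 ndistxx.
rewrite !big_cons => H.
have S0 : 0 <= \sum_(j <- s) `|y j| by rewrite sumr_ge0.
have Hs : \sum_(j <- s) `|y j| <= rho by apply: le_trans H; rewrite lerDr.
have Hi : `|y i| <= rho by apply: le_trans H; rewrite lerDl.
have T1 : T (z + y i) by exact: zT.
have T2 : T (z + \sum_(j <- s) y j).
  by apply: zT; apply: le_trans Hs; rewrite ler_norm_sum.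
have T3 : T (z + (y i + \sum_(j <- s) y j)).
  apply: zT; apply: le_trans H; rewrite (le_trans (ler_normD _ _))// lerD2l.
  exact: ler_norm_sum.
apply: (le_trans (ndist_triangle gf Tz T1 T3)); rewrite lerD2l.
apply: le_trans (IH Hs).
have := @ndist_shift _ _ _ _ _ _ _ gf hf z (z + \sum_(j <- s) y j) (y i) Tz T2 T1.
by rewrite -addrA (addrC _ (y i)) => /(_ T3) ->.
Qed.

(** Walk in $\lfloor\tau/s\rfloor$ steps of length [s] and pay for the remainder with the Lipschitz
    bound. Smallness of the metric relative to a tiny step thus propagates to a fixed distance. *)
Lemma ndist_ray (L : R) (u : 'rV[R]_d) (s tau : R) :
  (forall s t, T s -> T t -> ndist f s t <= L * `|t - s|) ->
  0 < L -> `|u| = 1 -> 0 < s <= rho -> 0 <= tau <= rho ->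
  ndist f z (z + tau *: u) <= tau / s * ndist f z (z + s *: u) + L * s.
Proof.
move=> HL L0 u1 /andP[s0 sr] /andP[t0 tr].
have /andP[n1 n2] := truncn_itv (divr_ge0 t0 (ltW s0)).
set n := Num.trunc (tau / s) in n1 n2.
have n1' : n%:R * s <= tau by rewrite -ler_pdivlMr.
have n2' : tau < (n%:R + 1) * s by rewrite natr1 -ltr_pdivrMr.
have ns0 : 0 <= n%:R * s by rewrite mulr_ge0 ?(ltW s0).
have Tt : T (z + tau *: u) by apply: zT; rewrite normrZ u1 mulr1 ger0_norm.
have Tn : T (z + (n%:R * s) *: u).
  by apply: zT; rewrite normrZ u1 mulr1 ger0_norm// (le_trans n1').
apply: (le_trans (ndist_triangle gf Tz Tn Tt)); apply: lerD.
  apply: (@le_trans _ _ (n%:R * ndist f z (z + s *: u))).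
    case: (n) Tn ns0 n1' => [|m] Tn ns0 n1'; first by rewrite !mul0r scale0r addr0 ndistxx.
    apply: (le_trans (@ndist_subdivide m _ _ Tz Tn _)); rewrite addrAC subrr add0r.
      by rewrite normrZ u1 mulr1 ger0_norm// (le_trans n1')// (le_trans tr)// ler_peMr ?(ltW rho_gt0)// ler1n.
    by rewrite scalerA mulrA mulVf ?mul1r// pnatr_eq0.
  by rewrite ler_wpM2r ?ndist_ge0.
apply: (le_trans (HL _ _ Tn Tt)).
rewrite ler_wpM2l ?(ltW L0)// opprD addrACA subrr add0r -scalerBl normrZ u1 mulr1 ger0_norm; lra.
Qed.

Definition nondegenerate (J : {set 'I_d}) := exists c r : R, [/\ 0 < c, 0 < r, r <= rho &
  forall x : 'rV[R]_d, (forall i, i \notin J -> x ord0 i = 0) -> `|x| <= r ->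
    c * `|x| <= ndist f z (z + x)].

(** Negation gives vectors [x m] tending to 0 whose metric length is less than $|x_m|/(m+1)$. The
    unit vectors along them have a cluster point [v]; [ndist_ray] carries the smallness out to
    [tau], and the Lipschitz bound passes it to [v]. *)
Lemma degenerate_direction (J : {set 'I_d}) : ~ nondegenerate J ->
  exists v : 'rV[R]_d, [/\ `|v| = 1, forall i, i \notin J -> v ord0 i = 0 &
    forall tau : R, 0 <= tau <= rho -> ndist f z (z + tau *: v) = 0].
Proof.
move=> nJ; have [L L0 HL] := ndist_Lipschitz.
have mS0 m : 0 < m.+1%:R :> R by rewrite ltr0n.
have /choice[x Hx] : forall m : nat, exists x : 'rV[R]_d,
    [/\ forall i, i \notin J -> x ord0 i = 0, `|x| <= rho / m.+1%:R &
        ndist f z (z + x) < m.+1%:R^-1 * `|x|].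
  move=> m; apply: contrapT => nh; apply: nJ; exists m.+1%:R^-1, (rho / m.+1%:R); split => //.
  - by rewrite divr_gt0.
  - by rewrite ler_pdivrMr// ler_peMr ?(ltW rho_gt0)// ler1n.
  - by move=> y yJ yr; rewrite leNgt; apply/negP => H; apply: nh; exists y.
have x0 m : 0 < `|x m|.
  rewrite normr_gt0; apply/eqP => E; have [_ _] := Hx m.
  by rewrite E normr0 mulr0 addr0 ndistxx ltxx.
pose u m := `|x m|^-1 *: x m.
have u1 m : `|u m| = 1 by rewrite /u normrZ ger0_norm ?invr_ge0// mulVf// lt0r_neq0.
have xE m : x m = `|x m| *: u m by rewrite /u scalerA divff ?scale1r// lt0r_neq0.
have cK : compact [set v : 'rV[R]_d | forall i, [set` `[-1, 1]] (v ord0 i)].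
  by apply: (@rV_compact R d (fun=> [set` `[-1, 1]])) => i; exact: segment_compact.
have [|v [_ clv]] := cK (u @ \oo) _.
  exists 0%N => // m _ /= i; rewrite in_itv /= -ler_norml -(u1 m); exact: mx_norm_ge.
have near_v (e : R) k : 0 < e -> exists2 m, (k <= m)%N & `|v - u m| < e.
  move=> e0; have [|y [[m /= km <-] Hm]] := clv (u @` [set m | (k <= m)%N]) (ball v e) _ (nbhsx_ballx v e e0).
    by exists k => // m /= km; exists m.
  by exists m => //; move: Hm; rewrite -ball_normE.
have v1 : `|v| = 1.
  apply/eqP; rewrite -subr_eq0 -normr_le0; apply/ler_addgt0Pl => e e0; rewrite addr0.
  have [m _ Hm] := near_v e 0%N e0.
  by rewrite -(u1 m) (le_trans (ler_dist_dist _ _))// ltW.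
exists v; split => //.
- move=> i iJ; apply/eqP; rewrite -normr_le0; apply/ler_addgt0Pl => e e0; rewrite addr0.
  have [m _ Hm] := near_v e 0%N e0.
  have [xJ _ _] := Hx m.
  have um : u m ord0 i = 0 by rewrite /u mxE xJ// mulr0.
  have := mx_norm_ge (v - u m) i; rewrite [X in `|X| <= _]mxE [X in `|_ + X|]mxE um subr0 => H; apply: (le_trans H); exact: ltW.
move=> tau /andP[t0 tr]; apply/eqP; rewrite eq_le ndist_ge0 andbT; apply/ler_addgt0Pl => e e0; rewrite addr0.
pose k := Num.truncn (2 * (rho * (1 + L)) / e).
have D0 : 0 < rho * (1 + L) by rewrite mulr_gt0// addr_gt0.
have Lr0 : 0 < L * rho by rewrite mulr_gt0.
have [|m km Hm] := near_v (e / (2 * (L * rho))) k; first by rewrite divr_gt0 ?mulr_gt0.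
have [_ xr Hn] := Hx m.
have xrho : `|x m| <= rho.
  by apply: (le_trans xr); rewrite ler_pdivrMr// ler_peMr ?(ltW rho_gt0)// ler1n.
have Tv : T (z + tau *: v).
  by apply: zT; rewrite normrZ v1 mulr1 ger0_norm.
have Tu : T (z + tau *: u m) by apply: zT; rewrite normrZ u1 mulr1 ger0_norm.
apply: (le_trans (ndist_triangle gf Tz Tu Tv)).
have xm : 0 < `|x m| <= rho by rewrite x0.
have tt : 0 <= tau <= rho by rewrite t0.
have H1 := ndist_ray HL L0 (u1 m) xm tt.
rewrite -xE in H1.
have H2 : tau / `|x m| * ndist f z (z + x m) + L * `|x m| <= rho * (1 + L) / m.+1%:R.
  rewrite mulrDr mulr1 mulrDl (mulrC rho L) -(mulrA L); apply: lerD.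
    apply: (@le_trans _ _ (tau / `|x m| * (m.+1%:R^-1 * `|x m|))).
      by rewrite ler_wpM2l ?divr_ge0 ?(ltW Hn).
    have -> : tau / `|x m| * (m.+1%:R^-1 * `|x m|) = tau / m.+1%:R.
      by rewrite mulrACA mulVf ?mulr1// lt0r_neq0.
    by rewrite ler_wpM2r ?invr_ge0.
  by rewrite ler_wpM2l ?(ltW L0).
have H3 : rho * (1 + L) / m.+1%:R <= e / 2.
  have /andP[_ Ht] := truncn_itv (divr_ge0 (mulr_ge0 (ler0n R 2) (ltW D0)) (ltW e0)).
  rewrite ler_pdivrMr//.
  have {}Ht : 2 * (rho * (1 + L)) / e <= m.+1%:R by rewrite (le_trans (ltW Ht))// ler_nat ltnS.
  rewrite ler_pdivrMr// in Ht; lra.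
have H4 := HL _ _ Tu Tv.
have H5 : L * `|z + tau *: v - (z + tau *: u m)| <= e / 2.
  rewrite opprD addrACA subrr add0r -scalerBr normrZ ger0_norm//.
  apply: (@le_trans _ _ (L * (rho * (e / (2 * (L * rho)))))).
    by rewrite ler_wpM2l ?(ltW L0)// ler_pM// ltW.
  rewrite le_eqVlt; apply/orP; left; apply/eqP; field.
  by rewrite !lt0r_neq0.
by rewrite (splitr e); apply: lerD; [exact: le_trans H1 (le_trans H2 H3)|exact: le_trans H4 H5].
Qed.

Lemma max_nondegenerate : exists J : {set 'I_d}, nondegenerate J /\
  forall i, i \notin J -> ~ nondegenerate (i |: J).
Proof.
have n0 : `[< nondegenerate finset.set0 >].
  apply/asboolP; exists 1, rho; split=> // x x0 _.
  have -> : x = 0 by apply/rowP => i; rewrite x0 ?inE// mxE.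
  by rewrite normr0 mulr0 addr0 ndistxx.
have [J /maxsetP[/asboolP nJ maxJ] _] := @maxset_exists _ (fun J => `[< nondegenerate J >]) _ n0.
exists J; split => // i iJ /asboolP H.
have := maxJ _ H (finset.subsetUr _ _) => E.
by move: iJ; rewrite -E !inE eqxx.
Qed.

(* x *m A removes from x its coordinates outside a maximal nondegenerate J, along
   directions in which the increments of the field vanish. *)
Lemma degenerate_projection : exists (J : {set 'I_d}) (A : 'M[R]_d), [/\ nondegenerate J,
  forall x : 'rV[R]_d, forall i, i \notin J -> (x *m A) ord0 i = 0,
  forall x : 'rV[R]_d, (forall i, i \notin J -> x ord0 i = 0) -> x *m A = x &
  exists2 L, 0 < L & forall s t, T s -> T t -> ndist f s t <= L * `|(t - s) *m A|].
Proof.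
have [J [nJ maxJ]] := max_nondegenerate.
(* The null direction for [i |: J] must have a nonzero [i]-th coordinate, since otherwise it would
   be supported in [J] and contradict nondegeneracy there; it is rescaled to make that coordinate
   1. *)
have /choice[V HV] : forall i, exists v : 'rV[R]_d, i \notin J ->
    [/\ v ord0 i = 1, forall j, j \notin J -> j != i -> v ord0 j = 0 &
    forall tau : R, `|tau *: v| <= rho -> ndist f z (z + tau *: v) = 0].
  move=> i; case: (boolP (i \in J)) => [iJ|iJ]; first by exists 0.
  have [v [v1 vJ v0]] := degenerate_direction (maxJ i iJ).
  have vi : v ord0 i != 0.
    apply/eqP => vi0; have [c [r [c0 r0 rr Hc]]] := nJ.
    have : c * `|r *: v| <= ndist f z (z + r *: v).
      apply: Hc; last by rewrite normrZ v1 mulr1 ger0_norm// ltW.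
      move=> j jJ; rewrite mxE; have [->|ji] := eqVneq j i; first by rewrite vi0 mulr0.
      by rewrite vJ ?mulr0// !inE negb_or ji.
    rewrite v0 ?(ltW r0)// normrZ v1 mulr1 ger0_norm ?(ltW r0)//.
    by rewrite leNgt mulr_gt0.
  exists ((v ord0 i)^-1 *: v) => _; split.
  - by rewrite mxE mulVf.
  - by move=> j jJ ji; rewrite mxE (vJ j) ?mulr0// !inE negb_or ji.
  move=> tau; rewrite scalerA; move: (tau / _) => {}tau.
  rewrite normrZ v1 mulr1 => tr; have [t0|t0] := leP 0 tau.
    by rewrite v0// t0 -(ger0_norm t0).
  have Hv : `|- tau *: v| <= rho by rewrite normrZ v1 mulr1 normrN.
  by rewrite -[tau]opprK scaleNr ndist_opp// v0// oppr_ge0 (ltW t0)/= -(ltr0_norm t0).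
(* The matrix of $x\mapsto x-\sum_{i\notin J}x_iV_i$. *)
pose A : 'M[R]_d := \matrix_(i, j) ((i == j)%:R - (i \notin J)%:R * V i ord0 j).
have AE x j : (x *m A) ord0 j = x ord0 j - \sum_(i | i \notin J) x ord0 i * V i ord0 j.
  rewrite mxE; under eq_bigr do rewrite mxE mulrBr.
  rewrite sumrB; congr (_ - _).
    rewrite (bigD1 j)//= eqxx mulr1 big1 ?addr0// => i /negPf ->; by rewrite mulr0.
  rewrite [RHS]big_mkcond /=; apply: eq_bigr => i _.
  by case: (i \notin J); rewrite ?mul1r// mul0r mulr0.
exists J, A; split => //.
- move=> x i iJ; rewrite AE (bigD1 i)//= big1 ?addr0; last first.
    by move=> j /andP[jJ ji]; have [_ -> //] := HV j jJ; rewrite ?mulr0// eq_sym.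
  by have [-> _ _] := HV i iJ; rewrite mulr1 subrr.
- move=> x xJ; apply/rowP => j; rewrite AE big1 ?subr0// => i iJ; by rewrite xJ// mul0r.
have [L L0 HL] := ndist_Lipschitz; exists L => //.
pose SV := \sum_(i | i \notin J) `|V i|.
have SV0 : 0 <= SV by rewrite sumr_ge0.
have xE x : x = x *m A + \sum_(i | i \notin J) x ord0 i *: V i.
  apply/rowP => j; rewrite mxE AE summxE.
  by under [X in _ + X]eq_bigr do rewrite mxE; rewrite subrK.
have D0 : 0 < 1 + 2 * SV by lra.
apply: (@ndist_global (fun h => L * `|h *m A|) (rho / (1 + 2 * SV))); first by rewrite divr_gt0.
  by move=> a x a0; rewrite -scalemxAl normrZ ger0_norm// mulrCA.
move=> h; rewrite ler_pdivlMr// => hd.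
have sV : \sum_(i | i \notin J) `|h ord0 i *: V i| <= `|h| * SV.
  by rewrite mulr_sumr; apply: ler_sum => i _; rewrite normrZ ler_wpM2r// mx_norm_ge.
have hA : `|h *m A| <= `|h| * (1 + SV).
  rewrite (_ : h *m A = h - \sum_(i | i \notin J) h ord0 i *: V i); last first.
    by rewrite {2}(xE h) addrK.
  rewrite (le_trans (ler_normB _ _))// mulrDr mulr1 lerD2l.
  by apply: le_trans sV; exact: ler_norm_sum.
have hAr : `|h *m A| <= rho.
  apply: (le_trans hA); apply: le_trans hd; rewrite ler_wpM2l//; lra.
have sVr : \sum_(i | i \notin J) `|h ord0 i *: V i| <= rho.
  apply: (le_trans sV); apply: le_trans hd; rewrite ler_wpM2l//; lra.
have Tx : T (z + h *m A) by exact: zT.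
have Th : T (z + h).
  apply: zT; apply: le_trans hd; rewrite ler_peMr//; lra.
have T2 : T (z + \sum_(i | i \notin J) h ord0 i *: V i).
  by apply: zT; apply: le_trans sVr; exact: ler_norm_sum.
apply: (le_trans (ndist_triangle gf Tz Tx Th)).
have -> : ndist f (z + h *m A) (z + h) = 0.
  have := @ndist_shift _ _ _ _ _ _ _ gf hf z (z + \sum_(i | i \notin J) h ord0 i *: V i) (h *m A) Tz T2 Tx.
  rewrite -addrA (addrC _ (h *m A)) -xE => /(_ Th) ->.
  apply/eqP; rewrite eq_le ndist_ge0 andbT.
  have := @ndist_sum _ [seq i <- index_enum 'I_d | i \notin J] (fun i => h ord0 i *: V i).
  rewrite !big_filter => /(_ sVr) H; apply: (le_trans H).
  rewrite big1// => i iJ; have [_ _ ->//] := HV i iJ.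
  apply: le_trans sVr; rewrite (bigD1 i)//= lerDl; exact: sumr_ge0.
rewrite addr0; apply: (le_trans (HL _ _ Tz Tx)).
by rewrite addrAC subrr add0r.
Qed.

End Geometry.

Section Layers.
Context {R : realType} {disp : measure_display} {Omega : measurableType disp}.
Variable P : probability Omega R.

(** Almost surely [h] is below the sum of the [a y] times the indicators of the [E y], whether or
    not these overlap; the final 2 is the sum of the geometric series. *)
Lemma layered_integral_le (E : nat -> set Omega) (a : nat -> R) (h : Omega -> R) (c : R) :
  measurable_fun setT h -> (forall w, 0 <= h w) -> (forall y, 0 <= a y) ->
  (forall y, measurable (E y)) -> (forall y, ((a y)%:E * P (E y) <= (c * 2^-1 ^+ y)%:E)%E) ->
  {ae P, forall w, h w = 0 \/ exists2 y, E y w & h w <= a y} ->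
  (\int[P]_w (h w)%:E <= (2 * c)%:E)%E.
Proof.
move=> mh h0 a0 mE PE hE.
pose g y w : \bar R := ((a y)%:E * (\1_(E y) w)%:E)%E.
have g0 y w : (0 <= g y w)%E by rewrite mule_ge0 ?lee_fin.
have mg y : measurable_fun setT (g y).
  apply: measurable_funeM; apply/measurable_EFinP; exact: measurable_indic.
apply: (@le_trans _ _ (\int[P]_w (\sum_(y <oo) g y w))%E).
  apply: ae_ge0_le_integral => //.
  - by move=> w _; rewrite lee_fin.
  - exact/measurable_EFinP.
  - by move=> w _; apply: nneseries_ge0.
  - by apply: ge0_emeasurable_sum.
  apply: filterS hE => w H _.
  have s0 : (0 <= \sum_(y <oo) g y w)%E by apply: nneseries_ge0.
  case: H => [->//|[y Ey hy]].
  apply: (@le_trans _ _ (g y w)).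
    by rewrite /g indicE mem_set// mule1 lee_fin.
  rewrite (nneseriesD1 (n := y))// leeDl//; exact: nneseries_ge0.
rewrite integral_nneseries//.
have c0 : 0 <= c.
  have := PE 0%N; rewrite expr0 mulr1 -lee_fin; apply: le_trans.
  by rewrite mule_ge0// lee_fin.
apply: lime_le; first by apply: is_cvg_nneseries => y _ _; apply: integral_ge0.
near=> n; rewrite big_mkord.
apply: (@le_trans _ _ (\sum_(y < n) (c * 2^-1 ^+ y)%:E)%E).
  apply: lee_sum => y _; apply: le_trans (PE y).
  have -> : (\int[P]_w g y w = (a y)%:E * P (E y))%E; last by [].
  rewrite /g ge0_integralZl ?lee_fin ?integral_indic ?setIT//.
  by apply/measurable_EFinP; exact: measurable_indic.
rewrite sumEFin lee_fin -mulr_sumr mulrC ler_wpM2r//; exact: sum_pow2_le.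
Unshelve. all: by end_near.
Qed.

End Layers.

Lemma rat_row_dense {R : realType} (d : nat) (x : 'rV[R]_d) (e : R) : 0 < e ->
  exists q : 'rV[rat]_d, `|x - map_mx ratr q| < e.
Proof.
move=> e0.
have /choice[q Hq] : forall i, exists q : rat, `|x ord0 i - ratr q| < e.
  move=> i; have [|q] := @rat_in_itvoo _ (x ord0 i - e) (x ord0 i + e).
    by rewrite ltrD2l; lra.
  by rewrite in_itv /= => /andP[H1 H2]; exists q; rewrite ltr_norml; lra.
exists (\row_i q i); apply: mx_norm_lt => // i.
by rewrite [X in `|X|]mxE [X in `|_ + X|]mxE [X in - X]mxE [X in - _ X]mxE.
Qed.

(** For each rational pair and each scale, a nearby member of [D] is chosen if there is one. Pairs
    are used because [D] will consist of points with equal projection; a set of single points is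
    placed on the diagonal. *)
Lemma dense_pairs {R : realType} (d : nat) (D : set ('rV[R]_d * 'rV[R]_d)) : D !=set0 ->
  exists u : nat -> 'rV[R]_d * 'rV[R]_d, (forall n, D (u n)) /\
  forall x (e : R), D x -> 0 < e ->
    exists n, `|x.1 - (u n).1| < e /\ `|x.2 - (u n).2| < e.
Proof.
move=> [x0 Dx0].
pose near (k : 'rV[rat]_d * 'rV[rat]_d * nat) (x : 'rV[R]_d * 'rV[R]_d) :=
  `|x.1 - map_mx ratr k.1.1| < k.2.+1%:R^-1 /\ `|x.2 - map_mx ratr k.1.2| < k.2.+1%:R^-1.
have /choice[v Hv] : forall k, exists y, D y /\ ((exists x, D x /\ near k x) -> near k y).
  move=> k; have [[x [Dx nx]]|H] := pselect (exists x, D x /\ near k x).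
    by exists x.
  by exists x0.
exists (fun n => if unpickle n is Some k then v k else x0); split.
  by move=> n; case: unpickle => // k; have [] := Hv k.
move=> x e Dx e0.
pose n := Num.truncn (2 / e).
have n0 : 0 < n.+1%:R^-1 :> R by rewrite invr_gt0.
have ne : n.+1%:R^-1 <= e / 2.
  have /andP[_ H] := truncn_itv (divr_ge0 (ler0n R 2) (ltW e0)).
  rewrite -[leRHS]invf_div lef_pV2 ?posrE ?divr_gt0 ?ltr0n//; exact: ltW.
have [q1 H1] := rat_row_dense x.1 n0.
have [q2 H2] := rat_row_dense x.2 n0.
exists (pickle (q1, q2, n)); rewrite pickleK.
have [_ H] := Hv (q1, q2, n).
have [H3 H4] : near (q1, q2, n) (v (q1, q2, n)) by apply: H; exists x.
rewrite (splitr e); split.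
  rewrite (le_lt_trans (ler_distD (map_mx ratr q1) _ _))// (distrC (map_mx _ _)).
  by apply: ltrD; [exact: lt_le_trans H1 ne|exact: lt_le_trans H3 ne].
rewrite (le_lt_trans (ler_distD (map_mx ratr q2) _ _))// (distrC (map_mx _ _)).
by apply: ltrD; [exact: lt_le_trans H2 ne|exact: lt_le_trans H4 ne].
Qed.

Lemma continuous_close {R : realType} (d : nat) (h : 'rV[R]_d -> R) x (e : R) :
  continuous h -> 0 < e -> exists2 delta : R, 0 < delta &
    forall y, `|x - y| < delta -> `|h x - h y| < e.
Proof.
move=> /(_ x)/cvgrPdist_lt/(_ e)/[apply] /nbhs_normP[delta /= d0 H].
by exists delta => // y xy; exact: (H y).
Qed.

(** * Sample paths factor through the projection; maximizers and outer points *)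

Section Projection.
Context {R : realType} {disp : measure_display} {Omega : measurableType disp}.
Variables (P : probability Omega R) (d : nat).
Variables (T : set 'rV[R]_d) (f : 'rV[R]_d -> {RV P >-> R}).
Hypothesis gf : centered_gaussian_field T f.
Hypothesis hf : homogeneous T f.
Hypothesis convT : convex_set (T : set (convex_lmodType 'rV[R]_d)).
Hypothesis smooth : {ae P, forall w, twice_cont_diff_on T (fun t => f t w)}.
Variables (z : 'rV[R]_d) (rho : R).
Hypothesis rho_gt0 : 0 < rho.
Hypothesis zT : forall h, `|h| <= rho -> T (z + h).
Variables (J : {set 'I_d}) (A : 'M[R]_d) (L : R).
Hypothesis pi_supp : forall (x : 'rV[R]_d) i, i \notin J -> (x *m A) ord0 i = 0.
Hypothesis pi_id : forall x : 'rV[R]_d, (forall i, i \notin J -> x ord0 i = 0) -> x *m A = x.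
Hypothesis ndist_le : forall s t, T s -> T t -> ndist f s t <= L * `|(t - s) *m A|.

Let Tz : T z.
Proof. by have := @zT 0; rewrite addr0 normr0; apply; rewrite ltW. Qed.

(** Each pair with equal projections has an increment of variance zero. A countable dense family of
    such pairs keeps the exceptional set null, and continuity of the path extends the equality to
    all pairs. *)
Lemma sample_paths_project : {ae P, forall w,
  (exists2 h : 'rV[R]_d -> R, continuous h & forall t, T t -> f t w = h t) /\
  forall s t, T s -> T t -> s *m A = t *m A -> f s w = f t w}.
Proof.
pose D := [set x : 'rV[R]_d * 'rV[R]_d | [/\ T x.1, T x.2 & x.1 *m A = x.2 *m A]].
have D0 : D !=set0 by exists (z, z).
have [u [Du denseu]] := dense_pairs D0.
have : {ae P, forall w, forall n, f (u n).1 w = f (u n).2 w}.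
  apply/ae_foralln => n; have [T1 T2 E] := Du n.
  have v0 : var3 f (u n).1 (u n).2 z 1 (-1) 0 = 0.
    have -> : var3 f (u n).1 (u n).2 z 1 (-1) 0 = dist2 f (u n).1 (u n).2.
      by rewrite /var3 /dist2; ring.
    rewrite -(ndistK gf T1 T2); apply/eqP; rewrite sqrf_eq0 eq_le ndist_ge0 andbT.
    by rewrite (le_trans (ndist_le T1 T2))// mulmxBl E subrr normr0 mulr0.
  have P0 := lc3_degenerate gf T1 T2 Tz v0.
  exists [set w | lc3 f (u n).1 (u n).2 z 1 (-1) 0 w != 0]; split => //.
    rewrite -[X in measurable X]setTI.
    have -> : [set w | lc3 f (u n).1 (u n).2 z 1 (-1) 0 w != 0] =
        lc3 f (u n).1 (u n).2 z 1 (-1) 0 @^-1` [set~ 0].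
      by apply/seteqP; split => w /= /eqP.
    by apply: measurable_lc3 => //; exact: measurableC.
  move=> w /= H; apply/negP => /eqP H0; apply: H; apply/eqP; rewrite -subr_eq0.
  by move: H0; rewrite /lc3 mul0r addr0 mul1r mulN1r => ->.
apply: filterS2 smooth => w [h [dh _ _] fh] Hu.
have ch : continuous h by move=> x; exact: differentiable_continuous (dh x).
split; first by exists h.
move=> s t Ts Tt E; apply/eqP; rewrite -subr_eq0 -normr_le0; apply/ler_addgt0Pl => e e0.
rewrite addr0 !fh//.
have e20 : 0 < e / 2 by rewrite divr_gt0.
have [d1 d10 H1] := continuous_close s ch e20.
have [d2 d20 H2] := continuous_close t ch e20.
have [|n] := denseu (s, t) (Num.min d1 d2) (And3 Ts Tt E).
  by rewrite lt_min d10.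
have [T1 T2 _] := Du n.
rewrite !lt_min /= => -[/andP[/H1 H3 _] /andP[_ /H2 H4]].
have := Hu n; rewrite !fh// => E'.
rewrite (le_trans (ler_distD (h (u n).1) _ _))// {2}E' (distrC _ (h t)) (splitr e).
by rewrite lerD// ltW.
Qed.

(* The projection of t lies on no open segment from the projection of a point of T
   to that of z: t is a boundary point as seen from z. *)
Definition outer_point (t : 'rV[R]_d) := T t /\ forall s (eta : R), T s -> 0 < eta < 1 ->
  t *m A <> (s + eta *: (z - s)) *m A.

Hypothesis J_proper : exists i, i \notin J.

(* Otherwise t could be moved inside T along the kernel of the projection without
   changing the value of the field, giving a second maximizer. *)
Lemma argmax_outer w t : (forall s t, T s -> T t -> s *m A = t *m A -> f s w = f t w) ->
  (exists! t, T t /\ forall s, T s -> f s w <= f t w) ->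
  T t -> (forall s, T s -> f s w <= f t w) -> outer_point t.
Proof.
move=> fp [t0 [_ uniq0]] Tt max_t; split => // s eta Ts /andP[eta0 eta1] E.
have tt0 : t0 = t by exact: uniq0.
have [i iJ] := J_proper.
(* A nonzero vector of the kernel, with [i]-th coordinate 1. Moving [z] along it keeps the
   projection of the constructed point equal to that of [t]. *)
pose v : 'rV[R]_d := 'e_i - 'e_i *m A.
have vA : v *m A = 0.
  by rewrite mulmxBl (pi_id (x := 'e_i *m A)) ?subrr// => j jJ; exact: pi_supp.
have vi : v ord0 i = 1 by rewrite [LHS]mxE [X in _ + X]mxE pi_supp// subr0 mxE !eqxx.
have v0 : 0 < `|v|.
  by rewrite normr_gt0; apply/eqP => H; move: vi; rewrite H mxE => /eqP; rewrite eq_sym oner_eq0.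
have Tbar (a : R) : `|a| <= rho / `|v| -> T (s + eta *: (z + a *: v - s)).
  move=> ha; apply: (convexT convT) => //; last by rewrite !ltW.
  by apply: zT; rewrite normrZ -ler_pdivlMr.
have pibar (a : R) : (s + eta *: (z + a *: v - s)) *m A = t *m A.
  rewrite E !mulmxDl -!scalemxAl !mulmxBl mulmxDl -scalemxAl vA scaler0 addr0.
  by rewrite -mulmxBl.
have r0 : 0 < rho / `|v| by rewrite divr_gt0.
have val a : `|a| <= rho / `|v| -> t0 = s + eta *: (z + a *: v - s).
  move=> ha; apply: uniq0; split; first exact: Tbar.
  by move=> y Ty; rewrite (fp _ t (Tbar _ ha) Tt (pibar a)); exact: max_t.
have h0 := val 0; rewrite normr0 in h0; have {}h0 := h0 (ltW r0).
have hr := val (rho / `|v|); rewrite ger0_norm ?(ltW r0)// in hr; have {}hr := hr (lexx _).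
move: h0; rewrite hr => /addrI/(scalerI (lt0r_neq0 eta0))/addIr/addrI.
move=> /(congr1 (fun x : 'rV[R]_d => x ord0 i)) /=.
rewrite [LHS]mxE [RHS]mxE vi mulr1 mul0r => H; by rewrite H ltxx in r0.
Qed.

(** If the scaled points were closer, [z + 2 *: g] would lie in the ball around [z], and the segment
    from [t] to it would contain a point [s] of [T] with $(s-z)A=\frac{2m}{m+l}(t'-z)A$. Then [t']
    projects strictly between [s] and [z], which is impossible for an outer point. *)
Lemma outer_separated t t' (l m : R) : outer_point t -> outer_point t' -> 0 < l < m ->
  rho / 2 * (m - l) <= `|l *: ((t - z) *m A) - m *: ((t' - z) *m A)|.
Proof.
move=> [Tt _] [Tt' out'] /andP[l0 lm]; rewrite leNgt; apply/negP => H.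
have m0 : 0 < m by apply: lt_trans lm.
have ml0 : 0 < m - l by rewrite subr_gt0.
have ml0' : 0 < m + l by rewrite addr_gt0.
set y := (t - z) *m A in H; set y' := (t' - z) *m A in H.
pose g := (m - l)^-1 *: (m *: y' - l *: y).
have gA : g *m A = g.
  have -> : g = ((m - l)^-1 *: (m *: (t' - z) - l *: (t - z))) *m A.
    by rewrite -scalemxAl mulmxBl -!scalemxAl.
  by apply: pi_id => i; exact: pi_supp.
have g2 : `|2 *: g| <= rho.
  rewrite normrZ ger0_norm// mulrC -ler_pdivlMr// /g normrZ gtr0_norm ?invr_gt0//.
  by rewrite mulrC ler_pdivrMr// distrC ltW.
pose th := (m - l) / (m + l).
have th01 : 0 <= th <= 1.
  by rewrite /th divr_ge0 ?(ltW ml0) ?(ltW ml0')//= ler_pdivrMr// mul1r; lra.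
pose s := t + th *: (z + 2 *: g - t).
have Ts : T s by apply: (convexT convT) => //; exact: zT.
have eta01 : 0 < (m - l) / (2 * m) < 1.
  by rewrite divr_gt0 ?mulr_gt0//= ltr_pdivrMr ?mulr_gt0// mul1r; lra.
apply: (out' s _ Ts eta01).
have sA : s *m A = t *m A + th *: (z *m A + 2 *: g - t *m A).
  by rewrite /s mulmxDl -scalemxAl mulmxBl mulmxDl -scalemxAl gA.
rewrite mulmxDl -scalemxAl mulmxBl sA /g /y /y' !mulmxBl.
move: (t *m A) (t' *m A) (z *m A) => a a' b; apply/rowP => j; rewrite !mxE /th; field.
by rewrite !lt0r_neq0.
Qed.

Hypothesis compT : compact T.

Lemma projection_bounded : exists2 D : R, 0 < D & forall t, T t -> `|(t - z) *m A| <= D.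
Proof.
have [M [Mreal HM]] := compact_bounded compT.
pose B := `|M| + 1.
have HB t : T t -> `|t| <= B.
  by apply: HM; rewrite /B (le_lt_trans (ler_norm _))// ltrDl.
have B0 : 0 < B by rewrite ltr_wpDl.
pose k := \sum_i `|row i A|; have k0 : 0 <= k by rewrite sumr_ge0.
exists (2 * B * k + 1); first by rewrite ltr_wpDl// !mulr_ge0// ltW.
move=> t Tt; apply: (@le_trans _ _ (2 * B * k)); last by rewrite lerDl.
have tz : `|t - z| <= 2 * B.
  by rewrite (le_trans (ler_normB _ _))// mulr_natl mulr2n lerD// HB.
rewrite mulmx_sum_row (le_trans (ler_norm_sum _ _ _))// /k mulr_sumr; apply: ler_sum => i _.
by rewrite normrZ ler_wpM2r// (le_trans (mx_norm_ge _ _)).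
Qed.

(* The copies of I scaled towards z by 1 - j kappa / b, with j of order b, are
   jointly separated, so a packing bound in dimension #|J| gains a factor b. *)
Lemma outer_count : exists C b1, [/\ 0 < C, 0 < b1 & forall (b : R) (I : seq 'rV[R]_d),
  b1 <= b -> uniq I -> (forall x, x \in I -> outer_point x) ->
  {in I &, forall x y, x != y -> 1 < b * `|x *m A - y *m A|} ->
  b * (size I)%:R <= C * b ^+ #|J|].
Proof.
have [D D0 HD] := projection_bounded.
exists (8 / rho * (4 * D + 2) ^+ #|J|), (8 / rho + 1).
have r8 : 0 < 8 / rho by rewrite divr_gt0.
split; [by rewrite mulr_gt0 ?exprn_gt0//; lra|by rewrite addr_gt0|].
move=> b I bb1 uI Iout Isep.
have b1 : 1 <= b by apply: le_trans bb1; rewrite lerDr ltW.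
have b0 : 0 < b by apply: lt_le_trans b1.
have b8 : 8 <= b * rho by rewrite -ler_pdivrMr//; apply: le_trans bb1; rewrite lerDl.
have q0 : 0 <= b * rho / 4 by rewrite divr_ge0// mulr_ge0 ?ltW.
(* The number of scaled copies: small enough to keep all factors in $[1/2,1]$, and at least
   $b\rho/8$ because $b\rho\ge8$. *)
pose n := Num.truncn (b * rho / 4).
(* Consecutive factors [lam] differ by $2/(\rho b)$, which [outer_separated] turns into distance
   $1/b$. Within one copy the factor $1/2$ leaves $1/(2b)$, the separation used for all pairs. *)
have /andP[n1 n2] : n%:R <= b * rho / 4 < n%:R + 1 by rewrite natr1; exact: truncn_itv.
have rb0 : 0 < rho * b by rewrite mulr_gt0.
pose lam (j : nat) : R := 1 - j%:R * (2 / rho) / b.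
have lamE j : lam j = 1 - 2 * j%:R / (rho * b) by rewrite /lam; field; rewrite !lt0r_neq0.
have lam_ge j : (j < n)%N -> 1 / 2 <= lam j <= 1.
  move=> jn; rewrite lamE.
  have j0 : 0 <= 2 * j%:R / (rho * b) by rewrite divr_ge0 ?(ltW rb0)// mulr_ge0.
  have : 2 * j%:R / (rho * b) <= 1 / 2.
    rewrite ler_pdivrMr ?mulr_gt0//.
    have : j%:R <= n%:R :> R by rewrite ler_nat ltnW.
    by lra.
  by lra.
pose pt (x : 'rV[R]_d) (j : nat) := lam j *: ((x - z) *m A).
have sep_lt x y i j : x \in I -> y \in I -> (i < n)%N -> (j < n)%N -> (j < i)%N ->
    1 / (2 * b) <= `|pt x i - pt y j|.
  move=> xI yI ni nj ij.
  have /andP[li _] := lam_ge i ni.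
  have lij : 2 / (rho * b) <= lam j - lam i.
    have -> : lam j - lam i = (i%:R - j%:R) * (2 / (rho * b)).
      by rewrite !lamE; field; rewrite !lt0r_neq0.
    rewrite ler_peMl ?divr_ge0 ?(ltW rb0)//.
    by rewrite lerBrDr addrC natr1 ler_nat.
  have p0 : 0 < 2 / (rho * b) by rewrite divr_gt0 ?mulr_gt0.
  have H : 0 < lam i < lam j by apply/andP; split; lra.
  apply: le_trans (outer_separated (Iout _ xI) (Iout _ yI) H).
  apply: (@le_trans _ _ (rho / 2 * (2 / (rho * b)))).
    have -> : rho / 2 * (2 / (rho * b)) = 2 * (1 / (2 * b)) by field; rewrite !lt0r_neq0.
    by rewrite ler_peMl ?divr_ge0 ?mulr_ge0 ?ltW//; lra.
  by rewrite ler_wpM2l ?divr_ge0 ?(ltW rho_gt0).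
have sep x y i j : x \in I -> y \in I -> (i < n)%N -> (j < n)%N -> (x, i) != (y, j) ->
    1 / (2 * b) <= `|pt x i - pt y j|.
  move=> xI yI ni nj; case: (ltngtP i j) => [ij|ij|->].
  - by move=> _; rewrite distrC; exact: sep_lt.
  - by move=> _; exact: sep_lt.
  rewrite xpair_eqE eqxx andbT => xy.
  have /andP[li _] := lam_ge j nj.
  have -> : pt x j - pt y j = lam j *: ((x - y) *m A).
    by rewrite /pt -scalerBr -mulmxBl opprB addrA subrK.
  have := Isep _ _ xI yI xy; rewrite -mulmxBl => H.
  rewrite normrZ ger0_norm; last by lra.
  apply: (@le_trans _ _ (1 / 2 * `|(x - y) *m A|)).
    rewrite ler_pdivrMr ?mulr_gt0//; lra.
  by rewrite ler_wpM2r.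
pose s := [seq pt x j | x <- I, j <- iota 0 n].
have sP u : u \in s -> exists x j, [/\ x \in I, (j < n)%N & u = pt x j].
  by move=> /allpairsP[[x j] /= [xI]]; rewrite mem_iota add0n => jn ->; exists x, j.
have us : uniq s.
  apply: allpairs_uniq; rewrite ?iota_uniq// => -[x i] [y j].
  move=> /allpairsP[[x' i'] /= [xI + [-> ->]]]; rewrite mem_iota add0n => iN.
  move=> /allpairsP[[y' j'] /= [yI + [-> ->]]]; rewrite mem_iota add0n => jN.
  move=> E; apply/eqP/negPn/negP => ne.
  have := sep _ _ _ _ xI yI iN jN ne; rewrite E subrr normr0 leNgt divr_gt0// mulr_gt0//.
have db0 : 0 < 1 / (2 * b) by rewrite divr_gt0// mulr_gt0.
have := @packing_bound _ d J s D _ db0 (ltW D0) us.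
have -> : (size s)%:R = n%:R * (size I)%:R :> R by rewrite size_allpairs size_iota natrM mulrC.
move=> H.
have {}H : n%:R * (size I)%:R <= ((4 * D + 2) * b) ^+ #|J|.
  apply: (le_trans (H _ _ _)).
  - by move=> u /sP[x [j [xI jn ->]]] i iJ; rewrite mxE pi_supp ?mulr0.
  - move=> u /sP[x [j [xI jn ->]]]; have /andP[l1 l2] := lam_ge j jn.
    rewrite normrZ ger0_norm; last by lra.
    have [Tx _] := Iout x xI.
    by rewrite (le_trans _ (HD x Tx))// ler_piMl.
  - move=> u v /sP[x [j [xI jn ->]]] /sP[y [i [yI iN ->]]] uv; apply: sep => //.
    by apply: contraNneq uv => -[-> ->].
  have -> : 2 * D / (1 / (2 * b)) = 4 * D * b by field; rewrite lt0r_neq0.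
  rewrite lerXn2r ?nnegrE ?mulr_ge0 ?addr_ge0 ?mulr_ge0 ?ltW//; last by lra.
have n8 : b * rho / 8 <= n%:R by lra.
apply: (@le_trans _ _ (8 / rho * (n%:R * (size I)%:R))).
  rewrite mulrA ler_wpM2r// -ler_pdivrMl// invf_div; lra.
by rewrite exprMn in H; rewrite -[leRHS]mulrA ler_wpM2l// (ltW r8).
Qed.

End Projection.

Section Grid.
Context {R : realType} {disp : measure_display} {Omega : measurableType disp}.
Variables (P : probability Omega R) (d : nat).
Variables (T : set 'rV[R]_d) (f : 'rV[R]_d -> {RV P >-> R}).
Hypothesis gf : centered_gaussian_field T f.
Hypothesis hf : homogeneous T f.
Variable sigma : R.
Hypothesis sigma_gt0 : 0 < sigma.
Hypothesis var_sigma : forall t, T t -> cov f t t = sigma ^+ 2.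
Variables (z : 'rV[R]_d) (rho : R).
Hypothesis rho_gt0 : 0 < rho.
Hypothesis zT : forall h, `|h| <= rho -> T (z + h).

Let Tz : T z.
Proof. by have := @zT 0; rewrite addr0 normr0; apply; rewrite ltW. Qed.

(** The grid spans only the directions in [J]. The perturbation [p] allows two uses: the identity
    when refuting degeneracy, and the passage to a nearby discretization point in the final lower
    bound. *)
Lemma grid_prob (J : {set 'I_d}) : nondegenerate f z rho J ->
  exists c b1 : R, [/\ 0 < c, 0 < b1 & forall (b : R) (p : 'rV[R]_d -> 'rV[R]_d), b1 <= b ->
    (forall x, T x -> [/\ T (p x), b * `|p x - x| <= 1 &
      forall i, i \notin J -> p x ord0 i = x ord0 i]) ->
    exists s : seq 'rV[R]_d, (forall x, x \in s -> T x) /\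
      ((c * b ^+ #|J| * gauss_tail (b / sigma))%:E <=
       P [set w | exists2 x, x \in s & (b < f (p x) w)%R])%E].
Proof.
move=> [c [r [c0 r0 rr Hc]]].
have [kap kap0 Hg] := grid_lower gf sigma_gt0 var_sigma.
(* The 4 makes the displacement of two grid points by [p], at most 2 in units of $1/b$, no more than
   half the mesh; the second term ensures $c^2K^2\ge4d\,kap$. *)
pose K := 4 + 4 * d%:R * kap / c ^+ 2.
have K4 : 4 <= K by rewrite /K lerDl divr_ge0 ?exprn_ge0 ?(ltW c0)// !mulr_ge0// ltW.
have K0 : 0 < K by lra.
have KE : 4 * d%:R * kap <= c ^+ 2 * K ^+ 2.
  apply: (@le_trans _ _ (c ^+ 2 * K)).
    rewrite -ler_pdivrMl ?exprn_gt0// mulrC /K lerDr; lra.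
  by rewrite ler_wpM2l ?exprn_ge0 ?(ltW c0)// expr2 ler_peMl; lra.
exists ((r / (4 * K)) ^+ #|J| / 2), (sigma + 4 / r); split.
- by rewrite divr_gt0 ?exprn_gt0 ?divr_gt0 ?mulr_gt0.
- by rewrite addr_gt0 ?divr_gt0.
move=> b p bb1 Hp.
have sb : sigma <= b by apply: le_trans bb1; rewrite lerDl divr_ge0 ?(ltW r0).
have b0 : 0 < b by apply: lt_le_trans sb.
have rb : 4 <= b * r by rewrite -ler_pdivrMr//; apply: le_trans bb1; rewrite lerDr ltW.
pose m := Num.truncn (b * r / (4 * K)).
have q0 : 0 <= b * r / (4 * K) by rewrite divr_ge0 ?mulr_ge0 ?(ltW b0) ?(ltW r0) ?(ltW K0).
have /andP[m1 m2] := truncn_itv q0; rewrite -/m in m1 m2.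
pose g (i : {ffun 'I_d -> 'I_m.+1}) : 'rV[R]_d := \row_k (K / b * (i k)%:R).
have gr i : `|g i| <= r / 4.
  apply: mx_norm_le; first by rewrite divr_ge0 ?(ltW r0).
  move=> k; rewrite mxE ger0_norm ?mulr_ge0 ?invr_ge0 ?(ltW b0) ?(ltW K0)//.
  apply: (@le_trans _ _ (K / b * (b * r / (4 * K)))).
    rewrite ler_wpM2l ?divr_ge0 ?(ltW b0) ?(ltW K0)//; apply: le_trans m1.
    by rewrite ler_nat -ltnS.
  by rewrite le_eqVlt; apply/orP; left; apply/eqP; field; rewrite !lt0r_neq0.
have Tg i : T (z + g i) by apply: zT; apply: (le_trans (gr i)); lra.
pose s := enum (pffun_on ord0 (mem J) (@predT 'I_m.+1)).
have sJ i k : i \in s -> k \notin J -> i k = ord0.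
  rewrite mem_enum => /pffun_onP[/fintype.subsetP H _] kJ.
  by apply/eqP; apply: contraNT kJ => ik; apply: H.
have szs : (size s = m.+1 ^ #|J|)%N.
  by rewrite -cardE card_pffun_on card_ord.
exists [seq z + g i | i <- s]; split.
  by move=> x /mapP[i _ ->]; exact: Tg.
have := Hg b m.+1 (fun i => p (z + g i)) s sb (enum_uniq _) _ _.
have -> : [set w | exists2 i, i \in s & (b < f (p (z + g i)) w)%R] =
    [set w | exists2 x, x \in [seq z + g i | i <- s] & (b < f (p x) w)%R].
  apply/seteqP; split => w /= [x xs bx]; first by exists (z + g x) => //; apply: map_f.
  by case/mapP: xs bx => i is_ ->; exists i.
move=> H; apply: (le_trans _ (H _ _)).
- rewrite lee_fin szs natrX (_ : (r / (4 * K)) ^+ #|J| / 2 * b ^+ #|J| * gauss_tail (b / sigma) =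
    (b * r / (4 * K)) ^+ #|J| * (gauss_tail (b / sigma) / 2)); last first.
    by rewrite -mulrA exprMn [in RHS]exprMn [in RHS]exprMn exprVn; ring.
  rewrite ler_wpM2r ?divr_ge0 ?gauss_tail_ge0// lerXn2r ?nnegrE// ltW//.
- by move=> i _; have [] := Hp _ (Tg i).
move=> i j is_ js.
have [Ti pi_ piJ] := Hp _ (Tg i); have [Tj pj pjJ] := Hp _ (Tg j).
set x := p (z + g i) in Ti pi_ piJ *; set y := p (z + g j) in Tj pj pjJ *.
have ij_norm : b * `|(y - x) - (g j - g i)| <= 2.
  have -> : y - x - (g j - g i) = (y - (z + g j)) - (x - (z + g i)).
    by apply/rowP => k; rewrite !mxE; ring.
  apply: (le_trans (ler_wpM2l (ltW b0) (ler_normB _ _))); rewrite mulrDr; lra.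
have xyr : `|y - x| <= r.
  have := lerB_dist (y - x) (g j - g i); have := ler_normB (g j) (g i).
  have := gr i; have := gr j.
  have : `|y - x - (g j - g i)| <= r / 2.
    rewrite -(ler_pM2l b0); lra.
  lra.
have ndE : ndist f x y = ndist f z (z + (y - x)).
  have E1 : z + (x - z) = x by rewrite subrKC.
  have E2 : z + (y - x) + (x - z) = y by apply/rowP => k; rewrite !mxE; ring.
  have := @ndist_shift _ _ _ _ _ _ _ gf hf z (z + (y - x)) (x - z).
  rewrite E1 E2 => -> //; apply: zT; exact: le_trans xyr rr.
have nd : c * `|y - x| <= ndist f x y.
  rewrite ndE; apply: Hc => // k kJ.
  by rewrite mxE [X in _ + X]mxE piJ// pjJ// !mxE !sJ// subrr.
rewrite -(ndistK gf Ti Tj) -exprMn.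
pose D := b * `|y - x|.
have D0 : 0 <= D by rewrite mulr_ge0 ?(ltW b0).
have bD : (c * D) ^+ 2 <= (b * ndist f x y) ^+ 2.
  rewrite lerXn2r ?nnegrE ?mulr_ge0 ?ndist_ge0 ?(ltW b0) ?(ltW c0)//.
  by rewrite /D mulrCA ler_wpM2l ?(ltW b0).
apply: le_trans bD.
(* One coordinate alone gives $D\ge Kn/2$ for an index difference $n$; bounding $n$ by $n^2$ and
   summing over the [d] coordinates gives the $\ell^1$ index distance used in [grid_lower]. *)
have nk k : K ^+ 2 / 4 * ((i k - j k) + (j k - i k))%N%:R <= D ^+ 2.
  set n := (_ + _)%N; have [n0|n0] := posnP n; first by rewrite n0 mulr0 exprn_ge0.
  have n1 : 1 <= n%:R :> R by rewrite ler1n.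
  have E : `|(g j - g i) ord0 k| = K / b * n%:R.
    rewrite !mxE -mulrBr normrM ger0_norm ?divr_ge0 ?(ltW b0) ?(ltW K0)//; congr (_ * _).
    rewrite /n; case: (leqP (i k) (j k)) => ij.
      by rewrite -natrB// ger0_norm//; move: ij; rewrite /leq => /eqP ->.
    rewrite distrC -natrB ?(ltnW ij)// ger0_norm//.
    by move: (ltnW ij); rewrite /leq => /eqP ->; rewrite addn0.
  have H1 : K * n%:R <= D + 2.
    have -> : K * n%:R = b * `|(g j - g i) ord0 k| by rewrite E; field; rewrite lt0r_neq0.
    have := ler_wpM2l (ltW b0) (mx_norm_ge (g j - g i) k).
    have := ler_wpM2l (ltW b0) (ler_distD (y - x) (g j - g i) 0).
    rewrite !subr0 mulrDr distrC -/D; lra.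
  have Kn : 4 * n%:R <= K * n%:R by rewrite ler_wpM2r.
  have H2 : K / 2 * n%:R <= D by lra.
  apply: (@le_trans _ _ ((K / 2 * n%:R) ^+ 2)); last first.
    by rewrite lerXn2r ?nnegrE// mulr_ge0// divr_ge0// ltW.
  rewrite exprMn [in leRHS]exprMn exprVn (_ : 2 ^+ 2 = 4 :> R); last by ring.
  by rewrite ler_wpM2l ?divr_ge0 ?exprn_ge0 ?(ltW K0)// expr2 ler_peMl.
have sumD : K ^+ 2 / 4 * (\sum_k ((i k - j k) + (j k - i k)))%N%:R <= d%:R * D ^+ 2.
  rewrite natr_sum mulr_sumr -[X in X%:R * _]card_ord -sum1_card natr_sum mulr_suml.
  by apply: ler_sum => k _; rewrite mul1r.
rewrite exprMn.
have : 4 * d%:R * kap * D ^+ 2 <= c ^+ 2 * K ^+ 2 * D ^+ 2 by rewrite ler_wpM2r ?exprn_ge0.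
set S := _%:R in sumD * => H2.
rewrite -(ler_pM2l (_ : 0 < K ^+ 2 / 4)); last by rewrite divr_gt0 ?exprn_gt0.
have := ler_wpM2l (ltW kap0) sumD; lra.
Qed.

End Grid.

Lemma ae_prob_le {R : realType} {disp : measure_display} {Omega : measurableType disp}
    (P : probability Omega R) (A B : set Omega) (Q : Omega -> Prop) :
  measurable A -> measurable B -> {ae P, forall w, Q w} ->
  (forall w, Q w -> A w -> B w) -> (P A <= P B)%E.
Proof.
move=> mA mB [N [mN PN0 subN]] H.
apply: (@le_trans _ _ (P (B `|` N))).
  apply: le_measure; rewrite ?inE//; first exact: measurableU.
  move=> w Aw; have [Nw|nNw] := pselect (N w); [by right|left; apply: H => //].
  by apply: contrapT => nQ; apply: nNw; apply: subN.
apply: (le_trans (measureU2 P mB mN)); rewrite -[leRHS]adde0; apply: leeD => //.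
by rewrite le_eqVlt; apply/orP; left; apply/eqP; exact: PN0.
Qed.

Lemma ae_exists {R : realType} {disp : measure_display} {Omega : measurableType disp}
    (P : probability Omega R) (Q : Omega -> Prop) : {ae P, forall w, Q w} -> exists w, Q w.
Proof.
move=> aeQ; apply: contrapT => nQ.
have : (P setT <= P set0)%E.
  by apply: (ae_prob_le _ _ aeQ) => // w Qw _; apply: nQ; exists w.
by rewrite probability_setT measure0 leNgt lte01.
Qed.

(** * Nondegeneracy in all directions from the uniqueness of the maximum *)

Section Nondegenerate.
Context {R : realType} {disp : measure_display} {Omega : measurableType disp}.
Variables (P : probability Omega R) (d : nat).
Variables (T : set 'rV[R]_d) (f : 'rV[R]_d -> {RV P >-> R}).
Hypothesis gf : centered_gaussian_field T f.
Hypothesis hf : homogeneous T f.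
Hypothesis convT : convex_set (T : set (convex_lmodType 'rV[R]_d)).
Hypothesis smooth : {ae P, forall w, twice_cont_diff_on T (fun t => f t w)}.
Variable sigma : R.
Hypothesis sigma_gt0 : 0 < sigma.
Hypothesis var_sigma : forall t, T t -> cov f t t = sigma ^+ 2.
Variables (z : 'rV[R]_d) (rho : R).
Hypothesis rho_gt0 : 0 < rho.
Hypothesis zT : forall h, `|h| <= rho -> T (z + h).

Let Tz : T z.
Proof. by have := @zT 0; rewrite addr0 normr0; apply; rewrite ltW. Qed.

Lemma measurable_exceed (S : seq 'rV[R]_d) (b : R) :
  measurable [set w | exists2 t, t \in S & b < f t w].
Proof.
apply: (proj1 (@prob_finite_union _ _ _ P _ S (fun t => [set w | b < f t w]) (fun=> 1) _)).
by move=> t tS; split; [exact: measurable_gt_field|apply: probability_le1; exact: measurable_gt_field].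
Qed.

Section Outer.
Variables (J : {set 'I_d}) (A : 'M[R]_d) (L : R).
Hypothesis L_gt0 : 0 < L.
Hypothesis pi_supp : forall (x : 'rV[R]_d) i, i \notin J -> (x *m A) ord0 i = 0.
Hypothesis pi_id : forall x : 'rV[R]_d, (forall i, i \notin J -> x ord0 i = 0) -> x *m A = x.
Hypothesis ndist_le : forall s t, T s -> T t -> ndist f s t <= L * `|(t - s) *m A|.
Hypothesis compT : compact T.

Lemma dist2_projection s t : T s -> T t -> dist2 f s t <= (L * `|s *m A - t *m A|) ^+ 2.
Proof.
move=> Ts Tt; rewrite -(ndistK gf Ts Tt) lerXn2r ?nnegrE ?ndist_ge0//.
  by rewrite mulr_ge0 ?(ltW L_gt0).
by rewrite distrC -mulmxBl ndist_le.
Qed.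

(** Chaining with the projection as [pi]: the centres of the cells are outer points, so
    [outer_count] saves a factor [b] in their number. *)
Lemma outer_prob : exists C b1 : R, [/\ 0 < C, 0 < b1 & forall (b : R) (S : seq 'rV[R]_d),
  b1 <= b -> (forall x, x \in S -> outer_point T z A x) ->
  (P [set w | exists2 t, t \in S & (b < f t w)%R] <=
   (C * b ^+ #|J| / b * gauss_tail (b / sigma))%:E)%E].
Proof.
have [C [b0 [C0 b00 HC]]] := @net_events _ _ _ P d T f gf sigma L (fun x => x *m A)
  sigma_gt0 L_gt0 var_sigma dist2_projection.
have [C' [b1 [C'0 b10 HC']]] := outer_count convT rho_gt0 zT pi_supp pi_id compT.
exists (2 * (C * C')), (b0 + b1); split; [by rewrite !mulr_gt0|by rewrite addr_gt0|].
move=> b S bb1 Sout.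
have bb0 : b0 <= b by apply: le_trans bb1; rewrite lerDl ltW.
have bb1' : b1 <= b by apply: le_trans bb1; rewrite lerDr ltW.
have b_gt0 : 0 < b by apply: lt_le_trans bb0.
have ST s : s \in S -> T s by move=> /Sout[].
have [I [E [uI IS sepI HE cover]]] := HC b S bb0 ST.
have cI := HC' b I bb1' uI (fun x xI => Sout x (IS x xI)) sepI.
pose p := gauss_tail (b / sigma); have p0 : 0 <= p by exact: gauss_tail_ge0.
have mG := measurable_exceed S b.
set G := [set w | _] in mG *.
have := @layered_integral_le _ _ _ P E (fun=> 1) (\1_G) (C * C' * b ^+ #|J| / b * p) _ _ _ _ _ _.
rewrite integral_indic// setIT => H.
rewrite (_ : 2 * (C * C') * b ^+ #|J| / b * _ = 2 * (C * C' * b ^+ #|J| / b * p)); last by rewrite !mulrA.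
apply: H => //.
- by move=> y; have [] := HE y.
- move=> y; rewrite mul1e; have [_ H] := HE y; apply: (le_trans H); rewrite lee_fin.
  have y1 : 1 <= y.+1%:R ^+ (2 * d) :> R by rewrite exprn_ege1// ler1n.
  have g0 : 0 <= 2^-1 ^+ y :> R by rewrite exprn_ge0.
  apply: (@le_trans _ _ ((size I)%:R * (C * 2^-1 ^+ y * p))).
    rewrite ler_wpM2l// ler_wpM2r// ler_pdivrMr ?(lt_le_trans ltr01)// ler_peMr//.
    by rewrite mulr_ge0 ?(ltW C0).
  have sI : (size I)%:R <= C' * b ^+ #|J| / b by rewrite ler_pdivlMr// mulrC.
  have : 0 <= C * 2^-1 ^+ y * p by rewrite !mulr_ge0 ?(ltW C0).
  move=> /ler_wpM2r/(_ _ _ sI); rewrite /p.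
  by move=> H'; apply: (le_trans H'); rewrite le_eqVlt; apply/orP; left; apply/eqP; ring.
apply: filterS (sample_paths_project gf smooth rho_gt0 zT ndist_le) => w [_ fp].
rewrite indicE; case: (boolP (w \in G)) => wG; [right|by left].
have [|y [t [Ey _ _ _]]] := cover w _ (set_mem wG).
  by move=> u v uS vS; apply: fp; exact: ST.
by exists y.
Qed.

End Outer.

Hypothesis compT : compact T.
Hypothesis umax : unique_maximum T f.

Lemma nondegenerate_all : nondegenerate f z rho [set: 'I_d]%SET.
Proof.
have [J [A [nJ pi_supp pi_id [L L0 ndist_le]]]] := degenerate_projection gf hf convT smooth rho_gt0 zT.
have [JT|JT] := eqVneq J [set: 'I_d]%SET; first by rewrite -JT.
exfalso.
have Jp : exists i, i \notin J.
  apply: contrapT => H; move/negP: JT; apply; apply/eqP/setP => i; rewrite inE; apply/negPn/negP => iJ.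
  by apply: H; exists i.
have [C [b1 [C0 b10 HC]]] := outer_prob L0 pi_supp pi_id ndist_le compT.
have [c [b2 [c0 b20 Hc]]] := grid_prob gf hf sigma_gt0 var_sigma rho_gt0 zT nJ.
pose q := C / c; have q0 : 0 < q by rewrite divr_gt0.
(* A single level suffices: the two bounds together would force [c <= C / b], while [b] exceeds
   [C / c]. *)
pose b := b1 + b2 + sigma + q + 1.
have [bb1 bb2 sb Cb] : [/\ b1 <= b, b2 <= b, sigma <= b & q < b].
  have s0 := sigma_gt0; rewrite /b; split; lra.
have b0 : 0 < b by apply: lt_le_trans sb.
have good : {ae P, forall w, (exists2 h : 'rV[R]_d -> R, continuous h & forall t, T t -> f t w = h t) /\
   exists2 t, outer_point T z A t & forall s, T s -> f s w <= f t w}.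
  apply: filterS2 (sample_paths_project gf smooth rho_gt0 zT ndist_le) umax => w [fh fp] um.
  split => //; have [t [[Tt mt] _]] := um; exists t => //.
  exact: (argmax_outer convT rho_gt0 zT pi_supp pi_id Jp fp um).
have [w0 [_ [t0 ot0 _]]] := ae_exists good.
(* [outer_prob] concerns finite sets only; the increasing unions over a countable dense set of outer
   points carry its bound to the limit. *)
have [|u [Du denseu]] := @dense_pairs R d [set x | outer_point T z A x.1 /\ x.2 = x.1].
  by exists (t0, t0).
have [|s [sT Hs]] := Hc b id bb2.
  by move=> x Tx; split=> //; rewrite subrr normr0 mulr0.
pose S n := [seq (u k).1 | k <- iota 0 n].
have So n x : x \in S n -> outer_point T z A x.
  by move=> /mapP[k _ ->]; have [] := Du k.
pose B n := [set w | exists2 t, t \in S n & b < f t w].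
have mB n : measurable (B n) by exact: measurable_exceed.
have ndB : {homo B : n m / (n <= m)%N >-> (n <= m)%O}.
  move=> n m nm; apply/subsetPset => w [t /mapP[k + ->] bt]; rewrite mem_iota add0n /= => kn.
  by exists (u k).1 => //; apply: map_f; rewrite mem_iota add0n /= (leq_trans kn).
have PB : (P (\bigcup_n B n) <= (C * b ^+ #|J| / b * gauss_tail (b / sigma))%:E)%E.
  have mUB : measurable (\bigcup_n B n) by exact: bigcup_measurable.
  have cB := @nondecreasing_cvg_mu _ _ _ P B mB mUB ndB.
  rewrite -(cvg_lim _ cB)//; apply: lime_le; first by apply/cvg_ex; eexists; exact: cB.
  by near=> n; apply: HC => //; exact: So.
(* If some grid value exceeds [b], so does the maximum, attained at an outer point; by continuity a
   nearby point of the dense sequence exceeds [b] as well. *)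
have PG : (P [set w | exists2 x, x \in s & (b < f (id x) w)%R] <= P (\bigcup_n B n))%E.
  apply: (ae_prob_le _ _ good).
  - exact: measurable_exceed.
  - exact: bigcup_measurable.
  move=> w [[h ch fh] [t ot mt]] [x xs bx].
  have Tt : T t by case: ot.
  have bt : b < f t w by apply: lt_le_trans (mt x (sT x xs)).
  have e0 : 0 < h t - b by rewrite subr_gt0 -fh.
  have [delta d0 Hd] := continuous_close t ch e0.
  have [||n [Hn _]] := denseu (t, t) delta; first by [].
    exact: d0.
  exists n.+1 => //; exists (u n).1; first by apply/mapP; exists n; rewrite ?mem_iota ?add0n /=.
  have Tn : T (u n).1 by have [[]] := Du n.
  by rewrite fh//; have := Hd _ Hn; rewrite ltr_norml => /andP[_]; lra.
have := le_trans Hs (le_trans PG PB); rewrite lee_fin.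
have p0 : 0 < gauss_tail (b / sigma).
  by apply: gauss_tail_gt0; rewrite ler_pdivlMr// mul1r.
rewrite ler_pM2r// leNgt => /negP; apply.
rewrite ltr_pdivrMr// mulrAC ltr_pM2r ?exprn_gt0//.
by rewrite mulrC -ltr_pdivrMr.
Unshelve. all: by end_near.
Qed.

End Nondegenerate.

Lemma ge0_integral_mrestr {R : realType} {disp : measure_display} {Omega : measurableType disp}
    (P : {measure set Omega -> \bar R}) (D : set Omega) (mD : measurable D) (g : Omega -> \bar R) :
  measurable_fun setT g -> (forall w, 0 <= g w)%E ->
  (\int[mrestr P mD]_w g w = \int[P]_(w in D) g w)%E.
Proof.
move=> mg g0; have mDc := measurableC mD.
transitivity (\int[mrestr P mD]_(w in setT `\` ~` D) g w)%E.
  apply: ge0_negligible_integral => //.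
  transitivity (P (~` D `&` D)); first by [].
  by rewrite setICl measure0.
rewrite setTD setCK; apply: eq_measure_integral => A mA AD.
transitivity (P (A `&` D)); first by [].
by rewrite setIidl.
Qed.

(** * The second moment as an integral under [P] *)

Section SecondMoment.
Context {R : realType} {disp : measure_display} {Omega : measurableType disp}.
Variables (P : probability Omega R) (d : nat).
Variables (f : 'rV[R]_d -> {RV P >-> R}) (b : R) (ts : seq 'rV[R]_d).
Let M := size ts.
Let N w : R := \sum_(j < M) \1_(high f b ts j) w.
Let G := exceedance f [set` ts] b.

Lemma exceedanceE (A : set 'rV[R]_d) w : exceedance f A b w <-> exists2 t, A t & b < f t w.
Proof.
split; rewrite /exceedance /=.
  by move=> /ereal_sup_gt[_ [t At <-]]; rewrite lte_fin; exists t.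
move=> [t At bt]; apply: (@lt_le_trans _ _ (f t w)%:E); first by rewrite lte_fin.
by apply: ereal_sup_ubound; exists t.
Qed.

Lemma exceedance_seq : G = [set w | exists2 t, t \in ts & b < f t w].
Proof. by apply/seteqP; split => w /exceedanceE. Qed.

Lemma high_count w : N w = (count (fun s => b - b^-1 < f s w) ts)%:R.
Proof.
rewrite -sum1_count natr_sum (big_nth 0) big_mkord [RHS]big_mkcond /=.
apply: eq_bigr => j _; rewrite indicE.
have -> : (w \in high f b ts j) = (b - b^-1 < f ts`_j w).
  by apply/idP/idP => [/set_mem//|H]; apply/mem_set.
by case: ifP.
Qed.

Lemma high_count_ge1 w : 0 < b -> G w -> 1 <= N w.
Proof.
move=> b0; rewrite exceedance_seq high_count => -[t tts bt].
rewrite ler1n -has_count; apply/hasP; exists t => //.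
by apply: lt_trans bt; rewrite gtrBl invr_gt0.
Qed.

Lemma measurable_exceedance : measurable G.
Proof. by rewrite exceedance_seq; exact: measurable_exceed. Qed.

Lemma measurable_inverse_count : measurable_fun setT (fun w => \1_G w / N w).
Proof.
apply: measurable_funM; first exact: measurable_indic measurable_exceedance.
have mN : measurable_fun setT N.
  by apply: measurable_sum => j; apply: measurable_indic; exact: measurable_high.
have -> : (fun w => (N w)^-1) = (@powR R)^~ (-1) \o N.
  by apply/funext => w /=; rewrite powR_inv1// high_count.
by apply: measurableT_comp => //; exact: measurable_powR.
Qed.

(** [Q_b] has density $N/(Mp)$ with respect to [P], and the squared estimator is $(Mp)^2/N^2$ on
    $G$, where $N\ge1$ permits the cancellation. *)
Lemma second_momentE (p : R) : 0 < b -> (0 < M)%N -> 0 < p ->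
  (forall i, (i < M)%N -> P (high f b ts i) = p%:E) ->
  (\int[Q_b f b ts]_w ((L_b f b ts w) ^+ 2)%:E =
   (M%:R * p)%:E * \int[P]_w (\1_G w / N w)%:E)%E.
Proof.
move=> b0 M0 p0 Hp.
have M0' : 0 < M%:R :> R by rewrite ltr0n.
have w0 : 0 <= (M%:R * p)^-1 by rewrite invr_ge0 mulr_ge0// ltW.
pose Qm := mscale (NngNum w0) (msum (fun i => mrestr P (measurable_high f b ts i)) M).
have QE A : measurable A -> Q_b f b ts A = Qm A.
  move=> mA; rewrite /Q_b /Qm /mscale /msum /= ge0_sume_distrr//.
  apply: eq_bigr => i _; rewrite Hp// inver (gt_eqF p0) /mrestr /=.
  rewrite muleCA muleC -EFinM -invfM; congr (_ * _)%E.
transitivity (\int[Qm]_w ((L_b f b ts w) ^+ 2)%:E)%E.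
  by apply: eq_measure_integral => A mA _; exact: QE.
have LE w : (L_b f b ts w) ^+ 2 = (M%:R * p) ^+ 2 * (\1_G w / (N w) ^+ 2).
  rewrite /L_b Hp//= -/M -/(N w) -/G exprMn exprMn exprVn indicE.
  by case: (w \in G); rewrite ?expr1n ?expr0n/= ?mulr1 ?mul1r// mulr0 mul0r mulr0.
have mh := measurable_inverse_count.
have mL : measurable_fun setT (fun w => ((L_b f b ts w) ^+ 2)%:E).
  apply/measurable_EFinP; apply: measurable_funX.
  have -> : L_b f b ts = (fun w => M%:R * p * (\1_G w / N w)).
    by apply/funext => w; rewrite /L_b Hp//= -/M -/(N w) -/G mulrAC mulrA.
  exact: measurable_funM.
have L0 w : (0 <= ((L_b f b ts w) ^+ 2)%:E)%E by rewrite lee_fin sqr_ge0.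
rewrite ge0_integral_mscale// ge0_integral_measure_sum//=.
under eq_bigr => i _ do rewrite ge0_integral_mrestr//.
transitivity ((M%:R * p)^-1%:E * \int[P]_w ((M%:R * p) ^+ 2 * (\1_G w / N w))%:E)%E.
  congr (_ * _)%E.
  under eq_bigr => i _ do rewrite integral_mkcond.
  rewrite -ge0_integral_sum//=; last 2 first.
  - move=> i; apply/(measurable_restrictT _ _).1 => //; first exact: measurable_high.
    exact: measurable_funTS.
  - by move=> i w _; rewrite erestrict_ge0.
  apply: eq_integral => w _ /=.
  transitivity (\sum_(i < M) ((L_b f b ts w) ^+ 2 * \1_(high f b ts i) w)%:E)%E.
    apply: eq_bigr => i _; rewrite patchE indicE.
    by case: (w \in high f b ts i); rewrite ?mulr1 ?mulr0.
  rewrite sumEFin -mulr_sumr -/(N w) LE; congr (_%:E).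
  rewrite -mulrA; congr (_ * _); rewrite indicE.
  have [wG|wG] := boolP (w \in G); last by rewrite !mul0r.
  rewrite !mul1r expr2 invfM -mulrA mulVf ?mulr1// lt0r_neq0//.
  by apply: (lt_le_trans ltr01); apply: high_count_ge1 b0 (set_mem wG).
under eq_integral do rewrite EFinM.
rewrite ge0_integralZl//; last 3 first.
- exact/measurable_EFinP.
- move=> w _; rewrite lee_fin divr_ge0// high_count; exact: ler0n.
- by rewrite lee_fin sqr_ge0.
by rewrite muleA -EFinM expr2 mulKf// lt0r_neq0// mulr_gt0.
Qed.

End SecondMoment.

(** * Counting points of a regular discretization *)

Section Discretization.
Context {R : realType} {d : nat}.
Implicit Types (x t : 'rV[R]_d) (T : set 'rV[R]_d) (ts : seq 'rV[R]_d).

Lemma norm_le_norm1 x : `|x| <= norm1 x.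
Proof.
apply: mx_norm_le => [|i]; first by rewrite sumr_ge0.
by rewrite /norm1 (bigD1 i)//= lerDl sumr_ge0.
Qed.

Lemma norm1_le x : norm1 x <= d%:R * `|x|.
Proof.
rewrite /norm1 -[X in X%:R * _]card_ord -sum1_card natr_sum mulr_suml.
by apply: ler_sum => i _; rewrite mul1r mx_norm_ge.
Qed.

Lemma norm1C x t : norm1 (x - t) = norm1 (t - x).
Proof. by apply: eq_bigr => i _; rewrite !mxE distrC. Qed.

Lemma norm1D x t : norm1 (x + t) <= norm1 x + norm1 t.
Proof. by rewrite /norm1 -big_split; apply: ler_sum => i _; rewrite /= mxE ler_normD. Qed.

Lemma discretization_size T ts (theta D : R) : (0 < d)%N -> 0 <= D ->
  (forall t, T t -> `|t| <= D) -> 0 < theta <= 1 -> regular_discretization T theta ts ->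
  (size ts)%:R <= ((2 * D * d%:R + 2) / theta) ^+ d.
Proof.
move=> d0 D0 TD /andP[th0 th1] [tsT sep _].
have d0' : 0 < d%:R :> R by rewrite ltr0n.
have sep' i j : (i < size ts)%N -> (j < size ts)%N -> i != j -> theta / d%:R <= `|ts`_i - ts`_j|.
  move=> im jm ij; rewrite ler_pdivrMr// mulrC; apply: le_trans (norm1_le _); exact: sep.
have q0 : 0 < theta / d%:R by rewrite divr_gt0.
have uts : uniq ts.
  apply/(uniqP 0) => i j im jm E; apply/eqP/negPn/negP => ij.
  by have := sep' i j im jm ij; rewrite E subrr normr0 leNgt q0.
have := @packing_bound _ d [set: 'I_d]%SET ts D _ q0 D0 uts.
rewrite cardsT card_ord => H; apply: (le_trans (H _ _ _)).
- by move=> x _ i; rewrite inE.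
- by move=> x /tsT/TD.
- move=> x y xts yts xy.
  rewrite -(nth_index 0 xts) -(nth_index 0 yts); apply: sep'; rewrite ?index_mem//.
  by apply: contraNneq xy => E; rewrite -(nth_index 0 xts) E nth_index.
have Dd : 0 <= 2 * D * d%:R by rewrite !mulr_ge0.
rewrite lerXn2r ?nnegrE ?divr_ge0 ?addr_ge0 ?divr_ge0 ?mulr_ge0 ?(ltW th0)//.
have -> : 2 * D / (theta / d%:R) = 2 * D * d%:R / theta by field; rewrite !lt0r_neq0.
by rewrite [leRHS]mulrDl lerD2l ler_pdivlMr// ler_piMr.
Qed.

(** Boxes of half-width $2\theta$ around the discretization points within $\delta+2\theta$ of [t]
    cover the ball inside [T], so their total volume bounds its outer measure. *)
Lemma covering_count T ts (t : 'rV[R]_d) (kappa0 delta theta : R) : (0 < d)%N -> 0 < theta ->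
  ((kappa0 * delta ^+ d)%:E <= lebesgue_rV (ball1 t delta `&` T))%E ->
  (forall t, T t -> exists2 s, s \in ts & norm1 (s - t) <= 2 * theta) ->
  kappa0 * delta ^+ d <= (4 * theta) ^+ d * (count (fun s => norm1 (t - s) <= delta + 2 * theta) ts)%:R.
Proof.
move=> d0 th0 Hk cov_ts.
set a := (fun s => _); pose F := [seq s <- ts | a s].
have sF : size F = count a ts by rewrite size_filter.
(* The finite cover is padded with the degenerate box at the origin, of volume $0^d=0$ since
   $d>0$. *)
pose lo k : 'rV[R]_d := if (k < size F)%N then F`_k - const_mx (2 * theta) else 0.
pose hi k : 'rV[R]_d := if (k < size F)%N then F`_k + const_mx (2 * theta) else 0.
have vol k : box_volume (lo k) (hi k) = if (k < size F)%N then (4 * theta) ^+ d else 0.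
  rewrite /box_volume /lo /hi; case: ifP => _; last first.
    rewrite (eq_bigr (fun=> 0)) => [|i _]; last by rewrite !mxE subrr.
    by rewrite prodr_const card_ord expr0n gtn_eqF.
  rewrite (eq_bigr (fun=> 4 * theta)) => [|i _]; first by rewrite prodr_const card_ord.
  by rewrite !mxE; ring.
rewrite -lee_fin; apply: (le_trans Hk).
apply: (@le_trans _ _ (\sum_(k <oo) (box_volume (lo k) (hi k))%:E)%E).
  apply: ereal_inf_lbound; exists (lo, hi) => //; split.
    move=> k i; rewrite /= /lo /hi; case: ifP => _; rewrite !mxE//.
    lra.
  move=> x [bx Tx]; have [s sts sx] := cov_ts x Tx.
  have sF' : s \in F.
    rewrite mem_filter sts andbT /a; have := norm1D (t - x) (x - s).
    rewrite subrKA (norm1C x s) => H; apply: (le_trans H); exact: lerD.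
  exists (index s F) => //= i; rewrite /lo /hi index_mem sF' nth_index// !mxE.
  have := le_trans (mx_norm_ge (s - x) i) (le_trans (norm_le_norm1 _) sx).
  rewrite !mxE ler_norml => /andP[? ?]; lra.
rewrite (nneseries_split _ (size F)); last first.
  by move=> k _; rewrite lee_fin vol; case: ifP => // _; rewrite exprn_ge0// mulr_ge0// ltW.
rewrite add0n eseries0 ?adde0; last first.
  by move=> k /= sk _; rewrite vol ltnNge sk.
rewrite sumEFin lee_fin big_mkord (eq_bigr (fun=> (4 * theta) ^+ d)) => [|k _]; last first.
  by rewrite vol ltn_ord.
by rewrite sumr_const card_ord sF mulr_natr.
Qed.

End Discretization.

(** * Lower bound for the maximum and upper bound for the inverse count *)

Section Bounds.
Context {R : realType} {disp : measure_display} {Omega : measurableType disp}.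
Variables (P : probability Omega R) (d : nat).
Variables (T : set 'rV[R]_d) (f : 'rV[R]_d -> {RV P >-> R}).
Hypothesis d_gt0 : (0 < d)%N.
Hypothesis compT : compact T.
Hypothesis gf : centered_gaussian_field T f.
Hypothesis hf : homogeneous T f.
Hypothesis convT : convex_set (T : set (convex_lmodType 'rV[R]_d)).
Hypothesis smooth : {ae P, forall w, twice_cont_diff_on T (fun t => f t w)}.
Hypothesis umax : unique_maximum T f.
Variable sigma : R.
Hypothesis sigma_gt0 : 0 < sigma.
Hypothesis var_sigma : forall t, T t -> cov f t t = sigma ^+ 2.
Variables (z : 'rV[R]_d) (rho : R).
Hypothesis rho_gt0 : 0 < rho.
Hypothesis zT : forall h, `|h| <= rho -> T (z + h).

Lemma field_tail t B : T t -> P [set w | (B < f t w)%R] = (gauss_tail (B / sigma))%:E.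
Proof.
move=> Tt; have s2 : 0 < sigma ^+ 2 by rewrite exprn_gt0.
have vE : var3 f t t t 1 0 0 = sigma ^+ 2 by rewrite /var3 var_sigma//; ring.
rewrite (_ : [set w | _] = [set w | B < lc3 f t t t 1 0 0 w]); last first.
  by apply/seteqP; split => w /=; rewrite /lc3 !mul0r !addr0 mul1r.
by rewrite (lc3_tail gf) ?vE// sqrtr_sqr gtr0_norm.
Qed.

Lemma max_lower : exists c b1 : R, [/\ 0 < c, 0 < b1 & forall (b : R) (ts : seq 'rV[R]_d), b1 <= b ->
  (forall t, t \in ts -> T t) ->
  (forall t, T t -> exists2 s, s \in ts & b * `|s - t| <= 1) ->
  ((c * b ^+ d * gauss_tail (b / sigma))%:E <=
   P [set w | exists2 t, t \in ts & (b < f t w)%R])%E].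
Proof.
have nd := nondegenerate_all gf hf convT smooth sigma_gt0 var_sigma rho_gt0 zT compT umax.
have [c [b1 [c0 b10 H]]] := grid_prob gf hf sigma_gt0 var_sigma rho_gt0 zT nd.
rewrite cardsT card_ord in H.
exists c, b1; split => // b ts bb1 tsT cov_ts.
have /choice[p Hp] : forall x, exists s, T x -> s \in ts /\ b * `|s - x| <= 1.
  move=> x; have [Tx|nTx] := pselect (T x); last by exists x.
  by have [s sts sx] := cov_ts x Tx; exists s.
have [|s [sT Hs]] := H b p bb1.
  move=> x Tx; have [pts px] := Hp x Tx; split => //; first exact: tsT.
  by move=> i; rewrite inE.
apply: (le_trans Hs); apply: le_measure; rewrite ?inE.
- rewrite (_ : [set w | _] = [set w | exists2 t, t \in [seq p x | x <- s] & b < f t w]).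
    exact: measurable_exceed.
  apply/seteqP; split => w [x xs bx]; first by exists (p x) => //; exact: map_f.
  by case/mapP: xs bx => y ys -> ?; exists y.
- exact: measurable_exceed.
by move=> w [x xs bx]; exists (p x) => //; have [] := Hp x (sT x xs).
Qed.

Variable kappa0 : R.
Hypothesis kappa0_gt0 : 0 < kappa0.
Hypothesis kappa0_le : forall t (e : R), T t -> 0 < e < 1 ->
  ((kappa0 * e ^+ d)%:E <= lebesgue_rV (ball1 t e `&` T))%E.

(** The least power of 2 above $5(y+1)$ is at most $10(y+1)$. At this level [m] the oscillation
    bound $5(y+1)2^{-m}/b$ is below $1/b$. *)
Lemma dyadic_scale (y : nat) : exists m, 5 * y.+1%:R < 2 ^+ m :> R /\
  4 ^+ m <= 100 * y.+1%:R ^+ 2 :> R.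
Proof.
have /andP[H1 H2] := @trunc_log_bounds 2 (5 * y.+1) isT isT.
exists (trunc_log 2 (5 * y.+1)).+1; set m := trunc_log _ _ in H1 H2 *.
split; first by rewrite -natrM -natrX ltr_nat.
have H3 : 2 ^+ m.+1 <= 10 * y.+1%:R :> R.
  rewrite exprS; move: H1; rewrite -(ler_nat R) natrX natrM => H1.
  by move: H1 => /(ler_wpM2l (ler0n R 2)) H1; apply: (le_trans H1); lra.
have -> : 4 = 2 ^+ 2 :> R by ring.
rewrite -exprM mulnC exprM.
have -> : 100 * y.+1%:R ^+ 2 = (10 * y.+1%:R) ^+ 2 :> R by ring.
by rewrite lerXn2r ?nnegrE// mulr_ge0.
Qed.

(* Near an exceedance t the oscillation is below 1/b at distance 1/(b (y+1)^2),
   and condition (B2) bounds below the number of discretization points there. *)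
Lemma inverse_count_le : exists2 K : R, 0 < K &
  forall (b e : R) (ts : seq 'rV[R]_d) t w y, 1 <= b -> 0 < e ->
  regular_discretization T (e / b) ts -> T t -> t \in ts -> b < f t w ->
  (forall s m, s \in ts -> b * `|s - t| <= 4^-1 ^+ m ->
    `|f s w - f t w| <= 5 * y.+1%:R * 2^-1 ^+ m / b) ->
  ((count (fun s => b - b^-1 < f s w) ts)%:R)^-1 <=
  (kappa0^-1 + 1) * (K * e * y.+1%:R ^+ 2) ^+ d.
Proof.
(* $800=8\cdot100$: the 8 is the ratio of the box side $4e/b$ to the radius $q/(2b)$ in units of
   $e/q$, the 100 comes from [dyadic_scale]. *)
have [K K0 K800] : exists2 K : R, 0 < K & 800 <= K by exists 800; rewrite ?ltr0n.
exists K => // b e ts t w y b1 e0 [tsT _ cov_ts] Tt tts bt Hosc.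
have b0 : 0 < b by apply: lt_le_trans b1.
have [m [m1 m2]] := dyadic_scale y.
set N := count _ _.
have N1 : 1 <= N%:R :> R.
  by rewrite ler1n -has_count; apply/hasP; exists t => //; apply: lt_trans bt; rewrite gtrBl invr_gt0.
have N0 : 0 < N%:R :> R by apply: lt_le_trans N1.
pose q : R := 4^-1 ^+ m.
have q0 : 0 < q by rewrite exprn_gt0// invr_gt0.
have q1 : q <= 1 by rewrite exprn_ile1// ?invr_ge0// invf_le1//; lra.
have qV : q^-1 = 4 ^+ m by rewrite /q exprVn invrK.
have Y0 : 0 <= y.+1%:R ^+ 2 :> R by rewrite exprn_ge0.
have eq_le : e / q <= 100 * e * y.+1%:R ^+ 2.
  have -> : 100 * e * y.+1%:R ^+ 2 = e * (100 * y.+1%:R ^+ 2) by ring.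
  by rewrite qV ler_wpM2l ?(ltW e0).
have V0 : 0 <= K * e * y.+1%:R ^+ 2.
  by rewrite !mulr_ge0 ?(ltW K0) ?(ltW e0).
have KeY : 800 * (e * y.+1%:R ^+ 2) <= K * e * y.+1%:R ^+ 2.
  by rewrite -mulrA ler_wpM2r// mulr_ge0// ltW.
have W0 : 0 <= (K * e * y.+1%:R ^+ 2) ^+ d by exact: exprn_ge0.
have k0 : 0 < kappa0^-1 by rewrite invr_gt0.
have high s : s \in ts -> norm1 (t - s) <= q / b -> b - b^-1 < f s w.
  move=> sts; rewrite norm1C => st.
  have := Hosc s m sts; rewrite mulrC -ler_pdivlMr// => /(_ (le_trans (norm_le_norm1 _) st)).
  have : 5 * y.+1%:R * 2^-1 ^+ m / b <= b^-1.
    rewrite -[leRHS]mul1r ler_wpM2r ?invr_ge0 ?(ltW b0)// exprVn ler_pdivrMr ?exprn_gt0// mul1r.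
    exact: ltW.
  move=> H1 H2; have := le_trans H2 H1; rewrite ler_norml => /andP[H3 _]; lra.
(* If [q < 4 * e], the discretization is too coarse for the small ball, but then the right-hand side
   is at least 1 and the trivial bound on the inverse count suffices. Otherwise $q/2+2e\le q$, so
   all counted points stay where the oscillation is controlled. *)
have [eq|eq] := leP (4 * e) q; last first.
  apply: (@le_trans _ _ 1); first by rewrite invf_le1.
  apply: (@le_trans _ _ ((K * e * y.+1%:R ^+ 2) ^+ d)); last by rewrite ler_peMl//; lra.
  rewrite exprn_ege1//.
  have : 1 <= 4 * (e / q) by rewrite mulrA ler_pdivlMr// mul1r ltW.
  have eY : 0 <= e * y.+1%:R ^+ 2 by rewrite mulr_ge0// ltW.
  lra.
have th0 : 0 < e / b by rewrite divr_gt0.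
have d01 : 0 < q / (2 * b) < 1.
  by rewrite divr_gt0 ?mulr_gt0//= ltr_pdivrMr ?mulr_gt0// mul1r; lra.
have := @covering_count R d T ts t kappa0 (q / (2 * b)) (e / b) d_gt0 th0 (kappa0_le Tt d01) cov_ts.
set N' := count _ _ => HN.
have NN : N'%:R <= N%:R :> R.
  rewrite ler_nat /N' (@eq_in_count _ _ (predI (fun s => norm1 (t - s) <= q / (2 * b) + 2 * (e / b))
    (fun s => b - b^-1 < f s w))); first by apply: sub_count => s /andP[].
  move=> s sts /=; symmetry; apply: andb_idr => H; apply: high => //; apply: (le_trans H).
  have -> : q / (2 * b) + 2 * (e / b) = (q / 2 + 2 * e) / b by field; rewrite lt0r_neq0.
  by rewrite ler_wpM2r ?invr_ge0 ?(ltW b0)//; lra.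
have H1 : kappa0 * (q / (2 * b)) ^+ d <= (4 * (e / b)) ^+ d * N%:R.
  by apply: (le_trans HN); rewrite ler_wpM2l// exprn_ge0// mulr_ge0// ltW.
apply: (@le_trans _ _ (kappa0^-1 * (8 * (e / q)) ^+ d)).
  rewrite -[leLHS]mul1r ler_pdivrMr//.
  have -> : 8 * (e / q) = 4 * (e / b) * (q / (2 * b))^-1.
    by field; rewrite !lt0r_neq0.
  have D0 : 0 < (q / (2 * b)) ^+ d by rewrite exprn_gt0// divr_gt0// mulr_gt0.
  rewrite exprMn exprVn.
  have -> : kappa0^-1 * ((4 * (e / b)) ^+ d / (q / (2 * b)) ^+ d) * N%:R =
      (4 * (e / b)) ^+ d * N%:R / (kappa0 * (q / (2 * b)) ^+ d).
    move: ((4 * (e / b)) ^+ d) ((q / (2 * b)) ^+ d) (N%:R : R) => x1 x2 x3.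
    by rewrite invfM; ring.
  by rewrite ler_pdivlMr ?mulr_gt0// mul1r.
apply: (@le_trans _ _ (kappa0^-1 * (K * e * y.+1%:R ^+ 2) ^+ d)).
  rewrite ler_wpM2l ?(ltW k0)// lerXn2r ?nnegrE//.
    by rewrite mulr_ge0// divr_ge0 ?(ltW e0) ?(ltW q0).
  by lra.
by rewrite ler_wpM2r// lerDl.
Qed.

(** Chaining with the identity as [pi]: the net has at most $C b^d$ points, and the growth
    $(y+1)^{2d}$ of the bound on the inverse count is cancelled exactly by the decay in
    [net_events], which leaves $2^{-y}$. *)
Lemma inverse_count_integral : exists C b1 : R, [/\ 0 < C, 0 < b1 &
  forall (b e : R) (ts : seq 'rV[R]_d), b1 <= b -> 0 < e -> regular_discretization T (e / b) ts ->
  (\int[P]_w (\1_(exceedance f [set` ts] b) w /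
     (\sum_(j < size ts) \1_(high f b ts j) w))%:E <=
   (C * e ^+ d * b ^+ d * gauss_tail (b / sigma))%:E)%E].
Proof.
have [L L0 HL] := ndist_Lipschitz gf hf convT smooth rho_gt0 zT.
have d2 s t : T s -> T t -> dist2 f s t <= (L * `|s - t|) ^+ 2.
  move=> Ts Tt; rewrite -(ndistK gf Ts Tt) lerXn2r ?nnegrE ?ndist_ge0//.
    by rewrite mulr_ge0 ?(ltW L0).
  by rewrite distrC HL.
have [C [b0 [C0 b00 HC]]] := @net_events _ _ _ P d T f gf sigma L (fun x => x)
  sigma_gt0 L0 var_sigma d2.
have [K K0 HK] := inverse_count_le.
have [D0 [_ HD0]] := compact_bounded compT.
pose D := `|D0| + 1.
have HD t : T t -> `|t| <= D.
  by apply: HD0; rewrite /D (le_lt_trans (ler_norm _))// ltrDl.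
have D1 : 0 < D by rewrite ltr_wpDl.
have k0 : 0 < kappa0^-1 by rewrite invr_gt0.
pose C' := 2 * ((kappa0^-1 + 1) * K ^+ d * (2 * D + 2) ^+ d * C).
have C'0 : 0 < C'.
  have A0 : 0 < kappa0^-1 + 1 by rewrite addr_gt0.
  have B0 : 0 < K ^+ d by exact: exprn_gt0.
  have E0 : 0 < (2 * D + 2) ^+ d by rewrite exprn_gt0// addr_gt0// mulr_gt0.
  exact: mulr_gt0 (ltr0Sn R 1) (mulr_gt0 (mulr_gt0 (mulr_gt0 A0 B0) E0) C0).
exists C', (b0 + 1); split; [by []|by rewrite addr_gt0|].
move=> b e ts bb0 e0 reg; have [tsT _ _] := reg.
have b1 : 1 <= b by apply: le_trans bb0; rewrite lerDr ltW.
have b0' : 0 < b by apply: lt_le_trans b1.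
have bb : b0 <= b by apply: le_trans bb0; rewrite lerDl.
have [I [E [uI IS sepI HE cover]]] := HC b ts bb tsT.
set p := gauss_tail (b / sigma); have p0 : 0 <= p by exact: gauss_tail_ge0.
have sI : (size I)%:R <= ((2 * D + 2) * b) ^+ d.
  have := @packing_bound _ d [set: 'I_d]%SET I D (1 / b) _ (ltW D1) uI.
  rewrite cardsT card_ord => H; apply: (le_trans (H _ _ _ _)).
  - by rewrite divr_gt0.
  - by move=> x _ i; rewrite inE.
  - by move=> x /IS/tsT/HD.
  - by move=> x y xI yI xy; rewrite ler_pdivrMr// mulrC ltW// sepI.
  rewrite lerXn2r ?nnegrE ?addr_ge0 ?divr_ge0 ?mulr_ge0 ?addr_ge0 ?mulr_ge0 ?(ltW D1) ?(ltW b0')//.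
  rewrite div1r invrK [leRHS]mulrDl lerD2l; lra.
pose a y := (kappa0^-1 + 1) * (K * e * y.+1%:R ^+ 2) ^+ d.
have a0 y : 0 <= a y.
  apply: mulr_ge0; first by rewrite addr_ge0 ?(ltW k0).
  apply: exprn_ge0; apply: mulr_ge0; last exact: exprn_ge0.
  by rewrite mulr_ge0 ?(ltW K0) ?(ltW e0).
pose c := (kappa0^-1 + 1) * K ^+ d * (2 * D + 2) ^+ d * C * e ^+ d * b ^+ d * p.
rewrite (_ : C' * e ^+ d * b ^+ d * p = 2 * c); last by rewrite /c /C'; ring.
apply: (@layered_integral_le _ _ _ P E a _ c) => //.
- exact: measurable_inverse_count.
- by move=> w; rewrite divr_ge0// high_count ler0n.
- by move=> y; have [] := HE y.
- move=> y; have [_ H] := HE y.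
  apply: (le_trans (lee_wpmul2l _ H)); rewrite ?lee_fin//.
  have Y0 : 0 < y.+1%:R :> R by rewrite ltr0n.
  have t0 : 0 <= C * 2^-1 ^+ y / y.+1%:R ^+ (2 * d) * p.
    by rewrite !mulr_ge0 ?invr_ge0 ?exprn_ge0 ?(ltW C0) ?invr_ge0.
  apply: (@le_trans _ _ (a y * (((2 * D + 2) * b) ^+ d * (C * 2^-1 ^+ y / y.+1%:R ^+ (2 * d) * p)))).
    by rewrite ler_wpM2l// ler_wpM2r.
  rewrite le_eqVlt; apply/orP; left; apply/eqP.
  have Z0 : (y.+1%:R ^+ 2) ^+ d != 0 :> R by rewrite !expf_neq0 ?lt0r_neq0.
  rewrite /a /c (exprMn d (K * e)) (exprMn d K) (exprMn d (2 * D + 2)) exprM.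
  move: (_ ^+ d) (kappa0^-1 + 1) Z0 => Z k Z0; field.
  by rewrite Z0.
have id_good w : forall u v, u \in ts -> v \in ts -> u = v -> f u w = f v w.
  by move=> u v _ _ ->.
apply: aeW => w.
rewrite indicE; have [wG|wG] := boolP (w \in _); last by left; rewrite mul0r.
right; move: wG => /set_mem; rewrite exceedance_seq => wG.
have [y [t [Ey tts bt osc]]] := cover w (id_good w) wG.
exists y => //; rewrite mul1r high_count.
exact: (HK _ _ _ _ _ _ b1 e0 reg (tsT t tts) tts bt osc).
Qed.

End Bounds.
Theorem theorem7p5 (R : realType) (disp : measure_display)
    (Omega : measurableType disp) (P : probability Omega R)
    (d : nat) (T : set 'rV[R]_d) (f : 'rV[R]_d -> {RV P >-> R}) :
  (0 < d)%N ->
  compact T ->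
  centered_gaussian_field T f ->
  (forall t, T t -> (0 < 'V_P[f t])%E) ->
  condition_B1 T f ->
  condition_B2 T ->
  unique_maximum T f ->
  exists c b0 e0 : R,
    [/\ 0 < c, 0 < b0, 0 < e0 &
      forall ts : R -> R -> seq 'rV[R]_d,
        (forall b e, b0 < b -> 0 < e <= e0 ->
           regular_discretization T (e / b) (ts b e)) ->
        let pars := [set be : R * R | b0 < be.1 /\ 0 < be.2 <= e0] in
        let supT := ereal_sup
          [set second_moment_ratio f be.1 (ts be.1 be.2) T | be in pars] in
        let supTs := ereal_sup
          [set second_moment_ratio f be.1 (ts be.1 be.2) [set` ts be.1 be.2]
            | be in pars] in
        (supT <= supTs)%E /\ (supTs <= c%:E)%E].
Proof.
move=> d_gt0 compT gf var_gt0 [hf smooth] [T0 convT [z zint] _ [kappa0 k0 Hk]] umax.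
have [rho rho0 zT] : exists2 rho : R, 0 < rho & forall h, `|h| <= rho -> T (z + h).
  have /nbhs_normP[r /= r0 Hr] := zint.
  exists (r / 2); first by rewrite divr_gt0.
  move=> h hr; apply: Hr => /=; rewrite opprD addNKr normrN.
  by apply: (le_lt_trans hr); rewrite ltr_pdivrMr// mulr_natr mulr2n ltrDl.
(* Homogeneity makes the variance constant on [T], so its value at the origin, which belongs to [T],
   serves everywhere. *)
pose sigma := Num.sqrt (cov f 0 0).
have c0 : 0 < cov f 0 0 by apply: (cov_gt0 gf T0); exact: var_gt0.
have s0 : 0 < sigma by rewrite sqrtr_gt0.
have vs t : T t -> cov f t t = sigma ^+ 2.
  move=> Tt; rewrite sqr_sqrtr ?(ltW c0)//.
  by rewrite -(cov_shift gf hf (s := 0) (t := 0) (h := t)) ?add0r.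
have [D0 [_ HD0]] := compact_bounded compT.
pose D := `|D0| + 1.
have HD t : T t -> `|t| <= D.
  by apply: HD0; rewrite /D (le_lt_trans (ler_norm _))// ltrDl.
have D1 : 0 <= D by rewrite addr_ge0.
have [c1 [b1 [c10 b10 H1]]] := max_lower compT gf hf convT smooth umax s0 vs rho0 zT.
have [C2 [b2 [C20 b20 H2]]] := inverse_count_integral d_gt0 compT gf hf convT smooth s0 vs rho0 zT k0 Hk.
have [C3 [b3 [C30 b30 H3]]] := base_tail gf s0 vs ler01.
pose CM := (2 * D * d%:R + 2) ^+ d.
have CM0 : 0 < CM.
  by rewrite exprn_gt0// ltr_wpDl// mulr_ge0// mulr_ge0.
(* The product of the bounds on $M$, $p$ and the inverse count integral is $CM\,C_3C_2(b^d\Psi)^2$: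
   the powers $e^{-d}$ and $e^d$ cancel, so the constant is uniform in [e]. The denominator is at
   least $(c_1b^d\Psi)^2$. *)
pose c := CM * C3 * C2 / c1 ^+ 2.
have cp : 0 < c by rewrite divr_gt0 ?exprn_gt0// !mulr_gt0.
have [B0 B00 HB0] : exists2 B0 : R, 0 < B0 & forall b, B0 < b ->
    [/\ b1 <= b, b2 <= b, b3 <= b & sigma <= b /\ 1 <= b].
  exists (b1 + b2 + b3 + sigma + 1); first by rewrite !addr_gt0.
  by move=> b bb; clear -b10 b20 b30 s0 bb; split; [lra|lra|lra|split; lra].
have half0 : 0 < 2^-1 :> R by rewrite invr_gt0.
(* For [e] at most $1/2$ the covering radius $2e/b$ is at most $1/b$, as [max_lower] requires. *)
exists c, B0, 2^-1; split; [exact: cp|exact: B00|exact: half0|].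
move=> ts reg pars supT supTs.
(* Both ratios are reduced to real fractions with the same numerator; [g <= gT] then yields the
   first inequality pointwise, before any supremum is taken. *)
have key b e : (b, e) \in pars -> exists (I g gT : R), [/\ 0 <= I, 0 < g <= gT,
    second_moment_ratio f b (ts b e) T = (I / gT ^+ 2)%:E,
    second_moment_ratio f b (ts b e) [set` ts b e] = (I / g ^+ 2)%:E &
    I / g ^+ 2 <= c].
  rewrite inE /pars /= => -[bb /andP[e0 e2]].
  have [bb1 bb2 bb3 [sb b_ge1]] := HB0 b bb.
  have b0 : 0 < b by apply: lt_le_trans b_ge1.
  have th0 : 0 < e / b by rewrite divr_gt0.
  have th1 : e / b <= 1 by rewrite ler_pdivrMr// mul1r; lra.
  have rg := reg b e bb (introT andP (conj e0 e2)).
  have [tsT _ cov_ts] := rg.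
  set t_ := ts b e in rg tsT cov_ts *.
  pose psi := gauss_tail (b / sigma).
  have psi0 : 0 < psi by apply: gauss_tail_gt0; rewrite ler_pdivlMr// mul1r.
  pose p := gauss_tail ((b - b^-1) / sigma).
  have Hp i : (i < size t_)%N -> P (high f b t_ i) = p%:E.
    by move=> im; apply: (field_tail gf s0 vs); apply: tsT; exact: mem_nth.
  have M0 : (0 < size t_)%N.
    by have [s + _] := cov_ts 0 T0; case: (t_).
  have T1 : T t_`_0 by apply: tsT; exact: mem_nth.
  have p_le : p <= C3 * psi.
    by rewrite -lee_fin -(Hp 0%N M0) /high; have := H3 b t_`_0 bb3 T1; rewrite div1r.
  have p_ge : psi <= p.
    rewrite -lee_fin -(Hp 0%N M0) /psi -(field_tail gf s0 vs b T1); apply: le_measure; rewrite ?inE.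
    + exact: measurable_gt_field.
    + exact: measurable_high.
    + by move=> w /= bw; rewrite /high /=; apply: lt_trans bw; rewrite gtrBl invr_gt0.
  have p0 : 0 < p by apply: lt_le_trans p_ge.
  pose G := exceedance f [set` t_] b.
  have mG : measurable G by exact: measurable_exceedance.
  have PG : (P^*)%mu G = P G by exact: measurable_mu_extE.
  have Pfin : P G \is a fin_num by exact: fin_num_measure.
  have le1 : (P G <= (P^*)%mu (exceedance f T b))%E.
    rewrite -PG; apply: le_mu_ext => w /exceedanceE[t tts bt]; apply/exceedanceE; exists t => //.
    exact: tsT.
  have le2 : ((P^*)%mu (exceedance f T b) <= 1)%E.
    rewrite -(@probability_setT _ _ _ P) -(measurable_mu_extE P measurableT).
    exact: le_mu_ext.
  have Tfin : (P^*)%mu (exceedance f T b) \is a fin_num.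
    by rewrite fin_numE gt_eqF ?lt_eqF//; [apply: le_lt_trans le2 _; rewrite ltry|
      apply: lt_le_trans le1; rewrite (lt_le_trans _ (measure_ge0 _ _))].
  have g_ge : ((c1 * b ^+ d * psi)%:E <= P G)%E.
    rewrite /G exceedance_seq; apply: H1 => // t Tt.
    have [s sts st] := cov_ts t Tt; exists s => //.
    apply: (le_trans (ler_wpM2l (ltW b0) (le_trans (norm_le_norm1 _) st))).
    by rewrite mulrCA [b * _]mulrC divfK ?lt0r_neq0//; clear -e2; lra.
  have cb0 : 0 < c1 * b ^+ d * psi by rewrite !mulr_gt0 ?exprn_gt0.
  have psi_ge0 := ltW psi0.
  pose J := (\int[Q_b f b t_]_w ((L_b f b t_ w) ^+ 2)%:E)%E.
  have J0 : (0 <= J)%E by apply: integral_ge0 => w _; rewrite lee_fin sqr_ge0.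
  pose B := CM * C3 * C2 * (b ^+ d * psi) ^+ 2.
  have JB : (J <= B%:E)%E.
    rewrite /J (second_momentE b0 M0 p0 Hp).
    have Mp0 : 0 <= (size t_)%:R * p by rewrite mulr_ge0// ltW.
    apply: (le_trans (lee_wpmul2l _ (H2 b e t_ bb2 e0 rg))); first by rewrite lee_fin.
    rewrite -EFinM lee_fin -/psi.
    have th01 : 0 < e / b <= 1 by rewrite th0.
    have sz := discretization_size d_gt0 D1 HD th01 rg.
    have X0 : 0 <= C2 * e ^+ d * b ^+ d * psi by rewrite !mulr_ge0 ?exprn_ge0 ?(ltW C20) ?(ltW e0) ?(ltW b0).
    have sp : (size t_)%:R * p <= ((2 * D * d%:R + 2) / (e / b)) ^+ d * (C3 * psi).
      by apply: ler_pM => //; exact: ltW.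
    apply: (le_trans (ler_wpM2r X0 sp)); rewrite /B /CM le_eqVlt; apply/orP; left; apply/eqP.
    rewrite (exprMn d (2 * D * d%:R + 2)) exprVn (exprMn d e) exprVn.
    have e00 : e ^+ d != 0 by rewrite expf_neq0 ?lt0r_neq0.
    have b00 : b ^+ d != 0 by rewrite expf_neq0 ?lt0r_neq0.
    move: ((_ + 2) ^+ d) (e ^+ d) (b ^+ d) e00 b00 => k e' b' e00 b00; field.
    by rewrite e00 b00.
  have Jfin : J \is a fin_num by rewrite ge0_fin_numE// (le_lt_trans JB)// ltry.
  have g0 : 0 < fine (P G) by rewrite -lte_fin fineK// (lt_le_trans _ g_ge)// lte_fin.
  have gT : fine (P G) <= fine ((P^*)%mu (exceedance f T b)) by apply: fine_le.
  have gT0 : 0 < fine ((P^*)%mu (exceedance f T b)) by apply: lt_le_trans gT.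
  have ratioE A g : 0 < g -> (P^*)%mu (exceedance f A b) = g%:E ->
      second_moment_ratio f b t_ A = (fine J / g ^+ 2)%:E.
    move=> g_gt0 E; rewrite /second_moment_ratio /prob_exceedance E -EFin_expe inver.
    by rewrite expf_eq0/= gt_eqF// EFinM fineK.
  exists (fine J), (fine (P G)), (fine ((P^*)%mu (exceedance f T b))); split.
  - exact: fine_ge0.
  - by rewrite g0.
  - by apply: ratioE => //; rewrite fineK.
  - by apply: ratioE => //; rewrite fineK// PG.
  rewrite ler_pdivrMr ?exprn_gt0//; apply: (@le_trans _ _ B).
    by rewrite -lee_fin fineK.
  apply: (@le_trans _ _ (c * (c1 * b ^+ d * psi) ^+ 2)).
    rewrite /c /B le_eqVlt; apply/orP; left; apply/eqP; field; exact: lt0r_neq0.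
  rewrite ler_wpM2l ?(ltW cp)// lerXn2r ?nnegrE ?(ltW cb0) ?(ltW g0)//.
  by rewrite -lee_fin fineK.
split.
  apply: ge_ereal_sup => _ [[b e] be <-] /=.
  have [I [g [gT [I0 /andP[g0 ggT] -> H _]]]] := key b e (mem_set be).
  apply: (@le_trans _ _ (second_moment_ratio f b (ts b e) [set` ts b e])).
    rewrite H lee_fin ler_wpM2l// lef_pV2 ?posrE ?exprn_gt0//; last exact: lt_le_trans ggT.
    by rewrite lerXn2r ?nnegrE ?(ltW g0)// (le_trans (ltW g0)).
  by apply: ereal_sup_ubound; exists (b, e).
apply: ge_ereal_sup => _ [[b e] be <-] /=.
have [I [g [gT [_ _ _ -> H]]]] := key b e (mem_set be).
by rewrite lee_fin.
Qed.
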